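(* Let $n\ge3$, $K>0$, $\alpha\in(0,1)$ (with $\alpha>\frac23$ if $n=3$), and let $X:\mathcal M\times[0,T)\to\mathbb S_K^{n+1}$ be a solution to mean curvature flow whose initial condition $X(\cdot,0)$ is an embedding satisfying \[ |A|^2\le\frac{1}{n-2+\alpha}H^2+2(2-\alpha)K . \] Then there is a constant $\mu<\infty$, depending only on $n$, $\alpha$, $\min_{\mathcal M\times\{0\}}\frac{\underline k}{|H|+\sqrt K}$ and $\max_{\mathcal M\times\{0\}}\frac{\overline k}{|H|+\sqrt K}$, such that \[ \underline k\ge-\mu\big(|H|+\sqrt K\big)\quad\text{and}\quad\overline k\le\mu\big(|H|+\sqrt K\big) \] on $\mathcal M\times[0,T)$.
   Context: $\mathbb S^{n+1}_K\subset\mathbb R^{n+2}$ is the round sphere of constant sectional curvature $K>0$ (radius $K^{-1/2}$). A solution to mean curvature flow is a smooth family of immersions $X(\cdot,t):\mathcal M\to\mathbb S_K^{n+1}$ of a closed $n$-manifold with $\partial_tX=-H\nu$, where $\nu$ is a unit normal field (tangent to the sphere), $A(u,v)=\langle D_u\nu,v\rangle$ is the second fundamental form and $H=\operatorname{tr}A$ the mean curvature. For an embedded hypersurface $\mathcal M\hookrightarrow\mathbb S_K^{n+1}$ (points identified with their images in $\mathbb R^{n+2}$), the inscribed and exscribed curvatures are \[ \overline k(p):=\sup_{q\ne p}\frac{2\langle p-q,\nu(p)\rangle}{\|p-q\|^2},\qquad \underline k(p):=\inf_{q\ne p}\frac{2\langle p-q,\nu(p)\rangle}{\|p-q\|^2},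 \] with the inner product and norm of $\mathbb R^{n+2}$; along the flow, $\overline k(\cdot,t)$ and $\underline k(\cdot,t)$ are those of the hypersurface $X(\cdot,t)$ (embeddedness is preserved by the flow). *)

(* Defs.v *)
From HB Require Import structures.
From mathcomp Require Import all_boot all_order all_algebra.
From mathcomp Require Import all_classical all_reals all_analysis.
Import Order.TTheory GRing.Theory Num.Theory.
Import numFieldNormedType.Exports.

Set Implicit Arguments.
Unset Strict Implicit.
Unset Printing Implicit Defensive.

Local Open Scope classical_set_scope.
Local Open Scope ring_scope.

(* The library norm on row vectors is the sup norm; it is only used for its
   topology.  All metric quantities go through this inner product. *)
Definition dotp (R : realType) (m : nat) (u v : 'rV[R]_m) : R :=
  \sum_(i < m) u 0 i * v 0 i.

Fixpoint Ck (R : realType) (V W : normedModType R) (k : nat) (U : set V)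
    (f : V -> W) : Prop :=
  if k is k'.+1 then
    (forall x, U x -> differentiable f x) /\
    (forall v : V, Ck k' U (fun x => 'D_v f x))
  else forall x, U x -> {for x, continuous f}.

(* [A] need not be open: [f] is smooth on [A] when it extends locally to
   smooth functions on open sets.  This is used on [V x [0, T)]. *)
Definition smooth_on (R : realType) (V W : normedModType R) (A : set V)
    (f : V -> W) : Prop :=
  forall x, A x -> exists (U : set V) (g : V -> W),
    [/\ open U, U x, forall k, Ck k U g & forall y, U y -> A y -> g y = f y].

Record chart (R : realType) (n : nat) (M : topologicalType) := Chart {
  chart_dom : set M;
  chart_tgt : set 'rV[R]_n;
  chart_fwd : M -> 'rV[R]_n;
  chart_bwd : 'rV[R]_n -> M;
  chart_dom_open : open chart_dom;
  chart_tgt_open : open chart_tgt;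
  chart_fwd_in : forall p, chart_dom p -> chart_tgt (chart_fwd p);
  chart_bwd_in : forall x, chart_tgt x -> chart_dom (chart_bwd x);
  chart_fwdK : forall p, chart_dom p -> chart_bwd (chart_fwd p) = p;
  chart_bwdK : forall x, chart_tgt x -> chart_fwd (chart_bwd x) = x;
  chart_fwd_cont : forall p, chart_dom p -> {for p, continuous chart_fwd};
  chart_bwd_cont : forall x, chart_tgt x -> {for x, continuous chart_bwd}
}.

(* [chart_at] selects a chart around each point; it is only used to evaluate
   the chart-independent scalars [meancurv] and [sffnorm2] below. *)
Record smooth_atlas (R : realType) (n : nat) (M : topologicalType) := Atlas {
  atlas_charts : set (chart R n M);
  chart_at : M -> chart R n M;
  chart_at_atlas : forall p, atlas_charts (chart_at p);
  chart_at_dom : forall p, chart_dom (chart_at p) p;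
  atlas_smooth : forall c d, atlas_charts c -> atlas_charts d ->
    smooth_on (chart_tgt c `&` chart_bwd c @^-1` chart_dom d)
              (chart_fwd d \o chart_bwd c)
}.

(* The charts are modelled on all of R^n, so there is no boundary. *)
Definition closed_manifold_space (M : topologicalType) : Prop :=
  [/\ hausdorff_space M, @second_countable M & compact [set: M]].

Definition immersion (R : realType) (n m : nat) (M : topologicalType)
    (S : smooth_atlas R n M) (F : M -> 'rV[R]_m) : Prop :=
  forall c, atlas_charts S c ->
    smooth_on (chart_tgt c) (F \o chart_bwd c) /\
    forall x, chart_tgt c x ->
      forall v, 'D_v (F \o chart_bwd c) x = 0 -> v = 0.

Definition embedding (R : realType) (n m : nat) (M : topologicalType)
    (S : smooth_atlas R n M) (F : M -> 'rV[R]_m) : Prop :=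
  [/\ immersion S F, continuous F, injective F &
      forall U : set M, open U -> exists2 W, open W & U = F @^-1` W].

Definition sphere (R : realType) (m : nat) (K : R) : set 'rV[R]_m :=
  [set x | dotp x x = K^-1].

Definition unit_normal (R : realType) (n : nat) (M : topologicalType)
    (S : smooth_atlas R n M) (F N : M -> 'rV[R]_n.+2) : Prop :=
  [/\ forall p, dotp (N p) (N p) = 1,
      forall p, dotp (N p) (F p) = 0 &
      forall c, atlas_charts S c -> forall x, chart_tgt c x ->
        forall v, dotp (N (chart_bwd c x)) ('D_v (F \o chart_bwd c) x) = 0].

Definition metric_mx (R : realType) (n m : nat) (M : topologicalType)
    (S : smooth_atlas R n M) (F : M -> 'rV[R]_m) (p : M) : 'M[R]_n :=
  let c := chart_at S p in
  \matrix_(i, j) dotp ('D_(delta_mx 0 i) (F \o chart_bwd c) (chart_fwd c p))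
                      ('D_(delta_mx 0 j) (F \o chart_bwd c) (chart_fwd c p)).

(* A(u, v) = <D_u nu, v>; differentiating in R^(n+2) or in the sphere gives the
   same value, as v is tangent to the sphere. *)
Definition sff_mx (R : realType) (n m : nat) (M : topologicalType)
    (S : smooth_atlas R n M) (F N : M -> 'rV[R]_m) (p : M) : 'M[R]_n :=
  let c := chart_at S p in
  \matrix_(i, j) dotp ('D_(delta_mx 0 i) (N \o chart_bwd c) (chart_fwd c p))
                      ('D_(delta_mx 0 j) (F \o chart_bwd c) (chart_fwd c p)).

Definition meancurv (R : realType) (n m : nat) (M : topologicalType)
    (S : smooth_atlas R n M) (F N : M -> 'rV[R]_m) (p : M) : R :=
  \tr (invmx (metric_mx S F p) *m sff_mx S F N p).

(* |A|^2 = g^{ik} g^{jl} A_{ij} A_{kl} *)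
Definition sffnorm2 (R : realType) (n m : nat) (M : topologicalType)
    (S : smooth_atlas R n M) (F N : M -> 'rV[R]_m) (p : M) : R :=
  \tr (invmx (metric_mx S F p) *m sff_mx S F N p
       *m invmx (metric_mx S F p) *m (sff_mx S F N p)^T).

Definition time_interval (R : realType) (T : \bar R) : set R :=
  [set t | 0 <= t /\ (t%:E < T)%E].

Definition smooth_family (R : realType) (n m : nat) (M : topologicalType)
    (S : smooth_atlas R n M) (T : \bar R) (X : R -> M -> 'rV[R]_m) : Prop :=
  forall c, atlas_charts S c ->
    smooth_on (chart_tgt c `*` time_interval T)
      (fun z : 'rV[R]_n * R^o => X z.2 (chart_bwd c z.1)).

(* The time derivative is the limit of difference quotients within [0, T),
   hence one-sided at t = 0. *)
Definition mean_curvature_flow (R : realType) (n : nat) (M : topologicalType)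
    (S : smooth_atlas R n M) (K : R) (T : \bar R)
    (X nu : R -> M -> 'rV[R]_n.+2) : Prop :=
  [/\ smooth_family S T X, smooth_family S T nu &
      forall t, time_interval T t ->
        [/\ forall p, sphere K (X t p),
            immersion S (X t),
            unit_normal S (X t) (nu t) &
            forall p, (s - t)^-1 *: (X s p - X t p)
                        @[s --> within (time_interval T) t^']
                      --> - meancurv S (X t) (nu t) p *: nu t p]].

Definition ball_curv (R : realType) (m : nat) (M : topologicalType)
    (F N : M -> 'rV[R]_m) (p : M) (q : 'rV[R]_m) : R :=
  2 * dotp (F p - q) (N p) / dotp (F p - q) (F p - q).

Definition inscribed_curv (R : realType) (m : nat) (M : topologicalType)
    (F N : M -> 'rV[R]_m) (p : M) : \bar R :=
  ereal_sup [set (ball_curv F N p q)%:E | q in range F `\ F p].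

Definition exscribed_curv (R : realType) (m : nat) (M : topologicalType)
    (F N : M -> 'rV[R]_m) (p : M) : \bar R :=
  ereal_inf [set (ball_curv F N p q)%:E | q in range F `\ F p].

Definition curv_scale (R : realType) (n m : nat) (M : topologicalType)
    (S : smooth_atlas R n M) (K : R) (F N : M -> 'rV[R]_m) (p : M) : R :=
  `|meancurv S F N p| + Num.sqrt K.

(* The infimum and supremum below are attained for a smooth embedding of a
   closed manifold, so they are the minimum and maximum of the two ratios. *)
Definition min_exscribed_ratio (R : realType) (n m : nat) (M : topologicalType)
    (S : smooth_atlas R n M) (K : R) (F N : M -> 'rV[R]_m) : \bar R :=
  ereal_inf [set (exscribed_curv F N p * (curv_scale S K F N p)^-1%:E)%E
            | p in [set: M]].

Definition max_inscribed_ratio (R : realType) (n m : nat) (M : topologicalType)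
    (S : smooth_atlas R n M) (K : R) (F N : M -> 'rV[R]_m) : \bar R :=
  ereal_sup [set (inscribed_curv F N p * (curv_scale S K F N p)^-1%:E)%E
            | p in [set: M]].

(* Main.v *)
(* For 0 < a < 1, the function G = H^2 / (n - 2 + a) + 2(2 - a)K - |A|^2 is, by the
   evolution equations for H and |A|^2, Kato's inequality
   |dA|^2 >= 3/(n+2) |dH|^2 and the maximum principle, positive along the flow as
   soon as it is positive initially (a > 2/3 if n = 3).  Comparing the functions
   G for two exponents a slightly below alpha gives G >= kappa (H^2 + K) for the
   smaller one.  Then sqrt G is, up to constants, |H| + sqrt K, and it is a
   supersolution of the linearised flow: this makes a two-point maximum principle
   applicable to
     Z(p, q) = mu sqrt G(p) |D|^2 / 2 - |<D, nu(p)>|,   D = p - q.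
   At a first zero of Z off the diagonal, the second derivatives of Z in the
   direction of a tangent vector at p and of its reflection at q in the bisector
   of D contradict the supersolution property.  Zeros cannot come from
   the diagonal because mu sqrt G > |A|, nor from a collision because the
   chord length decreases at most exponentially while Z > 0.
   All differentiation takes place in the ring of smooth functions of a chart,
   by means of the tangential derivatives in the n + 2 ambient directions. *)
Require Import Defs.
From HB Require Import structures.
From mathcomp Require Import all_boot all_order all_algebra.
From mathcomp Require Import all_classical all_reals all_analysis.
From mathcomp Require Import ring lra.
Import Order.TTheory GRing.Theory Num.Theory.
Import numFieldNormedType.Exports.

Set Implicit Arguments.
Unset Strict Implicit.
Unset Printing Implicit Defensive.

Local Open Scope classical_set_scope.
Local Open Scope ring_scope.

(** * Extrinsic geometry of hypersurfaces of the sphere *)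

(** Two facts let the argument close. First, put be = n - 4 + 2a. The evolution inequality reads
    (d/dt - Lap) G >= 2 (|A|^2 - be K) G + c K^2 with c > 0, so that phi = mu sqrt G satisfies (d/dt
    - Lap) phi >= phi (|A|^2 - be K) + c' with c' > 0, at least with the square root replaced by its
    tangent at the touching value. A touching pair is impossible as soon as (d/dt - Lap) phi + n K
    phi - 2 K H - |A|^2 phi > 0. The two fit together because |H| <= phi and n - be >= 2, that is a
    <= 1; the constant c' makes the inequality strict. Second, the gradient of phi has a sign at a
    touching pair: the first order condition makes <grad phi, q> a positive multiple of phi |q'|^2 -
    A(q', q'), where q' is the part of q tangent to the hypersurface at p, and |A| <= phi. G is even
    in the normal, so reversing the normal at the touching pair removes the absolute value in Z, and
    the inscribed and exscribed curvatures are treated at once. The inequalities are homogeneous in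
    K, which is why mu does not depend on K. *)

Definition derivation (A : comPzRingType) (d : A -> A) : Prop :=
  (forall u v, d (u + v) = d u + d v) /\
  (forall u v, d (u * v) = d u * v + u * d v).

Section Derivation.
Variables (A : comPzRingType) (d : A -> A).
Hypothesis dder : derivation d.

Lemma derD u v : d (u + v) = d u + d v. Proof. exact: dder.1. Qed.
Lemma derM u v : d (u * v) = d u * v + u * d v. Proof. exact: dder.2. Qed.
Lemma der0 : d 0 = 0.
Proof. by apply: (addrI (d 0)); rewrite -derD !addr0. Qed.
Lemma derN u : d (- u) = - d u.
Proof. by apply: (addrI (d u)); rewrite -derD !subrr der0. Qed.
Lemma derB u v : d (u - v) = d u - d v.
Proof. by rewrite derD derN. Qed.
Lemma der1 : d 1 = 0.
Proof. by apply: (addrI (d 1)); rewrite addr0 -{3}[1]mulr1 derM mulr1 mul1r. Qed.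
Lemma der_nat m : d m%:R = 0.
Proof. by elim: m => [|m IH]; rewrite ?der0 // -addn1 natrD derD IH der1 addr0. Qed.
Lemma der_sum (I : Type) (r : seq I) (P : pred I) (F : I -> A) :
  d (\sum_(i <- r | P i) F i) = \sum_(i <- r | P i) d (F i).
Proof. exact: (big_morph d derD der0). Qed.
Lemma der_dot (I : finType) (u v : I -> A) :
  d (\sum_i u i * v i) = \sum_i d (u i) * v i + \sum_i u i * d (v i).
Proof. by rewrite der_sum -big_split/=; apply: eq_bigr => i _; rewrite derM. Qed.

End Derivation.

Lemma derivation_sum (A : comPzRingType) (I : finType) (c : I -> A)
    (d : I -> A -> A) : (forall i, derivation (d i)) ->
  derivation (fun u => \sum_i c i * d i u).
Proof.
move=> dd; split=> u v.
  by rewrite -big_split/=; apply: eq_bigr => i _; rewrite (derD (dd i)) mulrDr.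
rewrite mulr_suml mulr_sumr -big_split/=; apply: eq_bigr => i _.
by rewrite (derM (dd i)); ring.
Qed.

(* [dl a] stands for the component along the [a]-th coordinate vector of
   R^(n+2) of the tangential gradient; all tensors are contracted with ambient
   indices, so that no frame of the hypersurface is needed. *)
Section Extrinsic.
Variables (A : comPzRingType) (n : nat).
Variables (K : A) (x nu : 'I_n.+2 -> A).
Variables (dl : 'I_n.+2 -> A -> A) (dt : A -> A).

(** The orthogonal projection of R^(n+2) onto the tangent space of the hypersurface; the factor [K]
    normalises the position vector, of squared length 1/K. *)
Let P a b := (a == b)%:R - nu a * nu b - K * x a * x b.
Definition weingarten a b := dl a (nu b).
Let W := weingarten.
Definition mcurv := \sum_a W a a.
Let H := mcurv.
Definition sqnormA := \sum_a \sum_b W a b * W a b.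
Let A2 := sqnormA.
Definition lap u := \sum_a dl a (dl a u).
Definition box u := dt u - lap u.
Definition gdot u v := \sum_a dl a u * dl a v.
Let w2 u a := \sum_c W a c * dl c u.

(** Replaces division by 2 when |nu|^2 = 1 is differentiated. *)
Hypothesis two_reg : forall u : A, u + u = 0 -> u = 0.
Hypothesis dlD : forall a, derivation (dl a).
Hypothesis dtD : derivation dt.
Hypothesis dlK : forall a, dl a K = 0.
Hypothesis dtK : dt K = 0.
Hypothesis nuT : forall u, \sum_a nu a * dl a u = 0.
Hypothesis xT : forall u, \sum_a x a * dl a u = 0.
Hypothesis xx : K * \sum_a x a * x a = 1.
Hypothesis nunu : \sum_a nu a * nu a = 1.
Hypothesis xnu : \sum_a x a * nu a = 0.
Hypothesis dlx : forall a b, dl a (x b) = P a b.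
(** The [dl a] are vector fields with components [P a c], their values on the coordinates [x c]. The
    bracket of two of them is again a tangential field, and its components are its values on the
    coordinates. *)
Hypothesis comm : forall a b u, dl a (dl b u) - dl b (dl a u) =
  \sum_c (dl a (P b c) - dl b (P a c)) * dl c u.

Lemma sum_delta (F : 'I_n.+2 -> A) a : \sum_b (a == b)%:R * F b = F a.
Proof.
rewrite (bigD1 a)//= eqxx mul1r big1 ?addr0// => b /negPf.
by rewrite eq_sym => ->; rewrite mul0r.
Qed.

Lemma sum_P (F : 'I_n.+2 -> A) a : \sum_b P a b * F b =
  F a - nu a * (\sum_b nu b * F b) - K * x a * (\sum_b x b * F b).
Proof.
rewrite !mulr_sumr -{1}(sum_delta F a) -!sumrB; apply: eq_bigr => b _.
by rewrite /P; ring.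
Qed.

Lemma P_sym a b : P a b = P b a.
Proof. by rewrite /P eq_sym; ring. Qed.

Lemma P_nu a : \sum_b P a b * nu b = 0.
Proof. by rewrite sum_P nunu xnu; ring. Qed.

Lemma P_x a : \sum_b P a b * x b = 0.
Proof.
rewrite sum_P (_ : \sum_b nu b * x b = 0); last first.
  by rewrite -[RHS]xnu; apply: eq_bigr => b _; ring.
by rewrite -mulrA [x a * _]mulrC mulrA xx; ring.
Qed.

Lemma P_dl a u : \sum_b P a b * dl b u = dl a u.
Proof. by rewrite sum_P nuT xT; ring. Qed.

Lemma weingarten_nu a : \sum_b W a b * nu b = 0.
Proof.
apply: two_reg; have := der_dot (dlD a) nu nu; rewrite nunu (der1 (dlD a)) => h; rewrite [RHS]h.
by congr (_ + _); apply: eq_bigr => b _; rewrite mulrC.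
Qed.

Lemma weingarten_x a : \sum_b W a b * x b = 0.
Proof.
have := der_dot (dlD a) x nu; rewrite xnu (der0 (dlD a)).
under [X in X + _]eq_bigr do rewrite dlx.
by rewrite P_nu add0r => h; rewrite [RHS]h; apply: eq_bigr => b _; rewrite mulrC.
Qed.

Lemma dlP a b c : dl a (P b c) =
  - (W a b * nu c) - nu b * W a c - K * P a b * x c - K * x b * P a c.
Proof.
rewrite /P !(derB (dlD a)) (der_nat (dlD a)) !(derM (dlD a)) dlK !dlx.
by rewrite -[dl a (nu b)]/(W a b) -[dl a (nu c)]/(W a c) /P; ring.
Qed.

(** The symmetry of [W] is only derived from this commutation rule. The antisymmetric part of [W]
    drops out here because it multiplies <nu, grad u> = 0. *)
Lemma dl_comm a b u : dl a (dl b u) = dl b (dl a u) +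
  nu a * w2 u b - nu b * w2 u a + K * (x a * dl b u - x b * dl a u).
Proof.
apply: (addIr (- dl b (dl a u))); rewrite comm.
transitivity (\sum_c ((W b a - W a b) * (nu c * dl c u)
   + nu a * (W b c * dl c u) - nu b * (W a c * dl c u)
   + (K * P b a - K * P a b) * (x c * dl c u)
   + K * x a * (P b c * dl c u) - K * x b * (P a c * dl c u))).
  by apply: eq_bigr => c _; rewrite !dlP; ring.
rewrite !(big_split, sumrN)/= -!mulr_sumr !P_dl nuT xT -/(w2 u a) -/(w2 u b).
by ring.
Qed.

(** The bracket of two tangential fields is tangential, so its value on the position vector has no
    component along [nu]; computed from the derivatives of [P], that component is
    [W b a - W a b]. *)
Lemma weingarten_sym a b : W a b = W b a.
Proof.
have nuP c : \sum_e nu e * P c e = 0.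
  by rewrite -[RHS](P_nu c); apply: eq_bigr => e _; rewrite mulrC.
have nuD c e : \sum_f nu f * dl c (P e f) = - W c e.
  transitivity (\sum_f (- W c e * (nu f * nu f) - nu e * (W c f * nu f)
    - K * P c e * (x f * nu f) - K * x e * (P c f * nu f))).
    by apply: eq_bigr => f _; rewrite dlP; ring.
  rewrite !(big_split, sumrN)/= -!mulr_sumr nunu xnu P_nu weingarten_nu; ring.
have nuw e : \sum_f nu f * w2 (x f) e = 0.
  under eq_bigr do rewrite mulr_sumr.
  rewrite exchange_big/= big1// => c _.
  rewrite -[RHS](mulr0 (W e c)) -[in RHS](nuP c) mulr_sumr.
  by apply: eq_bigr => f _; rewrite dlx; ring.
have : \sum_f nu f * (dl a (dl b (x f)) - dl b (dl a (x f))) = 0.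
  transitivity (\sum_f (nu a * (nu f * w2 (x f) b) - nu b * (nu f * w2 (x f) a)
     + K * x a * (nu f * P b f) - K * x b * (nu f * P a f))).
    by apply: eq_bigr => f _; rewrite dl_comm !dlx; ring.
  by rewrite !(big_split, sumrN)/= -!mulr_sumr !nuw !nuP; ring.
under eq_bigr do rewrite !dlx mulrBr.
rewrite sumrB !nuD => /eqP; rewrite opprK addrC subr_eq0 => /eqP->.
by [].
Qed.

Lemma tr_P : \sum_a P a a = n%:R.
Proof.
transitivity (\sum_(a < n.+2) (1 - nu a * nu a - K * (x a * x a))).
  by apply: eq_bigr => a _; rewrite /P eqxx mulr1n; ring.
rewrite !(big_split, sumrN)/= -mulr_sumr xx nunu.
rewrite big_const_ord iter_addr addr0 -addn2 natrD.
by ring.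
Qed.

Lemma div_x : \sum_a dl a (x a) = n%:R.
Proof. by rewrite -tr_P; apply: eq_bigr => a _; rewrite dlx. Qed.

Lemma lap_x b : lap (x b) = - (H * nu b) - n%:R * K * x b.
Proof.
rewrite /lap; transitivity (\sum_a (- (W a a * nu b) - nu a * W a b
  - P a a * (K * x b) - K * (x a * P a b))).
  by apply: eq_bigr => a _; rewrite dlx dlP; ring.
rewrite !(big_split, sumrN)/= -!mulr_sumr -!mulr_suml -[\sum_(i < n.+2) W i i]/H tr_P nuT.
have -> : \sum_a x a * P a b = 0.
  by rewrite -[RHS](P_x b); apply: eq_bigr => a _; rewrite P_sym mulrC.
by ring.
Qed.

Lemma sum_w2_nu b : \sum_c nu c * w2 (nu c) b = 0.
Proof.
under eq_bigr do rewrite mulr_sumr.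
rewrite exchange_big/= big1// => c _.
rewrite -[RHS](mulr0 (W b c)) -[in RHS](weingarten_nu c) mulr_sumr.
by apply: eq_bigr => f _; rewrite /W/weingarten; ring.
Qed.

Lemma sum_w2_diag : \sum_c w2 (nu c) c = A2.
Proof.
by apply: eq_bigr => a _; apply: eq_bigr => b _; rewrite -[dl b (nu a)]/(W b a) (weingarten_sym b).
Qed.

(** The traced Codazzi equation: symmetry of [W] exchanges the inner index with [b], and commuting
    the two derivations then produces [dl b] of the divergence of [nu], which is [H]. *)
Lemma lap_nu b : lap (nu b) = dl b H - A2 * nu b - K * H * x b.
Proof.
transitivity (\sum_c (dl b (dl c (nu c)) + nu c * w2 (nu c) b
  - nu b * w2 (nu c) c + K * (W b c * x c) - K * x b * W c c)).
  apply: eq_bigr => c _.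
  rewrite -[dl c (nu b)]/(W c b) weingarten_sym /W /weingarten dl_comm -[dl c (nu c)]/(W c c) -[dl b (nu c)]/(W b c).
  by ring.
rewrite !(big_split, sumrN)/= -!mulr_sumr -(der_sum (dlD b)) -[\sum_(i < n.+2) dl i (nu i)]/H.
rewrite sum_w2_nu sum_w2_diag weingarten_x.
by ring.
Qed.

(* The curvature terms are those of the Gauss equation. *)
Lemma bochner u : \sum_a dl a u * (lap (dl a u) - dl a (lap u)) =
  H * (\sum_a dl a u * w2 u a) - 2%:R * (\sum_a w2 u a * w2 u a)
  + (n%:R - 2%:R) * K * gdot u u.
Proof.
have step1 a c : dl c (dl c (dl a u)) = dl a (dl c (dl c u))
  + (nu c * w2 (dl c u) a - nu a * w2 (dl c u) c
     + K * (x c * dl a (dl c u) - x a * dl c (dl c u)))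
  + (W c c * w2 u a + nu c * dl c (w2 u a) - W c a * w2 u c
     - nu a * dl c (w2 u c)
     + K * (P c c * dl a u + x c * dl c (dl a u)
            - P c a * dl c u - x a * dl c (dl c u))).
  rewrite {1}(dl_comm c a u).
  rewrite !(derD (dlD c), derN (dlD c), derM (dlD c)) dlK !dlx.
  rewrite {1}(dl_comm c a) -[dl c (nu c)]/(W c c) -[dl c (nu a)]/(W c a).
  by ring.
have step2 a : dl a u * (lap (dl a u) - dl a (lap u)) =
  \sum_c ((dl a u * (nu c * w2 (dl c u) a) - (nu a * dl a u) * w2 (dl c u) c
     + K * (dl a u * (x c * dl a (dl c u)))
     - K * dl c (dl c u) * (x a * dl a u))
  + (W c c * (dl a u * w2 u a) + (dl a u) * (nu c * dl c (w2 u a))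
     - w2 u c * (W c a * dl a u)
     - (nu a * dl a u) * dl c (w2 u c)
     + K * P c c * (dl a u * dl a u) + K * (dl a u * (x c * dl c (dl a u)))
     - K * dl c u * (P c a * dl a u) - K * dl c (dl c u) * (x a * dl a u))).
  rewrite /lap (der_sum (dlD a)) -sumrB mulr_sumr; apply: eq_bigr => c _.
  by rewrite step1; ring.
rewrite (eq_bigr _ (fun a _ => step2 a)) {step1 step2} exchange_big/=.
have e1 : \sum_c \sum_a dl a u * (nu c * w2 (dl c u) a) =
          - \sum_a w2 u a * w2 u a.
  (* Differentiating <nu, grad u> = 0 moves the outer derivative onto [nu]; [e2] does the same with
     [x]. *)
  have key d : \sum_c nu c * dl d (dl c u) = - w2 u d.
    apply/eqP; rewrite -subr_eq0 opprK addrC; apply/eqP.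
    by have := der_dot (dlD d) nu (dl^~ u); rewrite nuT (der0 (dlD d)) => h; rewrite [RHS]h.
  rewrite exchange_big/=.
  transitivity (\sum_a \sum_d dl a u * W a d * (- w2 u d)).
    apply: eq_bigr => a _; rewrite -mulr_sumr.
    under eq_bigr do rewrite mulr_sumr.
    rewrite exchange_big/= mulr_sumr; apply: eq_bigr => d _.
    by rewrite -key !mulr_sumr; apply: eq_bigr => c _; ring.
  rewrite exchange_big -sumrN/=; apply: eq_bigr => d _.
  rewrite -mulr_suml mulrN; congr (- (_ * _)).
  by apply: eq_bigr => a _; rewrite weingarten_sym mulrC.
have e2 : \sum_c \sum_a dl a u * (x c * dl a (dl c u)) = - gdot u u.
  rewrite exchange_big/= /gdot -sumrN; apply: eq_bigr => a _.
  rewrite -mulr_sumr -mulrN; congr (_ * _).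
  apply/eqP; rewrite -subr_eq0 opprK addrC; apply/eqP.
  have := der_dot (dlD a) x (dl^~ u); rewrite xT (der0 (dlD a)) => h; rewrite [RHS]h.
  by congr (_ + _); rewrite -{1}(P_dl a); apply: eq_bigr => c _; rewrite dlx.
have Wdl c : \sum_a W c a * dl a u = w2 u c by [].
transitivity (\sum_c (\sum_a dl a u * (nu c * w2 (dl c u) a)
   + K * (\sum_a dl a u * (x c * dl a (dl c u)))
   + W c c * (\sum_a dl a u * w2 u a)
   + (\sum_a dl a u * (nu c * dl c (w2 u a)))
   - w2 u c * w2 u c
   + K * gdot u u * P c c + K * (\sum_a dl a u * (x c * dl c (dl a u)))
   - K * (dl c u * dl c u))).
  apply: eq_bigr => c _.
  rewrite !(big_split, sumrN)/= -!mulr_sumr.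
  rewrite -!mulr_suml nuT xT P_dl Wdl -/(gdot u u).
  by ring.
have e3 : \sum_c \sum_a dl a u * (nu c * dl c (w2 u a)) = 0.
  rewrite exchange_big/= big1// => a _.
  by rewrite -mulr_sumr nuT mulr0.
have e4 : \sum_c \sum_a dl a u * (x c * dl c (dl a u)) = 0.
  rewrite exchange_big/= big1// => a _.
  by rewrite -mulr_sumr xT mulr0.
rewrite !(big_split, sumrN)/= -!mulr_sumr -!mulr_suml e1 e2 e3 e4 -[\sum_(i < n.+2) W i i]/H tr_P -/(gdot u u).
by ring.
Qed.


Hypothesis dtx : forall a, dt (x a) = - (H * nu a).
(** As for [comm]: the commutator is a tangential field, and the coefficients are its values on the
    coordinates, since [dt (x c)] is minus [H * nu c]. *)
Hypothesis tcomm : forall a u, dt (dl a u) - dl a (dt u) =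
  \sum_c (dt (P a c) + dl a (H * nu c)) * dl c u.

Lemma dtP a c : dt (P a c) = - (dt (nu a) * nu c) - nu a * dt (nu c)
  + K * H * nu a * x c + K * H * x a * nu c.
Proof.
rewrite /P !(derB dtD) (der_nat dtD) !(derM dtD) dtK !dtx; ring.
Qed.

(** The commutator of [dt] and [dl a] is tangential; the vanishing of the normal component of its
    value on the position vector is this equation. *)
Lemma dt_nu a : dt (nu a) = dl a H + K * H * x a.
Proof.
have nuP c : \sum_e nu e * P c e = 0.
  by rewrite -[RHS](P_nu c); apply: eq_bigr => e _; rewrite mulrC.
have nudt : \sum_e nu e * dt (nu e) = 0.
  apply: two_reg; have := der_dot dtD nu nu; rewrite nunu (der1 dtD) => h.
  by rewrite [RHS]h; congr (_ + _); apply: eq_bigr => b _; rewrite mulrC.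
have nuW : \sum_e nu e * W a e = 0.
  by rewrite -[RHS](weingarten_nu a); apply: eq_bigr => e _; rewrite mulrC.
have : \sum_e nu e * (dt (dl a (x e)) - dl a (dt (x e))) = 0.
  under eq_bigr do rewrite tcomm mulr_sumr.
  rewrite exchange_big/= big1// => c _.
  rewrite -[RHS](mulr0 (dt (P a c) + dl a (H * nu c))) -[in RHS](nuP c) mulr_sumr.
  by apply: eq_bigr => e _; rewrite dlx P_sym; ring.
have -> : \sum_e nu e * (dt (dl a (x e)) - dl a (dt (x e))) = \sum_e (
    - dt (nu a) * (nu e * nu e) - nu a * (nu e * dt (nu e))
    + K * H * nu a * (x e * nu e) + K * H * x a * (nu e * nu e)
    + dl a H * (nu e * nu e) + H * (nu e * W a e)).
  apply: eq_bigr => e _; rewrite dlx dtP dtx (derN (dlD a)) (derM (dlD a)).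
  by rewrite -[dl a (nu e)]/(W a e); ring.
rewrite !(big_split, sumrN)/= -!mulr_sumr nunu xnu nudt nuW => h.
by apply/eqP; rewrite -subr_eq0 -oppr_eq0 -[X in _ == X]h; apply/eqP; ring.
Qed.

Lemma dt_dl a u : dt (dl a u) = dl a (dt u) + H * w2 u a - nu a * gdot H u.
Proof.
apply: (addIr (- dl a (dt u))); rewrite tcomm.
transitivity (\sum_c ((- dt (nu a) + K * H * x a + dl a H) * (nu c * dl c u)
   - nu a * (dl c H * dl c u) + H * (W a c * dl c u))).
  apply: eq_bigr => c _.
  by rewrite dtP dt_nu (derM (dlD a)) -[dl a (nu c)]/(W a c) dt_nu; ring.
rewrite !(big_split, sumrN)/= -!mulr_sumr nuT -/(w2 u a) -/(gdot H u).
by ring.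
Qed.

Lemma box_x b : box (x b) = n%:R * K * x b.
Proof. by rewrite /box dtx lap_x; ring. Qed.

Lemma box_nu b : box (nu b) = A2 * nu b + 2%:R * K * H * x b.
Proof. by rewrite /box dt_nu lap_nu; ring. Qed.

Lemma boxD u v : box (u + v) = box u + box v.
Proof.
rewrite /box /lap (derD dtD).
under eq_bigr do rewrite !(derD (dlD _)).
by rewrite big_split/=; ring.
Qed.

Lemma boxM u v : box (u * v) = box u * v + u * box v - 2%:R * gdot u v.
Proof.
rewrite /box /lap (derM dtD).
have -> : \sum_a dl a (dl a (u * v)) = \sum_a (dl a (dl a u) * v
    + u * dl a (dl a v) + 2%:R * (dl a u * dl a v)).
  by apply: eq_bigr => a _; rewrite !(derM (dlD _), derD (dlD _)); ring.
by rewrite !big_split/= -!mulr_sumr -mulr_suml /gdot; ring.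
Qed.

Lemma box_sum (I : finType) (F : I -> A) : box (\sum_i F i) = \sum_i box (F i).
Proof.
apply: (big_morph box boxD).
rewrite /box /lap (der0 dtD) big1 ?subr0// => a _.
by rewrite !(der0 (dlD a)).
Qed.

Lemma w2_nu b a : w2 (nu b) a = \sum_c W a c * W c b.
Proof. by []. Qed.

(** [H] is the divergence of [nu]: the divergence of [dt_nu] gives the Laplacian and the term in
    [K], and the commutator of [dt] with the divergence gives |A|^2 H. *)
Lemma box_mcurv : box H = (A2 + n%:R * K) * H.
Proof.
rewrite /box /H /mcurv (der_sum dtD).
have -> : \sum_a dt (W a a) = \sum_a (dl a (dl a H) + K * (x a * dl a H)
    + K * H * dl a (x a) + H * w2 (nu a) a - nu a * gdot H (nu a)).
  apply: eq_bigr => a _; rewrite /W /weingarten dt_dl dt_nu.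
  by rewrite (derD (dlD a)) !(derM (dlD a)) dlK; ring.
rewrite !(big_split, sumrN)/= -!mulr_sumr xT div_x sum_w2_diag.
have -> : \sum_a nu a * gdot H (nu a) = 0.
  under eq_bigr do rewrite mulr_sumr.
  rewrite exchange_big/= big1// => c _.
  rewrite -[RHS](mulr0 (dl c H)) -[in RHS](weingarten_nu c) mulr_sumr.
  by apply: eq_bigr => a _; rewrite -[dl c (nu a)]/(W c a); ring.
by rewrite -/(mcurv) -/H /lap; ring.
Qed.

Lemma box_gdot u : box (gdot u u) = 2%:R * gdot u (box u)
  + 4%:R * (\sum_a w2 u a * w2 u a) - 2%:R * (n%:R - 2%:R) * K * gdot u u
  - 2%:R * (\sum_a \sum_c dl c (dl a u) * dl c (dl a u)).
Proof.
have bo := bochner u.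
rewrite {1}/gdot box_sum.
under eq_bigr do rewrite boxM.
have -> : \sum_a (box (dl a u) * dl a u + dl a u * box (dl a u)
    - 2%:R * gdot (dl a u) (dl a u)) = \sum_a (2%:R * (dl a u * dl a (box u))
    + 2%:R * H * (dl a u * w2 u a) - 2%:R * gdot H u * (nu a * dl a u)
    - 2%:R * (dl a u * (lap (dl a u) - dl a (lap u)))
    - 2%:R * gdot (dl a u) (dl a u)).
  by apply: eq_bigr => a _; rewrite /box dt_dl (derB (dlD a)); ring.
rewrite !(big_split, sumrN)/= -!mulr_sumr nuT bo.
by rewrite /gdot; ring.
Qed.

Definition trA4 := \sum_a \sum_b w2 (nu b) a * w2 (nu b) a.
Definition sqnormdA := \sum_b \sum_a \sum_c dl c (W a b) * dl c (W a b).

Lemma sqnormAE : A2 = \sum_b gdot (nu b) (nu b).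
Proof. exact: exchange_big. Qed.

(** Since |A|^2 is the sum of the |grad nu_b|^2, Simons' identity is obtained from the Bochner
    formula for the coordinate functions of [nu], without covariant derivatives of tensors. *)
Lemma box_sqnormA : box A2 = 2%:R * A2 * A2 + 4%:R * K * H * H + 4%:R * trA4
  - 2%:R * (n%:R - 2%:R) * K * A2 - 2%:R * sqnormdA.
Proof.
rewrite {1}sqnormAE box_sum; under eq_bigr do rewrite box_gdot.
rewrite !(big_split, sumrN)/= -!mulr_sumr -sqnormAE.
have -> : \sum_b gdot (nu b) (box (nu b)) = A2 * A2 + 2%:R * K * H * H.
  transitivity (\sum_b \sum_a (dl a A2 * (W a b * nu b) + A2 * (W a b * W a b)
    + 2%:R * K * dl a H * (W a b * x b) + 2%:R * K * H * (P b a * W a b))).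
    apply: eq_bigr => b _; apply: eq_bigr => a _.
    rewrite box_nu (derD (dlD a)) !(derM (dlD a)) (der_nat (dlD a)) dlK dlx.
    by rewrite -[dl a (nu b)]/(W a b) P_sym; ring.
  rewrite exchange_big/=.
  transitivity (\sum_a (A2 * (\sum_b W a b * W a b) + 2%:R * K * H * W a a)).
    apply: eq_bigr => a _; rewrite !big_split/= -!mulr_sumr.
    rewrite weingarten_nu weingarten_x.
    have -> : \sum_b P b a * W a b = W a a.
      rewrite -[RHS](P_dl a (nu a)); apply: eq_bigr => b _.
      by rewrite -[dl b (nu a)]/(W b a) P_sym weingarten_sym.
    by ring.
  by rewrite big_split/= -!mulr_sumr -[\sum_a \sum_b _]/A2 -[\sum_a W a a]/H.
rewrite [\sum_(b < _) \sum_(a < _) w2 _ _ * _]exchange_big/=.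
rewrite -[\sum_(a < _) \sum_(b < _) w2 (nu b) a * _]/trA4.
rewrite -[\sum_(b < _) \sum_(a < _) \sum_(c < _) _]/sqnormdA.
by ring.
Qed.

(* The covariant derivative of the second fundamental form: the terms after the
   first are minus the components of [dl c (W a b)] along [nu] and [x]. *)
Let T c a b := dl c (W a b) + nu a * w2 (nu b) c + nu b * w2 (nu a) c
  + K * x a * W c b + K * x b * W c a.
Definition dA := T.

(** The correction terms in [dA] are exactly what [dl_comm], applied to [nu b], leaves when the
    first two indices are exchanged. *)
Lemma dA_codazzi c a b : dA c a b = dA a c b.
Proof.
have h : dl c (W a b) = dl a (W c b) + nu c * w2 (nu b) a - nu a * w2 (nu b) c
    + K * (x c * W a b - x a * W c b).
  by rewrite {1}/W {1}/weingarten dl_comm.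
have e : w2 (nu c) a = w2 (nu a) c.
  rewrite !w2_nu; apply: eq_bigr => d _.
  by rewrite (weingarten_sym a d) (weingarten_sym d c) mulrC.
by rewrite /dA /T h e (weingarten_sym a c); ring.
Qed.

Lemma dA_sym c a b : dA c a b = dA c b a.
Proof. by rewrite /dA /T (weingarten_sym a b); ring. Qed.

Lemma dA_nu c a : \sum_b dA c a b * nu b = 0.
Proof.
transitivity (\sum_b (dl c (W a b) * nu b + nu a * (nu b * w2 (nu b) c)
   + w2 (nu a) c * (nu b * nu b) + K * x a * (W c b * nu b)
   + K * W c a * (x b * nu b))).
  by apply: eq_bigr => b _; rewrite /dA /T; ring.
rewrite !big_split/= -!mulr_sumr sum_w2_nu nunu weingarten_nu xnu.
have := der_dot (dlD c) (W a) nu; rewrite weingarten_nu (der0 (dlD c)).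
have -> : \sum_i W a i * dl c (nu i) = w2 (nu a) c.
  rewrite w2_nu; apply: eq_bigr => i _.
  by rewrite -[dl c (nu i)]/(W c i) (weingarten_sym a) mulrC.
by move=> h; rewrite [RHS]h; ring.
Qed.

Lemma dA_x c a : \sum_b dA c a b * x b = 0.
Proof.
have nux : \sum_b nu b * x b = 0.
  by rewrite -[RHS]xnu; apply: eq_bigr => b _; ring.
have xw : \sum_b x b * w2 (nu b) c = 0.
  under eq_bigr do rewrite w2_nu mulr_sumr.
  rewrite exchange_big/= big1// => d _.
  rewrite -[RHS](mulr0 (W c d)) -[in RHS](weingarten_x d) mulr_sumr.
  by apply: eq_bigr => b _; ring.
transitivity (\sum_b (dl c (W a b) * x b + nu a * (x b * w2 (nu b) c)
   + w2 (nu a) c * (nu b * x b) + K * x a * (W c b * x b)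
   + W c a * (K * (x b * x b)))).
  by apply: eq_bigr => b _; rewrite /dA /T; ring.
rewrite !big_split/= -!mulr_sumr xw nux weingarten_x xx.
have := der_dot (dlD c) (W a) x; rewrite weingarten_x (der0 (dlD c)).
have -> : \sum_i W a i * dl c (x i) = W c a.
  rewrite -[RHS](P_dl c (nu a)); apply: eq_bigr => i _.
  by rewrite dlx -[dl i (nu a)]/(W i a) (weingarten_sym a) mulrC.
by move=> h; rewrite [RHS]h; ring.
Qed.

Lemma dA_tr c : \sum_a dA c a a = dl c H.
Proof.
transitivity (\sum_a (dl c (W a a) + 2%:R * (nu a * w2 (nu a) c)
   + 2%:R * K * (W c a * x a))).
  by apply: eq_bigr => a _; rewrite /dA /T; ring.
rewrite !big_split/= -!mulr_sumr sum_w2_nu weingarten_x -(der_sum (dlD c)).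
by rewrite -[\sum_a W a a]/H; ring.
Qed.

(** Ambient derivatives of the entries of [W] also see the normal directions. Their contribution
    cancels the quartic trace in [box_sqnormA], leaving the covariant derivative of A. *)
Lemma sqnormdAE : sqnormdA =
  \sum_c \sum_a \sum_b dA c a b * dA c a b + 2%:R * trA4 + 2%:R * K * A2.
Proof.
have -> : sqnormdA = \sum_c \sum_a \sum_b dl c (W a b) * dl c (W a b).
  rewrite /sqnormdA exchange_big/=; under eq_bigr do rewrite exchange_big/=.
  by rewrite exchange_big.
have -> : trA4 = \sum_c \sum_b w2 (nu b) c * w2 (nu b) c by [].
rewrite !mulr_sumr -!big_split/=; apply: eq_bigr => c _.
(* For fixed [c], the matrix of derivatives of [W] is [dA] minus [S]; [dA] is tangential in both
   indices and [S] is orthogonal to such matrices, so the squares add. *)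
pose p b := w2 (nu b) c; pose q b := W c b.
pose S a b := nu a * p b + nu b * p a + K * x a * q b + K * x b * q a.
have nux : \sum_b nu b * x b = 0.
  by rewrite -[RHS]xnu; apply: eq_bigr => b _; ring.
have nup : \sum_b nu b * p b = 0 by exact: sum_w2_nu.
have nuq : \sum_b nu b * q b = 0.
  by rewrite -[RHS](weingarten_nu c); apply: eq_bigr => b _; rewrite mulrC.
have xq : \sum_b x b * q b = 0.
  by rewrite -[RHS](weingarten_x c); apply: eq_bigr => b _; rewrite mulrC.
have xp : \sum_b x b * p b = 0.
  under eq_bigr do rewrite /p w2_nu mulr_sumr.
  rewrite exchange_big/= big1// => d _.
  rewrite -[RHS](mulr0 (W c d)) -[in RHS](weingarten_x d) mulr_sumr.
  by apply: eq_bigr => b _; ring.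
have main a b : dl c (W a b) * dl c (W a b) = dA c a b * dA c a b
    - 2%:R * (S a b * dA c a b) + S a b * S a b.
  by rewrite /S /p /q /dA /T; ring.
under eq_bigr do under eq_bigr do rewrite main.
have sum2 (f g : 'I_n.+2 -> A) : \sum_a \sum_b f a * g b =
    (\sum_a f a) * (\sum_b g b).
  by rewrite mulr_suml; apply: eq_bigr => a _; rewrite mulr_sumr.
have ST : \sum_a \sum_b S a b * dA c a b = 0.
  have r1 a : \sum_b S a b * dA c a b =
      nu a * (\sum_b p b * dA c a b) + K * x a * (\sum_b q b * dA c a b).
    transitivity (\sum_b (nu a * (p b * dA c a b) + p a * (dA c a b * nu b)
      + K * x a * (q b * dA c a b) + K * q a * (dA c a b * x b))).
      by apply: eq_bigr => b _; rewrite /S; ring.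
    by rewrite !big_split/= -!mulr_sumr dA_nu dA_x; ring.
  under eq_bigr do rewrite r1 !mulr_sumr.
  rewrite big_split/= exchange_big/= [X in _ + X]exchange_big/=.
  rewrite !big1 ?addr0// => b _.
    transitivity (K * q b * \sum_a dA c b a * x a).
      rewrite mulr_sumr; apply: eq_bigr => a _.
      by rewrite (dA_sym c b); ring.
    by rewrite dA_x mulr0.
  transitivity (p b * \sum_a dA c b a * nu a).
    rewrite mulr_sumr; apply: eq_bigr => a _.
    by rewrite (dA_sym c b); ring.
  by rewrite dA_nu mulr0.
have SS : \sum_a \sum_b S a b * S a b =
    2%:R * (\sum_b p b * p b) + 2%:R * K * (\sum_b q b * q b).
  transitivity (\sum_a \sum_b (
      (nu a * nu a) * (p b * p b) + (p a * p a) * (nu b * nu b)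
    + (K * K * (x a * x a)) * (q b * q b) + (q a * q a) * (K * K * (x b * x b))
    + 2%:R * (nu a * p a) * (nu b * p b)
    + (2%:R * K * (nu a * x a)) * (p b * q b)
    + (2%:R * K * (nu a * q a)) * (x b * p b)
    + (2%:R * K * (x a * p a)) * (nu b * q b)
    + (p a * q a) * (2%:R * K * (nu b * x b))
    + (2%:R * K * K * (x a * q a)) * (x b * q b))).
    by apply: eq_bigr => a _; apply: eq_bigr => b _; rewrite /S; ring.
  under eq_bigr do rewrite !big_split/=.
  rewrite !big_split/= !sum2 -!mulr_sumr nunu nux nup nuq xp xq -!mulrA.
  by rewrite (mulrA K _ (\sum_b _)) !xx; ring.
under eq_bigr do rewrite !(big_split, sumrN)/= -mulr_sumr.
rewrite !(big_split, sumrN)/= -mulr_sumr ST SS /p /q.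
by rewrite mulr0 subr0 !mulr_sumr addrA.
Qed.

Definition sqnormT := \sum_c \sum_a \sum_b dA c a b * dA c a b.

Lemma sum_P_sq : \sum_a \sum_b P a b * P a b = n%:R.
Proof.
rewrite -tr_P; apply: eq_bigr => a _.
rewrite -[RHS](dlx a a) -[RHS](P_dl a (x a)); apply: eq_bigr => b _.
by rewrite dlx (P_sym b).
Qed.

Let h c := dl c H.

(** The totally symmetric tensor built from the metric and the gradient of H. Its trace is (n + 2)
    dH, so [Q] divided by n + 2 is the trace part of [dA]. *)
Let Q c a b := P a b * h c + P c a * h b + P c b * h a.

Lemma sum_Q_sq : \sum_c \sum_a \sum_b Q c a b * Q c a b =
  3%:R * (n%:R + 2%:R) * gdot H H.
Proof.
have PP c b : \sum_a P a b * P c a = P c b.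
  rewrite -[RHS]dlx -(P_dl c (x b)); apply: eq_bigr => a _.
  by rewrite dlx mulrC.
have Ph c : \sum_a P c a * h a = h c by exact: P_dl.
transitivity (\sum_c \sum_a \sum_b (
    (P a b * P a b) * (h c * h c) + (P c a * P c a) * (h b * h b)
    + (P c b * P c b) * (h a * h a) + 2%:R * h c * P c a * (P a b * h b)
    + 2%:R * h c * h a * (P c b * P a b)
    + 2%:R * P c a * h a * (P c b * h b))).
  by apply: eq_bigr => c _; apply: eq_bigr => a _; apply: eq_bigr => b _;
     rewrite /Q; ring.
have e c : \sum_a \sum_b (
    (P a b * P a b) * (h c * h c) + (P c a * P c a) * (h b * h b)
    + (P c b * P c b) * (h a * h a) + 2%:R * h c * P c a * (P a b * h b)
    + 2%:R * h c * h a * (P c b * P a b)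
    + 2%:R * P c a * h a * (P c b * h b)) =
    n%:R * (h c * h c) + 2%:R * (\sum_a P c a * P c a) * gdot H H
    + 6%:R * (h c * h c).
  have PP' a : \sum_b P c b * P a b = P c a.
    by rewrite -[RHS]PP; apply: eq_bigr => b _; rewrite (P_sym b) mulrC.
  transitivity (\sum_a ((\sum_b P a b * P a b) * (h c * h c)
    + (P c a * P c a) * gdot H H + (\sum_b P c b * P c b) * (h a * h a)
    + 6%:R * h c * (P c a * h a))).
    apply: eq_bigr => a _.
    rewrite !big_split/= -!mulr_sumr -!mulr_suml !Ph (PP' a) -/(gdot H H). ring.
  rewrite !big_split/= -!mulr_sumr -!mulr_suml Ph sum_P_sq -/(gdot H H); ring.
under eq_bigr do rewrite e.
rewrite !big_split/= -!mulr_sumr -!mulr_suml -mulr_sumr sum_P_sq.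
rewrite -/(gdot H H); ring.
Qed.

Lemma sum_dA_Q : \sum_c \sum_a \sum_b dA c a b * Q c a b = 3%:R * gdot H H.
Proof.
have t1 c : \sum_a \sum_b dA c a b * P a b = h c.
  rewrite -[RHS]dA_tr; apply: eq_bigr => a _.
  transitivity (\sum_b P a b * dA c a b).
    by apply: eq_bigr => b _; rewrite mulrC.
  have n0 : \sum_b nu b * dA c a b = 0.
    by rewrite -[RHS](dA_nu c a); apply: eq_bigr => b _; rewrite mulrC.
  have x0 : \sum_b x b * dA c a b = 0.
    by rewrite -[RHS](dA_x c a); apply: eq_bigr => b _; rewrite mulrC.
  by rewrite sum_P n0 x0; ring.
transitivity (\sum_c \sum_a \sum_b dA c a b * P a b * h c
  + \sum_c \sum_a \sum_b dA c a b * P c a * h b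
  + \sum_c \sum_a \sum_b dA c a b * P c b * h a).
  rewrite -!big_split/=; apply: eq_bigr => c _.
  rewrite -!big_split/=; apply: eq_bigr => a _.
  rewrite -!big_split/=; apply: eq_bigr => b _.
  by rewrite /Q; ring.
have e1 : \sum_c \sum_a \sum_b dA c a b * P a b * h c = gdot H H.
  apply: eq_bigr => c _; under eq_bigr do rewrite -mulr_suml.
  by rewrite -mulr_suml t1.
have e2 : \sum_c \sum_a \sum_b dA c a b * P c a * h b = gdot H H.
  under eq_bigr do rewrite exchange_big/=.
  rewrite exchange_big/= -[RHS]e1; apply: eq_bigr => b _.
  apply: eq_bigr => c _; apply: eq_bigr => a _.
  by rewrite (dA_sym c a b) (dA_codazzi c b a).
have e3 : \sum_c \sum_a \sum_b dA c a b * P c b * h a = gdot H H.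
  rewrite exchange_big/= -[RHS]e1; apply: eq_bigr => a _.
  apply: eq_bigr => c _; apply: eq_bigr => b _.
  by rewrite (dA_codazzi c a b).
by rewrite e1 e2 e3; ring.
Qed.

(* The trace-free part of the totally symmetric tensor [dA], up to the factor
   [n + 2]. *)
Lemma kato : \sum_c \sum_a \sum_b
    ((n%:R + 2%:R) * dA c a b - Q c a b) * ((n%:R + 2%:R) * dA c a b - Q c a b)
  = (n%:R + 2%:R) * ((n%:R + 2%:R) * sqnormT - 3%:R * gdot H H).
Proof.
transitivity ((n%:R + 2%:R) * (n%:R + 2%:R) * sqnormT
  - 2%:R * (n%:R + 2%:R) * (\sum_c \sum_a \sum_b dA c a b * Q c a b)
  + \sum_c \sum_a \sum_b Q c a b * Q c a b).
  rewrite /sqnormT !mulr_sumr -sumrB -big_split/=; apply: eq_bigr => c _.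
  rewrite !mulr_sumr -sumrB -big_split/=; apply: eq_bigr => a _.
  rewrite !mulr_sumr -sumrB -big_split/=; apply: eq_bigr => b _.
  by ring.
by rewrite sum_dA_Q sum_Q_sq; ring.
Qed.

Lemma box_pinching (a b : A) :
    (forall c, dl c a = 0) -> (forall c, dl c b = 0) -> dt a = 0 -> dt b = 0 ->
  box (a * H * H + b * K - A2) =
    2%:R * (sqnormT - a * gdot H H) + 2%:R * a * (A2 + n%:R * K) * H * H
    - 2%:R * A2 * A2 - 4%:R * K * H * H + 2%:R * n%:R * K * A2.
Proof.
move=> da db ta tb.
have const c : (forall e, dl e c = 0) -> dt c = 0 -> box c = 0.
  move=> dc tc; rewrite /box tc /lap big1 ?subr0// => e _.
  by rewrite dc (der0 (dlD e)).
have gda u : gdot a u = 0 by rewrite /gdot big1// => e _; rewrite da mul0r.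
have -> : a * H * H + b * K - A2 = a * (H * H) + (b * K + (-1) * A2) by ring.
rewrite !(boxD, boxM) (const a) // (const b) // (const K) // gda.
rewrite (const (-1)); last 2 first.
- by move=> e; rewrite (derN (dlD e)) (der1 (dlD e)) oppr0.
- by rewrite (derN dtD) (der1 dtD) oppr0.
have -> : gdot b K = 0 by rewrite /gdot big1// => e _; rewrite db mul0r.
have -> : gdot (-1) A2 = 0.
  rewrite /gdot big1// => e _.
  by rewrite (derN (dlD e)) (der1 (dlD e)) oppr0 mul0r.
rewrite box_mcurv box_sqnormA sqnormdAE -/sqnormT; ring.
Qed.

End Extrinsic.

(** * Tangential derivations in a chart *)

Section Chart.
Variables (A : comPzRingType) (n : nat).
Variables (K : A) (x nu : 'I_n.+2 -> A) (pd : 'I_n -> A -> A) (dt : A -> A).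
Variable gi : 'M[A]_n.

Let F : 'M[A]_(n, n.+2) := \matrix_(i, a) pd i (x a).
Let N : 'M[A]_(n, n.+2) := \matrix_(i, a) pd i (nu a).
(** In index notation g^{kl} (d_l x_a) (d_k u), the [a]-th ambient component of the tangential
    gradient. *)
Definition tdl (a : 'I_n.+2) (u : A) : A := \sum_k (gi *m F) k a * pd k u.
Let dl := tdl.
Let P a b := (a == b)%:R - nu a * nu b - K * x a * x b.

Hypothesis two_reg : forall u : A, u + u = 0 -> u = 0.
Hypothesis pdD : forall i, derivation (pd i).
Hypothesis dtD : derivation dt.
Hypothesis pdC : forall i j u, pd i (pd j u) = pd j (pd i u).
Hypothesis dtC : forall i u, dt (pd i u) = pd i (dt u).
Hypothesis pdK : forall i, pd i K = 0.
Hypothesis xx : K * \sum_a x a * x a = 1.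
Hypothesis nunu : \sum_a nu a * nu a = 1.
Hypothesis xnu : \sum_a x a * nu a = 0.
Hypothesis nuF : forall i, \sum_a nu a * pd i (x a) = 0.
Hypothesis giP : gi *m (F *m F^T) = 1%:M.

Lemma giPr : (F *m F^T) *m gi = 1%:M.
Proof. exact: mulmx1C. Qed.

Lemma gi_sym : gi^T = gi.
Proof.
rewrite -[LHS]mul1mx -giP -mulmxA.
have -> : F *m F^T *m gi^T = 1%:M.
  by apply: trmx_inj; rewrite trmx1 trmx_mul trmxK trmx_mul trmxK giP.
by rewrite mulmx1.
Qed.

Lemma xF i : \sum_a x a * pd i (x a) = 0.
Proof.
apply: two_reg.
have s0 : pd i (\sum_a x a * x a) = 0.
  have := congr1 (pd i) xx; rewrite (derM (pdD i)) pdK mul0r add0r (der1 (pdD i)).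
  move=> h; rewrite -[LHS]mul1r -xx.
  by rewrite mulrAC h mul0r.
rewrite -[RHS]s0 (der_dot (pdD i)); congr (_ + _).
by apply: eq_bigr => a _; rewrite mulrC.
Qed.

(** The rows x, nu and the coordinate tangent vectors form a square matrix, and [C] collects the
    dual frame. Over a commutative ring a right inverse is a left inverse, and C B = 1 is the
    decomposition of the identity into its three projections. *)
Lemma Px a b : \sum_k (gi *m F) k a * pd k (x b) = P a b.
Proof.
pose rx : 'rV[A]_n.+2 := \row_a x a.
pose rn : 'rV[A]_n.+2 := \row_a nu a.
pose B : 'M[A]_(n.+2) := col_mx rx (col_mx rn F) : 'M[A]_(1 + (1 + n), n.+2).
pose C : 'M[A]_(n.+2) :=
  row_mx (K *: rx^T) (row_mx rn^T (gi *m F)^T) : 'M[A]_(n.+2, 1 + (1 + n)).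
have d11 (u v : 'I_n.+2 -> A) : \row_a u a *m (\row_a v a)^T =
    (\sum_a u a * v a)%:M.
  apply/matrixP => i j; rewrite !ord1 !mxE eqxx mulr1n.
  by apply: eq_bigr => c _; rewrite !mxE.
have rF (u : 'I_n.+2 -> A) : (forall i, \sum_a u a * pd i (x a) = 0) ->
    F *m (\row_a u a)^T = 0.
  move=> h; apply/matrixP => i j; rewrite !mxE -[RHS](h i).
  by apply: eq_bigr => c _; rewrite !mxE mulrC.
have Fr (u : 'I_n.+2 -> A) : (forall i, \sum_a u a * pd i (x a) = 0) ->
    (\row_a u a) *m F^T = 0.
  by move=> h; apply: trmx_inj; rewrite trmx_mul trmxK rF// trmx0.
have BC : B *m C = 1%:M.
  rewrite /B /C.
  have -> : (1%:M : 'M[A]_n.+2) = block_mx 1%:M 0 0 (block_mx 1%:M 0 0 1%:M)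
     :> 'M[A]_(1 + (1 + n)).
    by rewrite -!scalar_mx_block.
  rewrite (mul_col_row rx _ (K *: rx^T)) (mul_mx_row rx rn^T) (mul_col_mx rn).
  rewrite (mul_col_row rn _ rn^T).
  rewrite trmx_mul !mulmxA gi_sym Fr; last exact: xF.
  rewrite Fr// giPr rF// -!scalemxAr rF; last exact: xF.
  rewrite !d11 xnu nunu (_ : \sum_a nu a * x a = 0); last first.
    by rewrite -[RHS]xnu; apply: eq_bigr => c _; rewrite mulrC.
  rewrite !scale_scalar_mx xx mulr0 !raddf0.
  by rewrite !mul0mx row_mx0 col_mx0.
have := mulmx1C BC; rewrite /B /C.
rewrite (mul_row_col (K *: rx^T)) (mul_row_col rn^T _ rn) => /matrixP/(_ a b).
rewrite !mxE !big_ord1 !mxE => e.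
have -> : \sum_k (gi *m F) k a * pd k (x b) = \sum_j ((gi *m F)^T) a j * F j b.
  by apply: eq_bigr => k _; rewrite [RHS]mulrC !mxE mulrC.
by rewrite /P -e; ring.
Qed.

Lemma FE k l : \sum_a F k a * (gi *m F) l a = (k == l)%:R.
Proof.
have := congr1 (fun M : 'M[A]_n => M l k) giP; rewrite mulmxA mxE [1%:M _ _]mxE eq_sym => <-.
by apply: eq_bigr => a _; rewrite [_^T _ _]mxE mulrC.
Qed.

Lemma pdE k u : pd k u = \sum_c pd k (x c) * dl c u.
Proof.
under eq_bigr do rewrite mulr_sumr.
rewrite exchange_big/=.
transitivity (\sum_l (k == l)%:R * pd l u); last first.
  apply: eq_bigr => l _; rewrite -FE mulr_suml; apply: eq_bigr => c _.
  by rewrite [in LHS]mxE; ring.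
rewrite (bigD1 k)//= eqxx mul1r big1 ?addr0// => b /negPf.
by rewrite eq_sym => ->; rewrite mul0r.
Qed.

Lemma tdlD a : derivation (dl a).
Proof. by apply: derivation_sum => i; exact: pdD. Qed.

Lemma tdlK a : dl a K = 0.
Proof. by rewrite /dl /tdl big1// => k _; rewrite pdK mulr0. Qed.

Lemma sum_rF_tdl (v : 'I_n.+2 -> A) u :
  (forall i, \sum_a v a * pd i (x a) = 0) -> \sum_a v a * dl a u = 0.
Proof.
move=> h; under eq_bigr do rewrite mulr_sumr.
rewrite exchange_big/= big1// => k _.
transitivity ((\sum_a v a * (gi *m F) k a) * pd k u).
  by rewrite mulr_suml; apply: eq_bigr => a _; ring.
rewrite (_ : \sum_a _ = 0) ?mul0r//.
under eq_bigr do rewrite mxE mulr_sumr.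
rewrite exchange_big/= big1// => i _.
rewrite -[RHS](mulr0 (gi k i)) -[in RHS](h i) mulr_sumr.
by apply: eq_bigr => a _; rewrite !mxE; ring.
Qed.

Lemma nu_tdl u : \sum_a nu a * dl a u = 0.
Proof. exact: sum_rF_tdl. Qed.

Lemma x_tdl u : \sum_a x a * dl a u = 0.
Proof. by apply: sum_rF_tdl => i; exact: xF. Qed.

Lemma tdl_x a b : dl a (x b) = P a b.
Proof. exact: Px. Qed.

(** Second derivatives cancel since the [pd i] commute, so the commutator is a first order operator
    in the coordinates; testing it on the functions [x c] and using the chain rule [pdE] gives its
    ambient form. *)
Lemma tdl_comm a b u : dl a (dl b u) - dl b (dl a u) =
  \sum_c (dl a (P b c) - dl b (P a c)) * dl c u.
Proof.
pose V k := dl a ((gi *m F) k b) - dl b ((gi *m F) k a).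
have VE v : dl a (dl b v) - dl b (dl a v) = \sum_k V k * pd k v.
  rewrite {2}/dl {3}/dl /tdl !(der_sum (tdlD _)).
  transitivity ((\sum_k (dl a ((gi *m F) k b) * pd k v
      + (gi *m F) k b * dl a (pd k v))) -
    \sum_k (dl b ((gi *m F) k a) * pd k v + (gi *m F) k a * dl b (pd k v))).
    by congr (_ - _); apply: eq_bigr => k _; rewrite (derM (tdlD _)).
  rewrite !big_split/= /V.
  have -> : \sum_k (gi *m F) k b * dl a (pd k v) =
            \sum_k (gi *m F) k a * dl b (pd k v).
    rewrite /dl /tdl.
    under eq_bigr do rewrite mulr_sumr.
    under [RHS]eq_bigr do rewrite mulr_sumr.
    rewrite exchange_big/=; apply: eq_bigr => k _; apply: eq_bigr => l _.
    by rewrite pdC; ring.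
  rewrite opprD addrACA subrr addr0 -sumrB.
  by apply: eq_bigr => k _; ring.
rewrite VE.
transitivity (\sum_c (\sum_k V k * pd k (x c)) * dl c u); last first.
  by apply: eq_bigr => c _; rewrite -VE !tdl_x.
under [RHS]eq_bigr do rewrite mulr_suml.
rewrite exchange_big/=; apply: eq_bigr => k _.
by rewrite pdE mulr_sumr; apply: eq_bigr => c _; ring.
Qed.

Lemma tdl_tcomm f a u : (forall c, dt (x c) = - (f * nu c)) ->
  dt (dl a u) - dl a (dt u) =
  \sum_c (dt (P a c) + dl a (f * nu c)) * dl c u.
Proof.
move=> dtx; pose V k := dt ((gi *m F) k a).
have VE v : dt (dl a v) - dl a (dt v) = \sum_k V k * pd k v.
  rewrite /dl /tdl (der_sum dtD) -sumrB; apply: eq_bigr => k _.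
  by rewrite (derM dtD) dtC addrK.
rewrite VE.
transitivity (\sum_c (\sum_k V k * pd k (x c)) * dl c u); last first.
  by apply: eq_bigr => c _; rewrite -VE !tdl_x dtx (derN (tdlD a)) opprK.
under [RHS]eq_bigr do rewrite mulr_suml.
rewrite exchange_big/=; apply: eq_bigr => k _.
by rewrite pdE mulr_sumr; apply: eq_bigr => c _; ring.
Qed.

Lemma weingartenE a b : weingarten nu dl a b = ((gi *m F)^T *m N) a b.
Proof. by rewrite mxE; apply: eq_bigr => k _; rewrite !mxE. Qed.

Lemma mcurvE : mcurv nu dl = \tr (gi *m (N *m F^T)).
Proof.
rewrite [RHS]mxtrace_mulC -[in RHS]gi_sym -mulmxA -trmx_mul mxtrace_mulC.
by apply: eq_bigr => a _; rewrite weingartenE.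
Qed.

(** The Weingarten equation: the derivatives of [nu] are orthogonal to [nu] and to [x], hence equal
    to their projections on the span of the rows of [F]. *)
Lemma N_tangent : N = N *m F^T *m gi *m F.
Proof.
rewrite -!mulmxA -{1}gi_sym (mulmxA F^T) -trmx_mul; apply/matrixP => i b.
rewrite [RHS]mxE.
have -> : \sum_j N i j * ((gi *m F)^T *m F) j b = \sum_j N i j * P b j.
  apply: eq_bigr => c _; congr (_ * _); rewrite -[RHS]/(P b c) /P.
  transitivity (P c b); last by rewrite /P eq_sym; ring.
  rewrite -Px [LHS]mxE; apply: eq_bigr => k _.
  by rewrite [_^T _ _]mxE [F k b]mxE.
have nuN : \sum_j nu j * N i j = 0.
  apply: two_reg; have := der_dot (pdD i) nu nu.
  rewrite nunu (der1 (pdD i)) => h; rewrite [RHS]h.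
  by congr (_ + _); apply: eq_bigr => c _; rewrite mxE// mulrC.
have xN : \sum_j x j * N i j = 0.
  have := der_dot (pdD i) x nu; rewrite xnu (der0 (pdD i)) => h; rewrite [RHS]h.
  rewrite -[LHS]add0r -{1}(nuF i); congr (_ + _); apply: eq_bigr => c _.
    by rewrite mulrC.
  by rewrite mxE.
transitivity (\sum_j ((b == j)%:R * N i j - nu b * (nu j * N i j)
   - K * x b * (x j * N i j))); last first.
  by apply: eq_bigr => c _; rewrite /P; ring.
rewrite !(big_split, sumrN)/= -!mulr_sumr nuN xN (bigD1 b)//= eqxx big1.
  by rewrite mulr1n; ring.
by move=> c /negPf; rewrite eq_sym => ->; rewrite mul0r.
Qed.

Lemma sqnormAE_chart : sqnormA nu dl =
  \tr (gi *m (N *m F^T) *m gi *m (N *m F^T)^T).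
Proof.
transitivity (\tr ((gi *m F)^T *m N *m ((gi *m F)^T *m N)^T)).
  apply: eq_bigr => a _; rewrite [RHS]mxE; apply: eq_bigr => b _.
  by rewrite !weingartenE [X in _ = _ * X]mxE.
have -> : (gi *m F)^T *m N *m ((gi *m F)^T *m N)^T =
    (gi *m F)^T *m (N *m N^T *m (gi *m F)).
  by rewrite [X in _ *m X]trmx_mul trmxK !mulmxA.
rewrite mxtrace_mulC -!mulmxA.
have -> : gi *m (F *m (gi *m F)^T) = gi.
  by rewrite trmx_mul gi_sym !mulmxA -(mulmxA gi) -(mulmxA gi) giPr mulmx1.
by rewrite mulmxA mxtrace_mulC {1}N_tangent trmx_mul trmxK !mulmxA.
Qed.

End Chart.

(** * Smooth functions *)

Lemma near_eq_differentiable (R : numFieldType) (V W : normedModType R)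
    (f g : V -> W) (x : V) :
  (\near x, f x = g x) -> differentiable f x -> differentiable g x.
Proof.
move=> fg df.
have dfc : continuous ('d f x) by exact: diff_continuous.
have gE : g \o shift x = cst (g x) + 'd f x +o_ 0 id.
  apply/eqaddoP => _ /posnumP[e].
  have /eqaddoE/eqaddoP/(_ e%:num (gt0 e)) := diff_locally df.
  move=> h; near=> y.
  have -> : (g \o shift x - (cst (g x) + 'd f x)) y =
            (f \o shift x - (cst (f x) + 'd f x)) y.
    rewrite /= !fctE /= (nbhs_singleton fg); congr (_ - _).
    near: y; have := fg; rewrite (near_shift 0 x)/=.
    by apply: filterS => z /=; rewrite subr0 => ->.
  by near: y.
apply/diff_locallyP; rewrite (diff_unique dfc gE); split => //.
Unshelve. all: by end_near. Qed.

Section CkTheory.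
Variables (R : realType) (V : normedModType R).
Implicit Types (U : set V) (k : nat).

Section Gen.
Variable W : normedModType R.
Implicit Types f g : V -> W.

Lemma near_open U x (P : V -> Prop) : open U -> U x -> (forall y, U y -> P y) ->
  \forall y \near x, P y.
Proof. by move=> oU Ux h; apply: filterS h _; exact: open_nbhs_nbhs. Qed.

Lemma Ck_ext k U f g : open U -> (forall x, U x -> f x = g x) ->
  Ck k U f -> Ck k U g.
Proof.
move=> oU; elim: k f g => [|k IH] f g fg /=.
  move=> cf x Ux; rewrite /prop_for/continuous_at -(fg _ Ux).
  apply: cvg_trans (cf x Ux); apply: near_eq_cvg.
  exact: near_open oU Ux fg.
move=> [df dk]; split=> [x Ux|v].
  apply: near_eq_differentiable (df x Ux); exact: near_open oU Ux fg.
apply: IH (dk v) => x Ux; apply: near_eq_derive; exact: near_open oU Ux fg.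
Qed.

Lemma CkS k U f : Ck k.+1 U f -> Ck k U f.
Proof.
elim: k f => [|k IH] f; first by move=> [df _] x /df/differentiable_continuous.
by move=> [df dk]; split=> // v; apply: IH; exact: dk.
Qed.

Lemma Ck_sub k U U' f : U' `<=` U -> Ck k U f -> Ck k U' f.
Proof.
move=> sU; elim: k f => [|k IH] f /=; first by move=> h x /sU/h.
by move=> [df dk]; split=> [x /sU/df//|v]; apply: IH.
Qed.

Lemma Ck_cst k U (c : W) : Ck k U (cst c).
Proof.
elim: k c => [|k IH] c /=; first by move=> x _; exact: cvg_cst.
split=> [x _|v]; first exact: differentiable_cst.
by rewrite (_ : (fun x => _) = cst 0)//; apply/funext => x; rewrite derive_cst.
Qed.

Lemma CkD k U f g : open U -> Ck k U f -> Ck k U g ->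
  Ck k U (fun x => f x + g x).
Proof.
move=> oU; elim: k f g => [|k IH] f g /=.
  by move=> cf cg x Ux; apply: cvgD; [exact: cf|exact: cg].
move=> [df dkf] [dg dkg]; split=> [x Ux|v].
  by apply: differentiableD; [exact: (df _ Ux)|exact: (dg _ Ux)].
apply: (Ck_ext (f := fun x => 'D_v f x + 'D_v g x)) => //.
  by move=> x Ux; rewrite deriveD//; apply: diff_derivable; first [exact: (df _ Ux)|exact: (dg _ Ux)].
exact: IH.
Qed.

End Gen.

Implicit Types f g : V -> R.

Lemma CkM k U f g : open U -> Ck k U f -> Ck k U g ->
  Ck k U (fun x => f x * g x).
Proof.
move=> oU; elim: k f g => [|k IH] f g cf cg.
  by move=> x Ux; apply: cvgM; [exact: cf|exact: cg].
have [[df dkf] [dg dkg]] := (cf, cg); split=> [x Ux|v].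
  by apply: differentiableM; [exact: (df _ Ux)|exact: (dg _ Ux)].
apply: (Ck_ext (f := fun x => f x * 'D_v g x + g x * 'D_v f x)) => //.
  by move=> x Ux; rewrite deriveM//; apply: diff_derivable; first [exact: (df _ Ux)|exact: (dg _ Ux)].
by apply: CkD => //; [exact: IH (CkS cf) (dkg v)|exact: IH (CkS cg) (dkf v)].
Qed.

Lemma CkV k U f : open U -> (forall x, U x -> f x != 0) -> Ck k U f ->
  Ck k U (fun x => (f x)^-1).
Proof.
move=> oU f0; elim: k => [|k IH] cf.
  by move=> x Ux; apply: cvgV; [exact: f0|exact: cf].
have [df dkf] := cf; split=> [x Ux|v].
  by apply: differentiableV; [exact: df|exact: f0].
apply: (Ck_ext (f := fun x => (-1) * ((f x)^-1 * (f x)^-1 * 'D_v f x))) => //.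
  move=> x Ux; rewrite deriveV ?f0//; last by apply: diff_derivable; exact: (df _ Ux).
  by rewrite -[_ *: _]/(_ * _) expr2 invfM; ring.
apply: CkM => //; first exact: Ck_cst.
apply: (CkM oU) (dkf v); by apply: CkM => //; exact: IH (CkS cf).
Qed.

Definition smooth U f := forall k, Ck k U f.

Lemma smoothD_v U f v : smooth U f -> smooth U (fun x => 'D_v f x).
Proof. by move=> sf k; have [_] := sf k.+1; exact. Qed.

Lemma smooth_diff U f x : smooth U f -> U x -> differentiable f x.
Proof. by move=> sf; have [h _] := sf 1%N; exact: h. Qed.

Lemma smooth_derivable U f x v : smooth U f -> U x -> derivable f x v.
Proof. by move=> sf Ux; apply: diff_derivable; exact: smooth_diff sf Ux. Qed.

Lemma smooth_cont U f x : smooth U f -> U x -> {for x, continuous f}.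
Proof. by move=> sf; exact: (sf 0%N). Qed.

Lemma smooth_ext U f g : open U -> (forall x, U x -> f x = g x) ->
  smooth U f -> smooth U g.
Proof. by move=> oU e sf k; exact: Ck_ext e (sf k). Qed.

End CkTheory.

Lemma Ck_coord (R : realType) (V : normedModType R) (m : nat) k (U : set V)
    (F : V -> 'rV[R]_m) a : open U ->
  Ck k U F -> Ck k U (fun z => F z 0 a).
Proof.
move=> oU; elim: k F => [|k IH] F /=.
  move=> cF x Ux; apply: (@continuous_comp _ _ _ F (fun M : 'rV[R]_m => M 0 a)).
    exact: cF.
  exact: coord_continuous.
move=> [dF dkF]; split=> [x Ux|v].
  exact: (differentiable_comp (dF x Ux) (differentiable_coord _ _ _)).
apply: (Ck_ext (f := fun z => ('D_v F z) 0 a)) => //; last exact: IH.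
by move=> x Ux; rewrite derive_mx ?mxE//; apply: diff_derivable; exact: (dF _ Ux).
Qed.

(** * Symmetry of second derivatives *)

Section Schwarz.
Variables (R : realType) (V : normedModType R).

Lemma is_derive_line (g : V -> R) (v y : V) (s : R) :
  differentiable g (s *: v + y) ->
  is_derive s (1 : R) (fun s => g (s *: v + y)) ('D_v g (s *: v + y)).
Proof.
move=> dg.
have e : (fun h : R => h^-1 *: (((fun s => g (s *: v + y)) \o shift s) (h *: (1 : R))
     - g (s *: v + y))) =
   (fun h : R => h^-1 *: ((g \o shift (s *: v + y)) (h *: v) - g (s *: v + y))).
  apply/funext => h /=; congr (_ *: (g _ - _)).
  by rewrite -[h *: 1]/(h * 1) mulr1 scalerDl addrA.
apply: DeriveDef; last by rewrite /derive e.
by rewrite /derivable e; exact: diff_derivable.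
Qed.

Lemma derive_translate (f : V -> R) (c y v : V) :
  'D_v (fun z => f (c + z)) y = 'D_v f (c + y).
Proof.
rewrite /derive; set p := fun h => _; set q := fun h => _.
suff -> : p = q by [].
by apply/funext => r; rewrite /p /q /= addrCA.
Qed.

Lemma MVT_line (g : V -> R) (v y : V) (h : R) : 0 < h ->
  (forall s, 0 <= s <= h -> differentiable g (s *: v + y)) ->
  exists2 s, 0 < s < h & g (h *: v + y) - g y = h * 'D_v g (s *: v + y).
Proof.
move=> h0 dg.
have der s : s \in `]0, h[%R ->
    is_derive s (1 : R) (fun s => g (s *: v + y)) ('D_v g (s *: v + y)).
  rewrite in_itv/= => /andP[s0 sh]; apply: is_derive_line.
  by apply: dg; rewrite !ltW.
have cont : {within `[0, h], continuous (fun s => g (s *: v + y))}.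
  apply: derivable_within_continuous => s; rewrite in_itv/= => sh.
  by have [] := is_derive_line (dg s sh).
have [s] := MVT h0 der cont.
rewrite in_itv/= => sh; rewrite scale0r add0r subr0 => e.
by exists s => //; rewrite e mulrC.
Qed.

Lemma ball_comb (x v w : V) (d s t h : R) : h * (`|v| + `|w| + 1) < d ->
  0 <= s <= h -> 0 <= t <= h -> ball x d (s *: v + (t *: w + x)).
Proof.
move=> hd /andP[s0 sh] /andP[t0 th].
rewrite -ball_normE /ball_/= addrA opprD addrCA subrr addr0 normrN.
apply: le_lt_trans (ler_normD _ _) _; rewrite !normrZ !ger0_norm//.
apply: le_lt_trans hd.
have h0 : 0 <= h by exact: le_trans sh.
have := ler_wpM2r (normr_ge0 v) sh; have := ler_wpM2r (normr_ge0 w) th.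
by lra.
Qed.

(** The mean value theorem along [v] for the increment of [f] in the direction [w], then along [w]
    for the derivative of [f] in the direction [v]. *)
Lemma second_difference U (f : V -> R) (x v w : V) (d h : R) :
  smooth U f -> ball x d `<=` U -> 0 < h -> h * (`|v| + `|w| + 1) < d ->
  exists2 y, ball x d y & f (h *: v + (h *: w + x)) - f (h *: v + x)
    - f (h *: w + x) + f x = h * h * 'D_w (fun z => 'D_v f z) y.
Proof.
move=> sf dU h0 hd.
have h00 : 0 <= (0 : R) <= h by rewrite lexx ltW.
have inU s t : 0 <= s <= h -> 0 <= t <= h -> U (s *: v + (t *: w + x)).
  by move=> sh th; apply: dU; exact: ball_comb hd sh th.
pose g z := f (h *: w + z) - f z.
have hh : 0 <= h <= h by rewrite lexx ltW.
have dfs s t : 0 <= s <= h -> 0 <= t <= h -> differentiable f (s *: v + (t *: w + x)).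
  by move=> sh th; apply: smooth_diff sf _; exact: inU.
have shE : (fun z => f (h *: w + z)) = f \o shift (h *: w).
  by apply/funext => z /=; rewrite addrC.
have ds s : 0 <= s <= h -> differentiable (fun z => f (h *: w + z)) (s *: v + x).
  move=> sh; rewrite shE//; apply: differentiable_comp => //=.
  by rewrite -addrA [x + _]addrC; exact: dfs.
have df0 s : 0 <= s <= h -> differentiable f (s *: v + x).
  by move=> sh; have := dfs s 0 sh h00; rewrite scale0r add0r.
have dg s : 0 <= s <= h -> differentiable g (s *: v + x).
  by move=> sh; apply: differentiableB; [exact: ds|exact: df0].
have [s /andP[s0 sh] gs] := MVT_line h0 dg.
have sh' : 0 <= s <= h by rewrite !ltW.
have Dg : 'D_v g (s *: v + x) =
    'D_v f (h *: w + (s *: v + x)) - 'D_v f (s *: v + x).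
  have := deriveB (diff_derivable (v := v) (ds _ sh')) (diff_derivable (v := v) (df0 _ sh')).
  move=> E; rewrite -[LHS]/('D_v (_ \- _) _) E.
  by rewrite derive_translate.
have dD t : 0 <= t <= h -> differentiable (fun z => 'D_v f z) (t *: w + (s *: v + x)).
  move=> th; apply: smooth_diff (smoothD_v v sf) _.
  by rewrite addrCA; exact: inU.
have [t /andP[t0 th] ts] := MVT_line h0 dD.
exists (t *: w + (s *: v + x)).
  by rewrite addrCA; apply: ball_comb hd _ _; rewrite !ltW.
rewrite -mulrA -ts -Dg -gs /g [h *: w + (h *: v + x)]addrCA; ring.
Qed.

(** The second difference is symmetric in [v] and [w], so the two mixed derivatives agree at two
    points, possibly distinct, arbitrarily close to [x]; continuity concludes. *)
Lemma schwarz U (f : V -> R) (x v w : V) : open U -> U x -> smooth U f ->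
  'D_v (fun z => 'D_w f z) x = 'D_w (fun z => 'D_v f z) x.
Proof.
move=> oU Ux sf; apply/eqP/negPn/negP => ne.
set a := 'D_v _ x in ne *; set b := 'D_w _ x in ne *.
pose e := `|a - b| / 2.
have e0 : 0 < e by rewrite divr_gt0// normr_gt0 subr_eq0.
have ca := smooth_cont (smoothD_v v (smoothD_v w sf)) Ux.
have cb := smooth_cont (smoothD_v w (smoothD_v v sf)) Ux.
have [d /= d0 dP] : exists2 d : R, 0 < d & ball x d `<=` [set z | U z /\
    (`|a - 'D_v (fun z => 'D_w f z) z| < e /\
     `|b - 'D_w (fun z => 'D_v f z) z| < e)].
  have : nbhs x [set z | U z /\ (`|a - 'D_v (fun z => 'D_w f z) z| < e /\
     `|b - 'D_w (fun z => 'D_v f z) z| < e)].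
    apply: filterI; first exact: open_nbhs_nbhs.
    apply: filterI; first by move/cvgrPdist_lt : ca; exact.
    by move/cvgrPdist_lt : cb; exact.
  by move=> /nbhs_ballP[d /= d0 dP]; exists d.
have n0 : 0 < `|v| + `|w| + 1 by rewrite ltr_wpDl// addr_ge0.
pose h := d / 2 / (`|v| + `|w| + 1).
have h0 : 0 < h by rewrite !divr_gt0.
have hd : h * (`|v| + `|w| + 1) < d by rewrite /h divfK ?gt_eqF//; lra.
have hd' : h * (`|w| + `|v| + 1) < d by rewrite [`|w| + _]addrC.
have dU : ball x d `<=` U by move=> z /dP[].
have [y /dP[_ [_ yb]] ye] := second_difference sf dU h0 hd.
have [z /dP[_ [za _]] ze] := second_difference sf dU h0 hd'.
have E : 'D_v (fun z => 'D_w f z) z = 'D_w (fun z => 'D_v f z) y.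
  apply: (@mulfI _ (h * h)); first by rewrite mulf_neq0// gt_eqF.
  apply: etrans (esym ze) (etrans _ ye); rewrite [h *: w + (h *: v + x)]addrCA.
  by congr (_ + _); rewrite addrAC.
have : `|a - b| < e + e.
  rewrite -(subrKA ('D_v (fun z => 'D_w f z) z)); apply: le_lt_trans (ler_normD _ _) _.
  by apply: (ltrD za); rewrite E distrC; exact: yb.
rewrite -splitr ltxx //.
Qed.

End Schwarz.

(** * The ring of smooth functions on an open set *)

Record opn (R : realType) (V : normedModType R) := Opn {
  oset :> set V;
  osetP : open oset
}.

(* Smooth functions on [U], extended by zero so that equality is equality
   on [U]. *)
Record sfun (R : realType) (V : normedModType R) (U : opn V) := Sfun {
  sfval :> V -> R;
  sfvalP : `[< smooth U sfval /\ forall x, ~ oset U x -> sfval x = 0 >]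
}.

HB.instance Definition _ (R : realType) (V : normedModType R) (U : opn V) :=
  [isSub for @sfval R V U].
HB.instance Definition _ (R : realType) (V : normedModType R) (U : opn V) :=
  [Choice of sfun U by <:].

Section SfunTheory.
Variables (R : realType) (V : normedModType R) (U : opn V).
Implicit Types f g h : sfun U.

Lemma sfun_smooth f : smooth U f.
Proof. by have /asboolP[] := sfvalP f. Qed.

Lemma sfun_out f x : ~ oset U x -> f x = 0.
Proof. by have /asboolP[_] := sfvalP f; exact. Qed.

Lemma sfun_eq f g : (forall x, oset U x -> f x = g x) -> f = g.
Proof.
move=> fg; apply: val_inj; apply/funext => x /=.
by have [/fg//|nUx] := pselect (oset U x); rewrite !sfun_out.
Qed.

Definition mksf_fun (F : V -> R) := fun x => if `[< oset U x >] then F x else 0.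

Lemma mksfP (F : V -> R) : smooth U F ->
  `[< smooth U (mksf_fun F) /\ forall x, ~ oset U x -> mksf_fun F x = 0 >].
Proof.
move=> sF; apply/asboolP; split; last by move=> x /asboolPn/negbTE; rewrite /mksf_fun => ->.
apply: smooth_ext sF; first exact: osetP.
by move=> x /asboolP; rewrite /mksf_fun => ->.
Qed.

Definition mksf (F : V -> R) (sF : smooth U F) : sfun U := Sfun (mksfP sF).

Lemma mksfE (F : V -> R) (sF : smooth U F) x : oset U x -> mksf sF x = F x.
Proof. by move=> /asboolP; rewrite /mksf/= /mksf_fun => ->. Qed.

Lemma smooth_cst (c : R) : smooth U (fun=> c).
Proof. by move=> k; exact: Ck_cst. Qed.
Lemma smooth_add f g : smooth U (fun x => f x + g x).
Proof. by move=> k; apply: CkD; [exact: osetP|exact: sfun_smooth..]. Qed.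
Lemma smooth_mul f g : smooth U (fun x => f x * g x).
Proof. by move=> k; apply: CkM; [exact: osetP|exact: sfun_smooth..]. Qed.
Lemma smooth_opp f : smooth U (fun x => (-1) * f x).
Proof.
by move=> k; apply: CkM; [exact: osetP|exact: Ck_cst|exact: sfun_smooth].
Qed.

Definition sfC (c : R) : sfun U := mksf (smooth_cst c).
Definition sfadd f g : sfun U := mksf (smooth_add f g).
Definition sfmul f g : sfun U := mksf (smooth_mul f g).
Definition sfopp f : sfun U := mksf (smooth_opp f).

Fact sfaddA : associative sfadd.
Proof. by move=> f g h; apply: sfun_eq => x Ux; rewrite !mksfE// addrA. Qed.
Fact sfaddC : commutative sfadd.
Proof. by move=> f g; apply: sfun_eq => x Ux; rewrite !mksfE// addrC. Qed.
Fact sfadd0 : left_id (sfC 0) sfadd.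
Proof. by move=> f; apply: sfun_eq => x Ux; rewrite !mksfE// add0r. Qed.
Fact sfaddN : left_inverse (sfC 0) sfopp sfadd.
Proof. by move=> f; apply: sfun_eq => x Ux; rewrite !mksfE// mulN1r addNr. Qed.
HB.instance Definition _ :=
  GRing.isZmodule.Build (sfun U) sfaddA sfaddC sfadd0 sfaddN.
Fact sfmulA : associative sfmul.
Proof. by move=> f g h; apply: sfun_eq => x Ux; rewrite !mksfE// mulrA. Qed.
Fact sfmulC : commutative sfmul.
Proof. by move=> f g; apply: sfun_eq => x Ux; rewrite !mksfE// mulrC. Qed.
Fact sfmul1 : left_id (sfC 1) sfmul.
Proof. by move=> f; apply: sfun_eq => x Ux; rewrite !mksfE// mul1r. Qed.
Fact sfmulD : left_distributive sfmul (fun f g => f + g).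
Proof. by move=> f g h; apply: sfun_eq => x Ux; rewrite !mksfE// mulrDl. Qed.
HB.instance Definition _ :=
  GRing.Zmodule_isComPzRing.Build (sfun U) sfmulA sfmulC sfmul1 sfmulD.

Section Eval.
Variables (z : V) (Uz : oset U z).

Lemma sfD_ev f g : (f + g) z = f z + g z. Proof. by rewrite [LHS]mksfE. Qed.
Lemma sfM_ev f g : (f * g) z = f z * g z. Proof. by rewrite [LHS]mksfE. Qed.
Lemma sfN_ev f : (- f) z = - f z. Proof. by rewrite [LHS]mksfE// mulN1r. Qed.
Lemma sfB_ev f g : (f - g) z = f z - g z.
Proof. by rewrite sfD_ev sfN_ev. Qed.
Lemma sf1_ev : (1 : sfun U) z = 1. Proof. by rewrite [LHS]mksfE. Qed.
Lemma sf0_ev : (0 : sfun U) z = 0. Proof. by rewrite [LHS]mksfE. Qed.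
Lemma sfC_ev c : (sfC c) z = c. Proof. by rewrite [LHS]mksfE. Qed.
Lemma sfnat_ev m : (m%:R : sfun U) z = m%:R.
Proof.
by elim: m => [|m IH]; rewrite ?sf0_ev// -addn1 !natrD sfD_ev IH sf1_ev.
Qed.
Lemma sfsum_ev (I : Type) (r : seq I) (P : pred I) (F : I -> sfun U) :
  (\sum_(i <- r | P i) F i) z = \sum_(i <- r | P i) (F i) z.
Proof.
exact: (big_morph (fun f : sfun U => f z) sfD_ev sf0_ev).
Qed.
Lemma sfprod_ev (I : Type) (r : seq I) (P : pred I) (F : I -> sfun U) :
  (\prod_(i <- r | P i) F i) z = \prod_(i <- r | P i) (F i) z.
Proof.
exact: (big_morph (fun f : sfun U => f z) sfM_ev sf1_ev).
Qed.
End Eval.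

Definition sfder (v : V) (f : sfun U) : sfun U :=
  mksf (smoothD_v v (sfun_smooth f)).

Lemma sfderE v f z : oset U z -> sfder v f z = 'D_v f z.
Proof. exact: mksfE. Qed.

Lemma sfun_derivable f v z : oset U z -> derivable f z v.
Proof. by move=> Uz; exact: smooth_derivable (sfun_smooth f) Uz. Qed.

Lemma near_eqU (f g : V -> R) z : oset U z -> (forall x, oset U x -> f x = g x) ->
  \forall x \near z, f x = g x.
Proof. by move=> Uz; exact: near_open (osetP U) Uz. Qed.

Lemma sfderD v : derivation (sfder v).
Proof.
split=> f g; apply: sfun_eq => z Uz.
  rewrite sfD_ev// !sfderE// -deriveD; [|exact: sfun_derivable..].
  by apply: near_eq_derive; apply: near_eqU => // x Ux; rewrite sfD_ev.
rewrite sfD_ev// !sfM_ev// !sfderE//.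
rewrite (@near_eq_derive _ _ _ _ (fun x => f x * g x)); last first.
  by apply: near_eqU => // x Ux; rewrite sfM_ev.
rewrite deriveM; [|exact: sfun_derivable..].
by rewrite -![_ *: _]/(_ * _); ring.
Qed.

Lemma sfderC v w f : sfder v (sfder w f) = sfder w (sfder v f).
Proof.
apply: sfun_eq => z Uz.
have e a b : sfder a (sfder b f) z = 'D_a (fun x => 'D_b f x) z.
  rewrite (sfderE a (sfder b f) Uz).
  by apply: near_eq_derive; apply: near_eqU => // x Ux; exact: sfderE.
by rewrite (e v w) (e w v); exact: schwarz (osetP U) Uz (sfun_smooth f).
Qed.

Lemma sfder_C v c : sfder v (sfC c) = 0.
Proof.
apply: sfun_eq => z Uz; rewrite sfderE// sf0_ev//.
rewrite (near_eq_derive (g := cst c)) ?derive_cst//.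
by apply: near_eqU => // x Ux; rewrite sfC_ev.
Qed.

Lemma sf_two_reg f : f + f = 0 -> f = 0.
Proof.
move=> ff; apply: sfun_eq => z Uz.
have : (f + f) z = (0 : sfun U) z by rewrite ff.
by rewrite (sfD_ev Uz) (sf0_ev Uz); lra.
Qed.

Lemma sf_unit f : (forall x, oset U x -> f x != 0) -> exists g, f * g = 1.
Proof.
move=> f0.
have sV : smooth U (fun x => (f x)^-1).
  by move=> k; apply: CkV => //; [exact: osetP|exact: sfun_smooth].
exists (mksf sV); apply: sfun_eq => z Uz.
by rewrite sfM_ev// mksfE// sf1_ev// divff// f0.
Qed.

Lemma sf_det_ev n (M : 'M[sfun U]_n) z : oset U z ->
  (\det M) z = \det (\matrix_(i, j) M i j z).
Proof.
move=> Uz; rewrite /determinant sfsum_ev//; apply: eq_bigr => s _.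
rewrite sfM_ev//; congr (_ * _).
  case: (perm.odd_perm s); rewrite ?expr1 ?expr0 ?sf1_ev//.
  by rewrite sfN_ev// sf1_ev.
by rewrite sfprod_ev//; apply: eq_bigr => i _; rewrite mxE.
Qed.

(** The adjugate formula keeps the entries of the inverse in the ring: a determinant that vanishes
    nowhere on [U] is a unit there. *)
Lemma sf_gram_inv n (M : 'M[sfun U]_n) :
  (forall z, oset U z -> (\matrix_(i, j) M i j z) \in unitmx) ->
  exists2 M', M' *m M = 1%:M &
    forall z, oset U z -> (\matrix_(i, j) M' i j z) = invmx (\matrix_(i, j) M i j z).
Proof.
move=> uM.
have [|d dP] := @sf_unit (\det M).
  by move=> z Uz; rewrite sf_det_ev//; have := uM z Uz; rewrite unitmxE unitfE.
have inv : (d *: \adj M) *m M = 1%:M.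
  by rewrite -scalemxAl mul_adj_mx scale_scalar_mx mulrC dP.
exists (d *: \adj M) => // z Uz.
set Mz := \matrix_(i, j) _; set Iz := invmx _.
have IM : Mz *m (\matrix_(i, j) M i j z) = 1%:M.
  apply/matrixP => i j; rewrite !mxE.
  have : ((d *: \adj M) *m M) i j z = (1%:M : 'M[sfun U]_n) i j z by rewrite inv.
  rewrite [(_ *m _) i j]mxE [1%:M i j]mxE (sfsum_ev Uz).
  have -> : ((i == j)%:R : sfun U) z = (i == j)%:R by rewrite (sfnat_ev Uz).
  move=> <-; apply: eq_bigr => k _; rewrite (sfM_ev Uz).
  by congr (_ * _); rewrite mxE.
by rewrite -[LHS]mulmx1 -(mulmxV (uM z Uz)) mulmxA IM mul1mx.
Qed.

End SfunTheory.

(** * Evolution equations in a patch of the flow *)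

Section OneVariable.
Variable R : realType.
Implicit Types f p : R -> R.

Lemma near_quotient f (c : R) : is_derive (0 : R) (1 : R) f c ->
  h^-1 * (f h - f 0) @[h --> 0^'] --> c.
Proof.
move=> [df <-].
have e : (fun h : R => h^-1 *: ((f \o shift 0) (h *: (1 : R)) - f 0)) =
         (fun h : R => h^-1 * (f h - f 0)).
  by apply/funext => h; rewrite /= addr0 -[h *: 1]/(h * 1) mulr1.
have := df : (fun h : R => h^-1 *: ((f \o shift 0) (h *: (1 : R)) - f 0)) @ 0^'
  --> 'D_1 f 0.
by rewrite e.
Qed.

Lemma derive_left_min f (c : R) : is_derive (0 : R) (1 : R) f c ->
  (\forall s \near (0 : R), s < 0 -> f 0 <= f s) -> c <= 0.
Proof.
move=> /near_quotient df fmin; rewrite leNgt; apply/negP => c0.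
have h : \forall s \near (0 : R)^', 0 < s^-1 * (f s - f 0) by exact: (cvgr_gt _ df _ c0).
rewrite /dnbhs near_withinE in h.
have /nbhs_ballP[d /= d0 dP] : nbhs (0 : R) [set s | (s < 0 -> f 0 <= f s) /\
   (s != 0 -> 0 < s^-1 * (f s - f 0))] by exact: (filterI fmin h).
have [|h1 h2] := dP (- (d / 2)).
  by rewrite -ball_normE/= sub0r opprK gtr0_norm; lra.
have dd : - (d / 2) < 0 by lra.
have := h2 (ltr0_neq0 dd); rewrite nmulr_rgt0 ?invr_lt0//.
by rewrite subr_lt0 ltNge h1.
Qed.

Lemma derive_right_min f (c : R) : is_derive (0 : R) (1 : R) f c ->
  (\forall s \near (0 : R), 0 < s -> f 0 <= f s) -> 0 <= c.
Proof.
move=> /near_quotient df fmin; rewrite leNgt; apply/negP => c0.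
have h : \forall s \near (0 : R)^', s^-1 * (f s - f 0) < 0 by exact: (cvgr_lt _ df _ c0).
rewrite /dnbhs near_withinE in h.
have /nbhs_ballP[d /= d0 dP] : nbhs (0 : R) [set s | (0 < s -> f 0 <= f s) /\
   (s != 0 -> s^-1 * (f s - f 0) < 0)] by exact: (filterI fmin h).
have dd : 0 < d / 2 by lra.
have [|h1 h2] := dP (d / 2).
  by rewrite -ball_normE/= sub0r normrN gtr0_norm; lra.
have := h2 (lt0r_neq0 dd); rewrite pmulr_rlt0 ?invr_gt0//.
by rewrite subr_lt0 ltNge h1.
Qed.

(** If [c] were negative, [p] would be negative just to the right of 0, and the mean value theorem
    would bring [f] below [f 0]. *)
Lemma second_derivative_min f p (c : R) :
  (\forall s \near (0 : R), is_derive s (1 : R) f (p s)) ->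
  is_derive (0 : R) (1 : R) p c ->
  (\forall s \near (0 : R), f 0 <= f s) -> p 0 = 0 /\ 0 <= c.
Proof.
move=> df dp fmin.
have f0 : is_derive (0 : R) (1 : R) f (p 0) by exact: nbhs_singleton df.
have p0 : p 0 = 0.
  apply/le_anti/andP; split.
    by apply: (derive_left_min f0); apply: filterS fmin => s + _.
  by apply: (derive_right_min f0); apply: filterS fmin => s + _.
split => //; rewrite leNgt; apply/negP => c0.
have h : \forall s \near (0 : R)^', s^-1 * (p s - p 0) < 0 by exact: (cvgr_lt _ (near_quotient dp) _ c0).
rewrite /dnbhs near_withinE in h.
have /nbhs_ballP[d /= d0 dP] : nbhs (0 : R) [set s | (f 0 <= f s /\
   is_derive s (1 : R) f (p s)) /\ (s != 0 -> s^-1 * (p s - p 0) < 0)].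
  exact: (filterI (filterI fmin df) h).
pose e := d / 2.
have e0 : 0 < e by rewrite /e; lra.
have inb s : 0 <= s <= e -> ball (0 : R) d s.
  move=> /andP[s0 se]; rewrite -ball_normE/= sub0r normrN ger0_norm//.
  by rewrite /e in se; lra.
have der s : s \in `]0, e[%R -> is_derive s (1 : R) f (p s).
  rewrite in_itv/= => /andP[s0 se].
  by have [|[_ +] _] := dP s; first by apply: inb; rewrite !ltW.
have cont : {within `[0, e], continuous f}.
  apply: derivable_within_continuous => s; rewrite in_itv/= => se.
  by have [[_ []]] := dP s (inb s se).
have [s] := MVT e0 der cont; rewrite in_itv/= => /andP[s0 se] fe.
have sin : 0 <= s <= e by rewrite !ltW.
have [[_ _] /(_ (lt0r_neq0 s0))] := dP s (inb s sin).
rewrite p0 subr0 pmulr_rlt0 ?invr_gt0// => ps.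
have [|[+ _] _] := dP e; first by apply: inb; rewrite lexx ltW.
by rewrite -subr_ge0 fe subr0 nmulr_rge0// leNgt e0.
Qed.

End OneVariable.

(** The condition under which Kato's constant 3/(n+2) dominates the coefficient 1/(n-2+al) of H^2.
    It is automatic for n >= 4; for n = 3 it is al >= 2/3. *)
Lemma pinching_constant (R : realFieldType) (n : nat) (al : R) : (3 <= n)%N ->
  0 < al -> (n = 3%N -> 2 / 3 < al) -> n%:R + 2 <= 3 * (n%:R - 2 + al).
Proof.
move=> n3 al0 al3; have [n4|] := leqP 4 n.
  by have : (4 : R) <= n%:R; [rewrite ler_nat|lra].
rewrite ltnS => n3'; have n3e : n = 3%N by apply/eqP; rewrite eqn_leq n3' n3.
by have := al3 n3e; rewrite n3e; lra.
Qed.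

Lemma pinching_gradient (R : realFieldType) (N c a h t : R) :
  0 < N -> 0 < c -> c * a = 1 -> N + 2 <= 3 * c -> 0 <= h ->
  3 * h <= (N + 2) * t -> a * h <= t.
Proof.
move=> N0 c0 ca Nc h0 ht.
have t0 : 0 <= t by rewrite -(pmulr_rge0 _ (_ : 0 < N + 2)); lra.
rewrite -(ler_pM2l c0) mulrA ca mul1r.
have : (N + 2) * t <= 3 * c * t by rewrite ler_wpM2r.
by lra.
Qed.

(** * The flow in coordinates and the evolution of the pinching *)

Section Patch.
Variables (R : realType) (n : nat) (K : R).
Let V := ('rV[R]_n * R^o)%type.
(* A point of [V] is a pair of chart coordinates and a time. *)
Definition sdir (v : 'rV[R]_n) : V := (v, 0).
Definition tdir : V := (0, 1).
Definition gram (F : V -> 'rV[R]_n.+2) (z : V) : 'M[R]_n :=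
  \matrix_(i, j) dotp ('D_(sdir (delta_mx 0 i)) F z) ('D_(sdir (delta_mx 0 j)) F z).
Definition secf (F N : V -> 'rV[R]_n.+2) (z : V) : 'M[R]_n :=
  \matrix_(i, j) dotp ('D_(sdir (delta_mx 0 i)) N z) ('D_(sdir (delta_mx 0 j)) F z).
Definition meanc F N z : R := \tr (invmx (gram F z) *m secf F N z).
Definition norm2c F N z : R :=
  \tr (invmx (gram F z) *m secf F N z *m invmx (gram F z) *m (secf F N z)^T).

(** The flow equation is required on an open set of space-time, with a two-sided time derivative;
    for a flow on [0, T) such patches are obtained at positive times. *)
Record flow_patch (U : opn V) (F N : V -> 'rV[R]_n.+2) : Prop := FlowPatch {
  fp_smF : forall k, Ck k U F;
  fp_smN : forall k, Ck k U N;
  fp_FF : forall z, oset U z -> dotp (F z) (F z) = K^-1;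
  fp_NN : forall z, oset U z -> dotp (N z) (N z) = 1;
  fp_NF : forall z, oset U z -> dotp (N z) (F z) = 0;
  fp_NdF : forall z, oset U z -> forall i,
    dotp (N z) ('D_(sdir (delta_mx 0 i)) F z) = 0;
  fp_gram : forall z, oset U z -> gram F z \in unitmx;
  fp_flow : forall z, oset U z -> 'D_tdir F z = - meanc F N z *: N z
}.

Variables (U : opn V) (F N : V -> 'rV[R]_n.+2).
Hypothesis K0 : 0 < K.
Hypothesis fp : flow_patch U F N.

Lemma smooth_coord (G : V -> 'rV[R]_n.+2) a : (forall k, Ck k U G) ->
  smooth U (fun z => G z 0 a).
Proof. by move=> sG k; apply: Ck_coord; [exact: osetP|exact: sG]. Qed.

Definition pos a : sfun U := mksf (smooth_coord a (fp_smF fp)).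
Definition nml a : sfun U := mksf (smooth_coord a (fp_smN fp)).
Definition pdx (i : 'I_n) := @sfder R V U (sdir (delta_mx 0 i)).
Definition pdt := @sfder R V U tdir.
Definition Ks : sfun U := sfC U K.

Lemma posE a z : oset U z -> pos a z = F z 0 a. Proof. exact: mksfE. Qed.
Lemma nmlE a z : oset U z -> nml a z = N z 0 a. Proof. exact: mksfE. Qed.

Lemma derive_coord (G : V -> 'rV[R]_n.+2) a v z : (forall k, Ck k U G) ->
  oset U z -> 'D_v (fun z => G z 0 a) z = ('D_v G z) 0 a.
Proof.
move=> sG Uz; rewrite derive_mx ?mxE//; apply: diff_derivable.
by have [h _] := sG 1%N; exact: h.
Qed.

Lemma der_pos a v z : oset U z -> sfder v (pos a) z = ('D_v F z) 0 a.
Proof.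
move=> Uz; rewrite (sfderE v _ Uz) -(derive_coord _ _ (fp_smF fp) Uz).
by apply: near_eq_derive; apply: (near_eqU (U := U)) => // y Uy; exact: posE.
Qed.

Lemma der_nml a v z : oset U z -> sfder v (nml a) z = ('D_v N z) 0 a.
Proof.
move=> Uz; rewrite (sfderE v _ Uz) -(derive_coord _ _ (fp_smN fp) Uz).
by apply: near_eq_derive; apply: (near_eqU (U := U)) => // y Uy; exact: nmlE.
Qed.

Lemma dot_ev (f g : 'I_n.+2 -> sfun U) z : oset U z ->
  (\sum_a f a * g a) z = \sum_a f a z * g a z.
Proof.
by move=> Uz; rewrite (sfsum_ev Uz); apply: eq_bigr => a _; rewrite (sfM_ev Uz).
Qed.

Let Fm : 'M[sfun U]_(n, n.+2) := \matrix_(i, a) pdx i (pos a).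
Let Nm : 'M[sfun U]_(n, n.+2) := \matrix_(i, a) pdx i (nml a).

Lemma gram_ev z : oset U z ->
  \matrix_(i, j) ((Fm *m Fm^T) i j) z = gram F z.
Proof.
move=> Uz; apply/matrixP => i j; rewrite !mxE (sfsum_ev Uz).
apply: eq_bigr => a _; rewrite (sfM_ev Uz) !mxE.
by congr (_ * _); exact: der_pos.
Qed.

Lemma secf_ev z : oset U z ->
  \matrix_(i, j) ((Nm *m Fm^T) i j) z = secf F N z.
Proof.
move=> Uz; apply/matrixP => i j; rewrite !mxE (sfsum_ev Uz).
apply: eq_bigr => a _; rewrite (sfM_ev Uz) !mxE.
by congr (_ * _); [exact: der_nml|exact: der_pos].
Qed.

Lemma patch_gi : exists gi : 'M[sfun U]_n, gi *m (Fm *m Fm^T) = 1%:M /\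
  forall z, oset U z -> \matrix_(i, j) (gi i j) z = invmx (gram F z).
Proof.
have [|gi gi1 giE] := @sf_gram_inv R V U n (Fm *m Fm^T).
  by move=> z Uz; rewrite gram_ev//; exact: (fp_gram fp Uz).
exists gi; split=> // z Uz; rewrite -(gram_ev Uz); exact: giE.
Qed.

Definition pgi := projT1 (cid patch_gi).
Lemma pgiP : pgi *m (Fm *m Fm^T) = 1%:M.
Proof. by have [] := projT2 (cid patch_gi). Qed.
Lemma pgiE z : oset U z -> \matrix_(i, j) (pgi i j) z = invmx (gram F z).
Proof. by have [_] := projT2 (cid patch_gi); exact. Qed.

Definition pdl := tdl pos pdx pgi.

Lemma patch_xx : Ks * \sum_a pos a * pos a = 1.
Proof.
apply: sfun_eq => z Uz; rewrite (sfM_ev Uz) (sfC_ev Uz) (sf1_ev Uz) dot_ev//.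
have <- : dotp (F z) (F z) = \sum_a pos a z * pos a z.
  by apply: eq_bigr => a _; rewrite posE.
by rewrite (fp_FF fp Uz) mulfV// gt_eqF.
Qed.

Lemma patch_nunu : \sum_a nml a * nml a = 1.
Proof.
apply: sfun_eq => z Uz; rewrite (sf1_ev Uz) dot_ev// -[RHS](fp_NN fp Uz).
by apply: eq_bigr => a _; rewrite nmlE.
Qed.

Lemma patch_xnu : \sum_a pos a * nml a = 0.
Proof.
apply: sfun_eq => z Uz; rewrite (sf0_ev Uz) dot_ev// -[RHS](fp_NF fp Uz).
by apply: eq_bigr => a _; rewrite nmlE// posE// mulrC.
Qed.

Lemma patch_nuF i : \sum_a nml a * pdx i (pos a) = 0.
Proof.
apply: sfun_eq => z Uz; rewrite (sf0_ev Uz) dot_ev// -[RHS](fp_NdF fp Uz i).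
by apply: eq_bigr => a _; rewrite nmlE// der_pos.
Qed.

Lemma pdxD i : derivation (pdx i). Proof. exact: sfderD. Qed.
Lemma pdtD : derivation pdt. Proof. exact: sfderD. Qed.
Lemma pdxC i j u : pdx i (pdx j u) = pdx j (pdx i u). Proof. exact: sfderC. Qed.
Lemma pdtC i u : pdt (pdx i u) = pdx i (pdt u). Proof. exact: sfderC. Qed.
Lemma pdxK i : pdx i Ks = 0. Proof. exact: sfder_C. Qed.
Lemma pdtK : pdt Ks = 0. Proof. exact: sfder_C. Qed.

Definition pH := mcurv nml pdl.
Definition pA2 := sqnormA nml pdl.

Lemma pH_ev z : oset U z -> pH z = meanc F N z.
Proof.
move=> Uz.
have -> : pH = \tr (pgi *m (Nm *m Fm^T)).
  exact: (mcurvE nml pgiP).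
rewrite /mxtrace (sfsum_ev Uz) /meanc -pgiE// -secf_ev//.
apply: eq_bigr => i _; rewrite !mxE (sfsum_ev Uz).
by apply: eq_bigr => j _; rewrite (sfM_ev Uz) !mxE.
Qed.

Lemma mulmx_ev m p q (X : 'M[sfun U]_(m, p)) (Y : 'M[sfun U]_(p, q)) z :
  oset U z -> \matrix_(i, j) ((X *m Y) i j) z =
    (\matrix_(i, j) (X i j) z) *m (\matrix_(i, j) (Y i j) z).
Proof.
move=> Uz; apply/matrixP => i j; rewrite !mxE (sfsum_ev Uz).
by apply: eq_bigr => k _; rewrite (sfM_ev Uz) !mxE.
Qed.

Lemma pA2_ev z : oset U z -> pA2 z = norm2c F N z.
Proof.
move=> Uz.
have -> : pA2 = \tr (pgi *m (Nm *m Fm^T) *m pgi *m (Nm *m Fm^T)^T).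
  exact: (sqnormAE_chart (@sf_two_reg _ _ U) pdxD pdxK patch_xx patch_nunu
    patch_xnu patch_nuF pgiP).
transitivity (\tr (\matrix_(i, j)
    ((pgi *m (Nm *m Fm^T) *m pgi *m (Nm *m Fm^T)^T) i j) z)).
  by rewrite /mxtrace (sfsum_ev Uz); apply: eq_bigr => i _; rewrite [RHS]mxE.
rewrite !(mulmx_ev _ _ Uz) pgiE//.
have -> : \matrix_(i, j) ((Nm *m Fm^T)^T i j) z = (secf F N z)^T.
  by rewrite -secf_ev//; apply/matrixP => i j; rewrite !mxE.
by rewrite -!(mulmx_ev _ _ Uz) secf_ev.
Qed.

Let tr2 := @sf_two_reg R V U.
Definition pP a b : sfun U := (a == b)%:R - nml a * nml b - Ks * pos a * pos b.

Lemma pdlD a : derivation (pdl a). Proof. exact: tdlD pdxD a. Qed.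
Lemma pdlK a : pdl a Ks = 0. Proof. exact: tdlK pdxK a. Qed.
Lemma pnuT u : \sum_a nml a * pdl a u = 0.
Proof. exact: nu_tdl patch_nuF u. Qed.
Lemma pxT u : \sum_a pos a * pdl a u = 0.
Proof. exact: (x_tdl pgi tr2 pdxD pdxK patch_xx). Qed.
Lemma pdl_x a b : pdl a (pos b) = pP a b.
Proof.
exact: (tdl_x tr2 pdxD pdxK patch_xx patch_nunu patch_xnu patch_nuF pgiP).
Qed.
Lemma pdl_comm a b u : pdl a (pdl b u) - pdl b (pdl a u) =
  \sum_c (pdl a (pP b c) - pdl b (pP a c)) * pdl c u.
Proof.
exact: (tdl_comm tr2 pdxD pdxC pdxK patch_xx patch_nunu patch_xnu
  patch_nuF pgiP).
Qed.
Lemma pdt_x a : pdt (pos a) = - (pH * nml a).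
Proof.
apply: sfun_eq => z Uz; rewrite der_pos// (fp_flow fp Uz) mxE (sfN_ev Uz).
by rewrite (sfM_ev Uz) pH_ev// nmlE// mulNr.
Qed.
Lemma pdt_pdl a u : pdt (pdl a u) - pdl a (pdt u) =
  \sum_c (pdt (pP a c) + pdl a (pH * nml c)) * pdl c u.
Proof.
exact: (tdl_tcomm tr2 pdxD pdtD pdtC pdxK patch_xx patch_nunu patch_xnu
  patch_nuF pgiP a u pdt_x).
Qed.

Definition pbox := box pdl pdt.
Lemma pbox_x b : pbox (pos b) = n%:R * Ks * pos b.
Proof.
exact: (box_x pdlD pdlK pnuT patch_xx patch_nunu patch_xnu pdl_x pdt_x).
Qed.
Lemma pbox_nu b : pbox (nml b) = pA2 * nml b + 2%:R * Ks * pH * pos b.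
Proof.
exact: (box_nu tr2 pdlD pdtD pdlK pdtK pnuT pxT patch_nunu patch_xnu pdl_x
  pdl_comm pdt_x pdt_pdl).
Qed.
Lemma pboxM u v : pbox (u * v) = pbox u * v + u * pbox v - 2%:R * gdot pdl u v.
Proof. exact: (boxM pdlD pdtD). Qed.
Lemma pboxD u v : pbox (u + v) = pbox u + pbox v.
Proof. exact: (boxD pdlD pdtD). Qed.

Lemma pdl_C a c : pdl a (sfC U c) = 0.
Proof.
by rewrite /pdl /tdl big1// => k _; rewrite [pdx k _]sfder_C mulr0.
Qed.
Lemma pbox_C c : pbox (sfC U c) = 0.
Proof.
rewrite /pbox /box /lap [pdt _]sfder_C big1 ?subr0// => a _.
by rewrite pdl_C (der0 (pdlD a)).
Qed.

Definition pG (al : R) : sfun U :=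
  sfC U (n%:R - 2 + al)^-1 * pH * pH + sfC U (2 * (2 - al)) * Ks - pA2.

Lemma pG_ev al z : oset U z -> pG al z =
  (n%:R - 2 + al)^-1 * meanc F N z ^+ 2 + 2 * (2 - al) * K - norm2c F N z.
Proof.
move=> Uz; rewrite (sfB_ev Uz) (sfD_ev Uz) !(sfM_ev Uz) !(sfC_ev Uz) pH_ev//.
by rewrite pA2_ev// expr2 mulrA.
Qed.

Lemma sf_sumsq3_ge0 (f : 'I_n.+2 -> 'I_n.+2 -> 'I_n.+2 -> sfun U) z : oset U z ->
  0 <= (\sum_c \sum_a \sum_b f c a b * f c a b) z.
Proof.
move=> Uz; rewrite (sfsum_ev Uz) sumr_ge0// => c _.
rewrite (sfsum_ev Uz) sumr_ge0// => a _.
rewrite (sfsum_ev Uz) sumr_ge0// => b _.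
by rewrite (sfM_ev Uz) -expr2 sqr_ge0.
Qed.

Lemma gdot_ge0 u z : oset U z -> 0 <= gdot pdl u u z.
Proof.
move=> Uz; rewrite (sfsum_ev Uz) sumr_ge0// => c _.
by rewrite (sfM_ev Uz) -expr2 sqr_ge0.
Qed.

(** Up to the gradient term 2 (|dA|^2 - a |dH|^2), which Kato makes nonnegative, the two sides agree
    identically, because a (n - 2 + al) = 1. The last term on the left is positive and makes the
    maximum principle strict. *)
Lemma pbox_pinching (al : R) z : oset U z -> (3 <= n)%N -> 0 < al ->
    (n = 3%N -> 2 / 3 < al) -> al < 1 ->
  2 * (norm2c F N z - (n%:R - 4 + 2 * al) * K) * pG al z
    + 4 * (2 - al) * (n%:R - 4 + 2 * al) * K ^+ 2 <= pbox (pG al) z.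
Proof.
move=> Uz n3 al0 al3 al1.
have nR : (3 : R) <= n%:R by rewrite ler_nat.
have n2 : 0 < n%:R + 2 :> R by lra.
have n0 : 0 < n%:R :> R by lra.
have c0 : 0 < n%:R - 2 + al by lra.
set a := (n%:R - 2 + al)^-1.
have a1 : (n%:R - 2 + al) * a = 1 by rewrite divff// gt_eqF//; lra.
have a0 : 0 < a by rewrite invr_gt0; lra.
rewrite /pG -/a /pbox.
rewrite (box_pinching tr2 pdlD pdtD pdlK pdtK pnuT pxT patch_xx patch_nunu
  patch_xnu pdl_x pdl_comm pdt_x pdt_pdl (pdl_C^~ a) (pdl_C^~ _)); last 2 first.
- exact: sfder_C.
- exact: sfder_C.
have kt := kato tr2 pdlD pdlK pnuT pxT patch_xx patch_nunu patch_xnu pdl_x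
  pdl_comm.
have : 0 <= ((n%:R + 2%:R) * ((n%:R + 2%:R) * sqnormT Ks pos nml pdl
    - 3%:R * gdot pdl pH pH) : sfun U) z.
  by rewrite -kt; exact: sf_sumsq3_ge0.
rewrite -/pH -/pA2; set T2 := sqnormT _ _ _ _; set hh := gdot _ _ _.
have hh0 : 0 <= hh z := gdot_ge0 pH Uz.
rewrite !(sfB_ev Uz, sfD_ev Uz, sfM_ev Uz, sfnat_ev Uz, sfC_ev Uz) -!pA2_ev//.
set t := T2 z in hh0 *; move: hh0; set h := hh z; set H := pH z; set A := pA2 z.
move=> h0 {}kt.
have kt' : 3 * h <= (n%:R + 2) * t.
  by move: kt; rewrite pmulr_rge0// subr_ge0.
have th : a * h <= t.
  by apply: (pinching_gradient n0 c0 a1 _ h0 kt'); exact: pinching_constant.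
rewrite -subr_ge0.
have -> : 2 * (t - a * h) + 2 * a * (A + n%:R * K) * H * H - 2 * A * A -
   4 * K * H * H + 2 * n%:R * K * A -
   (2 * (A - (n%:R - 4 + 2 * al) * K) * (a * H * H + 2 * (2 - al) * K - A) +
    4 * (2 - al) * (n%:R - 4 + 2 * al) * K ^+ 2) =
   2 * (t - a * h) + 4 * K * H * H * ((n%:R - 2 + al) * a - 1).
  by ring.
by rewrite a1 subrr mulr0 addr0 mulr_ge0// subr_ge0.
Qed.

End Patch.

(** * Derivatives along lines and the Laplacian in coordinates *)

Section Line.
Variables (R : realType) (V : normedModType R) (U : opn V).

Lemma near_line (v z : V) : oset U z ->
  \forall s \near (0 : R), oset U (s *: v + z).
Proof.
move=> Uz.
have c : (fun s : R => s *: v + z) @ (0 : R) --> (0 : R) *: v + z.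
  by apply: cvgD; [exact: scalel_continuous|exact: cvg_cst].
apply: c; rewrite scale0r add0r.
by apply: open_nbhs_nbhs; split => //; exact: osetP.
Qed.

Lemma is_derive_sfun (f : sfun U) (v z : V) (s : R) : oset U (s *: v + z) ->
  is_derive s (1 : R) (fun s => f (s *: v + z)) (sfder v f (s *: v + z)).
Proof.
move=> Us; rewrite (sfderE v f Us); apply: is_derive_line.
exact: smooth_diff (sfun_smooth f) Us.
Qed.

Lemma is_derive_sfun0 (f : sfun U) (v z : V) : oset U z ->
  is_derive (0 : R) (1 : R) (fun s => f (s *: v + z)) (sfder v f z).
Proof.
move=> Uz; have := @is_derive_sfun f v z 0; rewrite scale0r add0r; exact.
Qed.

Lemma near_is_derive_sfun (f : sfun U) (v z : V) : oset U z ->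
  \forall s \near (0 : R),
    is_derive s (1 : R) (fun s => f (s *: v + z)) (sfder v f (s *: v + z)).
Proof.
by move=> /(near_line v); apply: filterS => s; exact: is_derive_sfun.
Qed.

Lemma sfder_sum (I : finType) (c : I -> R) (w : I -> V) (f : sfun U) :
  sfder (\sum_i c i *: w i) f = \sum_i sfC U (c i) * sfder (w i) f.
Proof.
apply: sfun_eq => z Uz; rewrite sfderE// (sfsum_ev Uz).
have df := smooth_diff (sfun_smooth f) Uz.
rewrite deriveE// linear_sum; apply: eq_bigr => i _.
by rewrite linearZ (sfM_ev Uz) (sfC_ev Uz) sfderE// deriveE.
Qed.

End Line.

Section Hessian.
Variables (R : realType) (n : nat) (K : R).
Let V := ('rV[R]_n * R^o)%type.
Variables (U : opn V) (F N : V -> 'rV[R]_n.+2).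
Hypothesis fp : flow_patch K U F N.
Local Notation pdx := (@pdx R n U).
Local Notation Fm := (\matrix_(i, a) pdx i (pos fp a)).

Lemma sdir_sum (v : 'rV[R]_n) : sdir v = \sum_i v 0 i *: sdir (delta_mx 0 i).
Proof.
rewrite /sdir {1}[v]row_sum_delta.
have e (f : 'I_n -> 'rV[R]_n) : ((\sum_i f i, 0) : V) = \sum_i ((f i, 0) : V).
  apply: (big_morph (fun x : 'rV[R]_n => (x, 0) : V)) => // x y.
  by rewrite -[RHS]/(x + y, 0 + 0) addr0.
rewrite e; apply: eq_bigr => i _.
by rewrite -[RHS]/(_ *: _, _ *: 0) scaler0.
Qed.

Lemma sfder_sdir v (f : sfun U) :
  sfder (sdir v) f = \sum_i sfC U (v 0 i) * pdx i f.
Proof. by rewrite sdir_sum sfder_sum. Qed.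

Definition hess (f : sfun U) (z : V) (i j : 'I_n) := pdx i (pdx j f) z.

Lemma sfder2_sdir v w (f : sfun U) z : oset U z ->
  sfder (sdir v) (sfder (sdir w) f) z =
  \sum_i \sum_j v 0 i * w 0 j * hess f z i j.
Proof.
move=> Uz; rewrite (sfder_sdir v) (sfsum_ev Uz); apply: eq_bigr => i _.
rewrite (sfM_ev Uz) (sfC_ev Uz) sfder_sdir (der_sum (@pdxD R n U i)).
rewrite (sfsum_ev Uz) mulr_sumr; apply: eq_bigr => j _.
rewrite (derM (@pdxD R n U i)) [pdx i (sfC _ _)]sfder_C mul0r add0r (sfM_ev Uz) (sfC_ev Uz).
by rewrite mulrA.
Qed.

Definition tvec (z : V) (a : 'I_n.+2) : 'rV[R]_n :=
  \row_k ((pgi fp *m Fm) k a) z.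

Lemma pdl_ev a (f : sfun U) z : oset U z ->
  pdl fp a f z = sfder (sdir (tvec z a)) f z.
Proof.
move=> Uz; rewrite sfder_sdir !(sfsum_ev Uz); apply: eq_bigr => k _.
by rewrite !(sfM_ev Uz) (sfC_ev Uz) [tvec _ _ _ _]mxE.
Qed.

Definition drift (z : V) (l : 'I_n) : R :=
  \sum_a \sum_k tvec z a 0 k * pdx k ((pgi fp *m Fm) l a) z.

(** The coefficients of the derivations are frozen at [z], so that second derivative tests along
    straight lines apply. What this leaves out is first order and disappears at a critical point. *)
Lemma lap_ev (f : sfun U) z : oset U z -> lap (pdl fp) f z =
  \sum_a sfder (sdir (tvec z a)) (sfder (sdir (tvec z a)) f) z
  + \sum_l drift z l * pdx l f z.
Proof.
move=> Uz; rewrite (sfsum_ev Uz).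
have -> : \sum_l drift z l * pdx l f z = \sum_a \sum_l
    (\sum_k tvec z a 0 k * pdx k ((pgi fp *m Fm) l a) z) * pdx l f z.
  by rewrite exchange_big/=; apply: eq_bigr => l _; rewrite mulr_suml.
rewrite -big_split; apply: eq_bigr => a _.
rewrite (sfder2_sdir _ _ _ Uz) (pdl_ev a _ Uz) sfder_sdir (sfsum_ev Uz).
have -> : \sum_l (\sum_k tvec z a 0 k * pdx k ((pgi fp *m Fm) l a) z)
    * pdx l f z = \sum_k \sum_l
    tvec z a 0 k * pdx k ((pgi fp *m Fm) l a) z * pdx l f z.
  by rewrite exchange_big/=; apply: eq_bigr => l _; rewrite mulr_suml.
rewrite -big_split; apply: eq_bigr => k _.
rewrite (sfM_ev Uz) (sfC_ev Uz) (der_sum (@pdxD R n U k)).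
rewrite (sfsum_ev Uz) mulr_sumr -big_split; apply: eq_bigr => l _.
rewrite (derM (@pdxD R n U k)) (sfD_ev Uz) !(sfM_ev Uz) /hess.
by rewrite [tvec z a 0 l]mxE -[RHS]/(_ + _); ring.
Qed.

Lemma line_min (f : sfun U) v z : oset U z ->
  (\forall s \near (0 : R), f z <= f (s *: v + z)) ->
  sfder v f z = 0 /\ 0 <= sfder v (sfder v f) z.
Proof.
move=> Uz fmin.
have e : (0 : R) *: v + z = z by rewrite scale0r add0r.
have [|] := second_derivative_min (near_is_derive_sfun f v Uz)
  (is_derive_sfun0 (sfder v f) v Uz).
  by rewrite e.
by rewrite e.
Qed.

Lemma pbox_min (f : sfun U) z : oset U z ->
  (forall v, \forall s \near (0 : R), f z <= f (s *: sdir v + z)) ->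
  (\forall s \near (0 : R), s < 0 -> f z <= f (s *: tdir R n + z)) ->
  pbox fp f z <= 0.
Proof.
move=> Uz smin tmin.
rewrite /pbox /box (sfB_ev Uz) subr_le0; apply: (@le_trans _ _ 0).
  apply: (derive_left_min (is_derive_sfun0 f (tdir R n) Uz)).
  by rewrite scale0r add0r.
rewrite lap_ev// [X in _ + X]big1 ?addr0; last first.
  move=> l _; rewrite -[RHS](mulr0 (drift z l)); congr (_ * _).
  exact: (line_min Uz (smin (delta_mx 0 l))).1.
by apply: sumr_ge0 => a _; exact: (line_min Uz (smin _)).2.
Qed.

End Hessian.

(** * The two-point maximum principle *)

Lemma cauchy_schwarz_sum (R : realFieldType) (I : finType) (f g : I -> R) :
  (\sum_i f i * g i) ^+ 2 <= (\sum_i f i ^+ 2) * (\sum_i g i ^+ 2).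
Proof.
rewrite -subr_ge0.
(* Lagrange's identity. *)
have <- : 2^-1 * \sum_i \sum_j (f i * g j - f j * g i) ^+ 2 =
  (\sum_i f i ^+ 2) * (\sum_i g i ^+ 2) - (\sum_i f i * g i) ^+ 2.
  have e : \sum_i \sum_j (f i * g j - f j * g i) ^+ 2 =
     2 * ((\sum_i f i ^+ 2) * (\sum_i g i ^+ 2)) - 2 * (\sum_i f i * g i) ^+ 2.
    transitivity (\sum_i (f i ^+ 2 * (\sum_j g j ^+ 2)
        + g i ^+ 2 * (\sum_j f j ^+ 2) - 2 * (f i * g i) * (\sum_j f j * g j))).
      apply: eq_bigr => i _; rewrite !mulr_sumr -big_split/= -sumrB.
      by apply: eq_bigr => j _; ring.
    by rewrite sumrB big_split/= -!mulr_suml -mulr_sumr; ring.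
  by rewrite e; field.
rewrite mulr_ge0// sumr_ge0// => i _; rewrite sumr_ge0// => j _.
by rewrite sqr_ge0.
Qed.

(** * Linear algebra at a touching pair *)

Section TwoPointAlgebra.
Variables (R : realFieldType) (n : nat) (K phi H : R).
Variables (X Y nu nu2 dphi : 'I_n.+2 -> R) (W : 'I_n.+2 -> 'I_n.+2 -> R).
Let P a b := (a == b)%:R - nu a * nu b - K * X a * X b.
Let P2 a b := (a == b)%:R - nu2 a * nu2 b - K * Y a * Y b.
(** [B] is the ambient derivative of the vector [u]. Since [delta] is half of the squared chord
    length, [Rf] is the reflection in the hyperplane bisecting the chord. *)
Let B a c := dphi a * X c + phi * P a c - W a c.
Let u c := phi * X c - nu c.
Let XY := \sum_c X c * Y c.
Let delta := K^-1 - XY.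
Let D c := X c - Y c.
Let Rf a b := (a == b)%:R - D a * D b / delta.

Hypothesis K0 : 0 < K.
Hypothesis XX : \sum_c X c * X c = K^-1.
Hypothesis YY : \sum_c Y c * Y c = K^-1.
Hypothesis NN : \sum_c nu c * nu c = 1.
Hypothesis NX : \sum_c X c * nu c = 0.
Hypothesis NN2 : \sum_c nu2 c * nu2 c = 1.
Hypothesis NY2 : \sum_c Y c * nu2 c = 0.
Hypothesis dX : \sum_a X a * dphi a = 0.
Hypothesis dN : \sum_a nu a * dphi a = 0.
Hypothesis WX : forall a, \sum_c W a c * X c = 0.
Hypothesis WN : forall a, \sum_c W a c * nu c = 0.
Hypothesis XW : forall c, \sum_a X a * W a c = 0.
Hypothesis NW : forall c, \sum_a nu a * W a c = 0.
Hypothesis trW : \sum_a W a a = H.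
Hypothesis delta0 : 0 < delta.
(** The two-point function vanishes; [FO1] and [FO2] say that so do its derivatives in the first and
    in the second point. *)
Hypothesis uY : \sum_c u c * Y c = phi / K.
Hypothesis FO1 : forall a, dphi a / K = \sum_c B a c * Y c.
Hypothesis FO2 : forall b, \sum_c u c * P2 b c = 0.

Lemma deltasum (F : 'I_n.+2 -> R) a : \sum_b (a == b)%:R * F b = F a.
Proof.
rewrite (bigD1 a)//= eqxx mul1r big1 ?addr0// => b /negPf.
by rewrite eq_sym => ->; rewrite mul0r.
Qed.

Lemma tpNY : \sum_c nu c * Y c = - (phi * delta).
Proof.
have : \sum_c u c * Y c = phi * XY - \sum_c nu c * Y c.
  rewrite /XY mulr_sumr -sumrB; apply: eq_bigr => c _; rewrite /u; ring.
by rewrite uY /delta => h; lra.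
Qed.

Lemma tpPY a : \sum_c P a c * Y c = Y a - nu a * (\sum_c nu c * Y c) - K * X a * XY.
Proof.
rewrite !mulr_sumr -{1}(deltasum Y a) -!sumrB; apply: eq_bigr => c _.
by rewrite /P; ring.
Qed.

Lemma tpPX a : \sum_c P a c * X c = 0.
Proof.
have NX' : \sum_c nu c * X c = 0.
  by rewrite -[RHS]NX; apply: eq_bigr => c _; rewrite mulrC.
transitivity (X a - nu a * (\sum_c nu c * X c) - K * X a * (\sum_c X c * X c)).
  rewrite !mulr_sumr -{1}(deltasum X a) -!sumrB; apply: eq_bigr => c _.
  by rewrite /P; ring.
by rewrite NX' XX; field; rewrite gt_eqF.
Qed.

Lemma XP c : \sum_a X a * P a c = 0.
Proof.
by rewrite -[RHS](tpPX c); apply: eq_bigr => a _; rewrite /P eq_sym; ring.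
Qed.

Lemma tpPN a : \sum_c P a c * nu c = 0.
Proof.
transitivity (nu a - nu a * (\sum_c nu c * nu c) - K * X a * (\sum_c X c * nu c)).
  rewrite !mulr_sumr -{1}(deltasum nu a) -!sumrB; apply: eq_bigr => c _.
  by rewrite /P; ring.
by rewrite NX NN; ring.
Qed.

Lemma NP c : \sum_a nu a * P a c = 0.
Proof.
by rewrite -[RHS](tpPN c); apply: eq_bigr => a _; rewrite /P eq_sym; ring.
Qed.

Lemma XB c : \sum_a X a * B a c = 0.
Proof.
transitivity (\sum_a (X c * (X a * dphi a) + phi * (X a * P a c) - X a * W a c)).
  by apply: eq_bigr => a _; rewrite /B; ring.
by rewrite sumrB big_split/= -!mulr_sumr dX XP XW; ring.
Qed.

Lemma NB c : \sum_a nu a * B a c = 0.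
Proof.
transitivity (\sum_a (X c * (nu a * dphi a) + phi * (nu a * P a c) - nu a * W a c)).
  by apply: eq_bigr => a _; rewrite /B; ring.
by rewrite sumrB big_split/= -!mulr_sumr dN NP NW; ring.
Qed.

(** [B X] equals dphi/K, so this is [FO1] again. It makes the reflection invisible in the trace of
    [B], which is how [trace_B] is computed. *)
Lemma BD a : \sum_c B a c * D c = 0.
Proof.
transitivity (\sum_c (B a c * X c - B a c * Y c)).
  by apply: eq_bigr => c _; rewrite /D; ring.
rewrite sumrB -FO1.
transitivity (dphi a * (\sum_c X c * X c) + phi * (\sum_c P a c * X c)
   - \sum_c W a c * X c - dphi a / K).
  congr (_ - _); rewrite !mulr_sumr -big_split/= -sumrB.
  by apply: eq_bigr => c _; rewrite /B; ring.
by rewrite XX tpPX WX; ring.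
Qed.

Lemma gradient_at_Y : delta * (\sum_a dphi a * Y a) =
  phi * (\sum_a \sum_c Y a * P a c * Y c) - \sum_a \sum_c Y a * W a c * Y c.
Proof.
have e a : delta * dphi a = \sum_c (phi * (P a c * Y c) - W a c * Y c).
  have := FO1 a.
  have -> : \sum_c B a c * Y c = dphi a * XY
      + \sum_c (phi * (P a c * Y c) - W a c * Y c).
    rewrite /XY mulr_sumr -big_split/=; apply: eq_bigr => c _.
    by rewrite /B; ring.
  by rewrite /delta => h; lra.
rewrite !mulr_sumr -sumrB; apply: eq_bigr => a _.
rewrite mulrA e mulr_suml mulr_sumr -sumrB; apply: eq_bigr => c _; ring.
Qed.

(* The reflection in the bisector of the chord maps the tangent space at [X] to
   the one at [Y], since [phi D - nu] is [nu2] up to sign. *)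
Lemma reflect_P2 : \sum_a \sum_c B a c * (\sum_b Rf a b * P2 b c) =
  \sum_a \sum_c B a c * Rf a c.
Proof.
pose c2 := \sum_c u c * nu2 c.
(* By [FO2] the vector [u] has no component tangent to the hypersurface at [Y]; [uY] gives the
   component along [Y]. *)
have uE b : u b = c2 * nu2 b + phi * Y b.
  have := FO2 b.
  have -> : \sum_c u c * P2 b c = u b - nu2 b * c2 - K * Y b * (\sum_c u c * Y c).
    rewrite /c2 !mulr_sumr -{1}(deltasum u b) -!sumrB; apply: eq_bigr => c _.
    by rewrite /P2; ring.
  rewrite uY => h.
  have k : K * Y b * (phi / K) = phi * Y b by field; rewrite gt_eqF.
  by rewrite k in h; lra.
have nuE b : nu b = phi * D b - c2 * nu2 b by rewrite /D; have := uE b; rewrite /u; lra.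
have DN : \sum_c D c * nu c = phi * delta.
  transitivity (\sum_c X c * nu c - \sum_c nu c * Y c).
    by rewrite -sumrB; apply: eq_bigr => c _; rewrite /D; ring.
  by rewrite NX tpNY; ring.
have DD : \sum_c D c * D c = 2 * delta.
  transitivity (\sum_c X c * X c + \sum_c Y c * Y c - 2 * XY).
    rewrite /XY mulr_sumr -big_split/= -sumrB; apply: eq_bigr => c _.
    by rewrite /D; ring.
  by rewrite XX YY /delta; ring.
have DY : \sum_c D c * Y c = - delta.
  transitivity (XY - \sum_c Y c * Y c).
    by rewrite /XY -sumrB; apply: eq_bigr => c _; rewrite /D; ring.
  by rewrite YY /delta; ring.
have c21 : c2 * c2 = 1.
  have : \sum_b (phi * D b - nu b) * (phi * D b - nu b) = 1.
    transitivity (phi * phi * (\sum_c D c * D c) - 2 * phi * (\sum_c D c * nu c)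
      + \sum_c nu c * nu c).
      by rewrite !mulr_sumr -sumrB -big_split/=; apply: eq_bigr => b _; ring.
    by rewrite DD DN NN; ring.
  have -> : \sum_b (phi * D b - nu b) * (phi * D b - nu b) =
            c2 * c2 * (\sum_c nu2 c * nu2 c).
    by rewrite mulr_sumr; apply: eq_bigr => b _; rewrite nuE; ring.
  by rewrite NN2 mulr1.
have dn0 : delta != 0 by rewrite gt_eqF.
have Rsum (F : 'I_n.+2 -> R) a : \sum_b Rf a b * F b =
    F a - D a / delta * (\sum_b D b * F b).
  rewrite mulr_sumr -{1}(deltasum F a) -sumrB; apply: eq_bigr => b _.
  by rewrite /Rf; ring.
have RY a : \sum_b Rf a b * Y b = X a.
  by rewrite Rsum DY /D; field.
have RN2 a : \sum_b Rf a b * nu2 b = - (c2 * nu a).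
  have Dn2 : \sum_b D b * nu2 b = c2 * (phi * delta).
    have : \sum_c D c * nu c = phi * (\sum_c D c * D c) - c2 * (\sum_c D c * nu2 c).
      by rewrite !mulr_sumr -sumrB; apply: eq_bigr => c _; rewrite nuE; ring.
    rewrite DN DD => h.
    have h2 : c2 * (\sum_c D c * nu2 c) = phi * delta by lra.
    by rewrite -h2 mulrA c21 mul1r.
  rewrite Rsum Dn2 (nuE a).
  have -> : nu2 a = c2 * c2 * nu2 a by rewrite c21 mul1r.
  have -> : - (c2 * (phi * D a - c2 * (c2 * c2 * nu2 a))) =
            (c2 * c2) * (c2 * c2) * nu2 a - c2 * phi * D a by ring.
  by rewrite c21; field.
have RP a c : \sum_b Rf a b * P2 b c = Rf a c + c2 * nu a * nu2 c - K * X a * Y c.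
  transitivity (\sum_b (Rf a b * (b == c)%:R - (Rf a b * nu2 b) * nu2 c
     - K * Y c * (Rf a b * Y b))).
    by apply: eq_bigr => b _; rewrite /P2; ring.
  rewrite !sumrB -mulr_suml -mulr_sumr RY RN2.
  have -> : \sum_b Rf a b * (b == c)%:R = Rf a c.
    by rewrite -(deltasum (Rf a) c); apply: eq_bigr => b _; rewrite eq_sym mulrC.
  by ring.
rewrite exchange_big [RHS]exchange_big/=; apply: eq_bigr => c _.
transitivity (\sum_a (B a c * Rf a c + c2 * nu2 c * (nu a * B a c)
   - K * Y c * (X a * B a c))).
  by apply: eq_bigr => a _; rewrite RP; ring.
by rewrite sumrB big_split/= -!mulr_sumr XB NB; ring.
Qed.

Lemma trace_B : \sum_a \sum_c B a c * Rf a c = n%:R * phi - H.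
Proof.
have inner a : \sum_c B a c * Rf a c = B a a.
  transitivity (\sum_c ((a == c)%:R * B a c - D a / delta * (B a c * D c))).
    by apply: eq_bigr => c _; rewrite /Rf; ring.
  by rewrite sumrB -mulr_sumr BD deltasum; ring.
under eq_bigr do rewrite inner.
transitivity (\sum_a (X a * dphi a + phi * (1 - nu a * nu a - K * (X a * X a))
  - W a a)).
  by apply: eq_bigr => a _; rewrite /B /P eqxx mulr1n; ring.
rewrite sumrB big_split/= -mulr_sumr !sumrB -mulr_sumr dX NN XX trW.
rewrite big_const_ord iter_addr addr0 -addn2 natrD mulfV ?gt_eqF//.
by ring.
Qed.

(** By [gradient_at_Y], the inner product of dphi and [Y] is, up to the factor [delta], phi |p|^2 -
    A(p, p), where [p] is the tangential part of [Y] at [X]; Cauchy-Schwarz bounds A(p, p) by |A|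
    |p|^2. *)
Lemma weingarten_quadratic (A : R) : 0 <= phi ->
  \sum_a \sum_c W a c ^+ 2 = A -> A <= phi ^+ 2 ->
  0 <= \sum_a dphi a * Y a.
Proof.
move=> phi0 WA Aphi; rewrite -(pmulr_rge0 _ delta0) gradient_at_Y subr_ge0.
pose p a := \sum_c P a c * Y c.
have pE a : p a = Y a - nu a * (\sum_c nu c * Y c) - K * X a * XY by exact: tpPY.
have Wp a : \sum_c W a c * p c = \sum_c W a c * Y c.
  transitivity (\sum_c W a c * Y c - (\sum_c W a c * nu c) * (\sum_c nu c * Y c)
    - K * XY * (\sum_c W a c * X c)).
    rewrite mulr_suml mulr_sumr -!sumrB; apply: eq_bigr => c _.
    by rewrite pE; ring.
  by rewrite WN WX; ring.
have YWY : \sum_a \sum_c Y a * W a c * Y c = \sum_a p a * (\sum_c W a c * p c).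
  transitivity (\sum_a (Y a * (\sum_c W a c * Y c))).
    by apply: eq_bigr => a _; rewrite mulr_sumr; apply: eq_bigr => c _; ring.
  under [RHS]eq_bigr do rewrite Wp pE.
  transitivity (\sum_a (Y a * (\sum_c W a c * Y c))
    - (\sum_c nu c * Y c) * (\sum_a nu a * (\sum_c W a c * Y c))
    - K * XY * (\sum_a X a * (\sum_c W a c * Y c))).
    have z1 (v : 'I_n.+2 -> R) : (forall c, \sum_a v a * W a c = 0) ->
        \sum_a v a * (\sum_c W a c * Y c) = 0.
      move=> v0; under eq_bigr do rewrite mulr_sumr.
      rewrite exchange_big/= big1// => c _.
      rewrite -[RHS](mul0r (Y c)) -[in RHS](v0 c) mulr_suml.
      by apply: eq_bigr => a _; ring.
    by rewrite (z1 _ NW) (z1 _ XW); ring.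
  set NYs := \sum_c nu c * Y c.
  rewrite [NYs * _]mulr_sumr [K * XY * _]mulr_sumr -!sumrB.
  by apply: eq_bigr => a _; ring.
have pp : \sum_a \sum_c Y a * P a c * Y c = \sum_a p a ^+ 2.
  have e1 : \sum_a p a * nu a = 0.
    under eq_bigr do rewrite mulr_suml.
    rewrite exchange_big/= big1// => c _.
    rewrite -[RHS](mul0r (Y c)) -[in RHS](NP c) mulr_suml.
    by apply: eq_bigr => a _; ring.
  have e2 : \sum_a p a * X a = 0.
    under eq_bigr do rewrite mulr_suml.
    rewrite exchange_big/= big1// => c _.
    rewrite -[RHS](mul0r (Y c)) -[in RHS](XP c) mulr_suml.
    by apply: eq_bigr => a _; ring.
  transitivity (\sum_a p a * Y a).
    apply: eq_bigr => a _; rewrite mulr_suml; apply: eq_bigr => c _; ring.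
  transitivity (\sum_a p a * Y a - (\sum_c nu c * Y c) * (\sum_a p a * nu a)
     - K * XY * (\sum_a p a * X a)).
    by rewrite e1 e2; ring.
  set NYs := \sum_c nu c * Y c.
  rewrite [NYs * _]mulr_sumr [K * XY * _]mulr_sumr -!sumrB.
  by apply: eq_bigr => a _; rewrite expr2 [X in _ = _ * X]pE -/NYs; ring.
rewrite YWY pp.
set S := \sum_a p a ^+ 2.
have S0 : 0 <= S by apply: sumr_ge0 => a _; exact: sqr_ge0.
have T2 : (\sum_a p a * (\sum_c W a c * p c)) ^+ 2 <= (phi * S) ^+ 2.
  apply: (le_trans (cauchy_schwarz_sum _ _)).
  rewrite -/S (_ : (phi * S) ^+ 2 = S * (phi ^+ 2 * S)); last by ring.
  rewrite ler_wpM2l//.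
  apply: (@le_trans _ _ (\sum_a (\sum_c W a c ^+ 2) * S)).
    by apply: ler_sum => a _; exact: cauchy_schwarz_sum.
  by rewrite -mulr_suml WA ler_wpM2r.
have phiS : 0 <= phi * S by exact: mulr_ge0.
have [h|h] := leP 0 (\sum_a p a * (\sum_c W a c * p c)).
  by rewrite -(@ler_pXn2r _ 2)// nnegrE.
by apply: le_trans phiS; exact: ltW.
Qed.

End TwoPointAlgebra.

Lemma is_derive_sumf (R : realType) (I : finType) (h : I -> R -> R) (dh : I -> R)
    (s : R) : (forall i, is_derive s (1 : R) (h i) (dh i)) ->
  is_derive s (1 : R) (fun s => \sum_i h i s) (\sum_i dh i).
Proof.
move=> hd.
elim: (index_enum I) => [|i r IH].
  rewrite big_nil (_ : (fun _ => _) = cst 0); first exact: is_derive_cst.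
  by apply/funext => t; rewrite big_nil.
rewrite big_cons (_ : (fun _ => _) = h i + fun s => \sum_(i <- r) h i s).
  exact: is_deriveD.
by apply/funext => t; rewrite big_cons.
Qed.

Lemma is_derive_mulf (R : realType) (f g : R -> R) (df dg s : R) :
  is_derive s (1 : R) f df -> is_derive s (1 : R) g dg ->
  is_derive s (1 : R) (fun s => f s * g s) (df * g s + f s * dg).
Proof.
move=> hf hg; have h := is_deriveM hf hg.
apply: is_derive_eq; rewrite -![_ *: _]/(_ * _); ring.
Qed.

(** * First and second order conditions at a touching pair *)

Section TwoPoint.
Variables (R : realType) (n : nat) (K : R).
Let V := ('rV[R]_n * R^o)%type.
Variables (U : opn V) (F N : V -> 'rV[R]_n.+2).
Variables (U' : opn V) (F' N' : V -> 'rV[R]_n.+2).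
Hypothesis K0 : 0 < K.
Hypothesis fp : flow_patch K U F N.
Hypothesis fp' : flow_patch K U' F' N'.
Variables (phi : sfun U) (z z' : V).
Hypothesis Uz : oset U z.
Hypothesis Uz' : oset U' z'.

Let u c : sfun U := phi * pos fp c - nml fp c.
Let y c : sfun U' := pos fp' c.
(* This is [phi d^2 / 2 - <D, nu>] with [D] the chord and [d] its length: on
   the sphere [d^2 = 2 (K^-1 - <x, y>)] and [<x, nu> = 0]. *)
Definition twopt (v w : V) (s : R) : R :=
  phi (s *: v + z) / K - \sum_c u c (s *: v + z) * y c (s *: w + z').

Let d1 (v w : V) (s : R) : R :=
  sfder v phi (s *: v + z) / K
  - \sum_c (sfder v (u c) (s *: v + z) * y c (s *: w + z')
            + u c (s *: v + z) * sfder w (y c) (s *: w + z')).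

Let d2 (v w : V) : R :=
  sfder v (sfder v phi) z / K
  - \sum_c (sfder v (sfder v (u c)) z * y c z'
            + 2 * (sfder v (u c) z * sfder w (y c) z')
            + u c z * sfder w (sfder w (y c)) z').

Lemma is_derive_twopt v w s : oset U (s *: v + z) -> oset U' (s *: w + z') ->
  is_derive s (1 : R) (twopt v w) (d1 v w s).
Proof.
move=> Us Us'; rewrite /twopt /d1; apply: is_deriveB.
  have := is_derive_mulf (is_derive_sfun phi Us) (is_derive_cst K^-1 s 1).
  by rewrite mulr0 addr0.
apply: is_derive_sumf => c.
by apply: is_derive_mulf; exact: is_derive_sfun.
Qed.

Lemma near_twopt v w : \forall s \near (0 : R),
  is_derive s (1 : R) (twopt v w) (d1 v w s).
Proof.
have h1 := near_line v Uz; have h2 := near_line w Uz'.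
by apply: filterS2 h1 h2 => s; exact: is_derive_twopt.
Qed.

Lemma is_derive_d1 v w : is_derive (0 : R) (1 : R) (d1 v w) (d2 v w).
Proof.
have d0 (f : sfun U) := is_derive_sfun0 f v Uz.
have d0' (f : sfun U') := is_derive_sfun0 f w Uz'.
rewrite /d1 /d2; apply: is_deriveB.
  have := is_derive_mulf (d0 (sfder v phi)) (is_derive_cst K^-1 (0 : R) (1 : R)).
  by rewrite mulr0 addr0.
apply: is_derive_sumf => c.
have m1 := is_derive_mulf (d0 (sfder v (u c))) (d0' (y c)).
have m2 := is_derive_mulf (d0 (u c)) (d0' (sfder w (y c))).
have e : (0 : R) *: v + z = z by rewrite scale0r add0r.
have e' : (0 : R) *: w + z' = z' by rewrite scale0r add0r.
apply: (is_derive_eq (is_deriveD m1 m2)); rewrite e e'.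
by move: (sfder v (u c) z) (sfder w (y c) z') => p q; rewrite mulr_natl mulr2n !addrA.
Qed.

Hypothesis zero : phi z / K - \sum_c u c z * y c z' = 0.
Hypothesis smin : forall v w, \forall s \near (0 : R),
  0 <= twopt (sdir v) (sdir w) s.
Hypothesis tmin : \forall s \near (0 : R),
  s < 0 -> 0 <= twopt (tdir R n) (tdir R n) s.

Lemma twopt0 v w : twopt v w 0 = 0.
Proof. by rewrite /twopt !scale0r !add0r zero. Qed.

Lemma twopt_second v w : d1 (sdir v) (sdir w) 0 = 0 /\ 0 <= d2 (sdir v) (sdir w).
Proof.
apply: (second_derivative_min (near_twopt _ _) (is_derive_d1 _ _)).
by rewrite twopt0; exact: smin.
Qed.

Lemma sfder_sdir0 (W : opn V) (f : sfun W) x : oset W x -> sfder (sdir 0) f x = 0.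
Proof. by move=> Wx; rewrite sfderE// -[sdir 0]/(0 : V) derive0. Qed.

Lemma twopt_FO1 v : sfder (sdir v) phi z / K = \sum_c sfder (sdir v) (u c) z * y c z'.
Proof.
have [+ _] := twopt_second v 0; rewrite /d1 !scale0r !add0r => /eqP.
rewrite subr_eq0 => /eqP ->; apply: eq_bigr => c _.
by rewrite (sfder_sdir0 _ Uz') mulr0 addr0.
Qed.

Lemma twopt_FO2 w : \sum_c u c z * sfder (sdir w) (y c) z' = 0.
Proof.
have [+ _] := twopt_second 0 w; rewrite /d1 !scale0r !add0r => /eqP.
rewrite (sfder_sdir0 _ Uz) mul0r sub0r oppr_eq0 => /eqP h.
rewrite -[RHS]h; apply: eq_bigr => c _.
by rewrite (sfder_sdir0 _ Uz) mul0r add0r.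
Qed.

Lemma twopt_time : pdt phi z / K
  - \sum_c (pdt (u c) z * y c z' + u c z * pdt (y c) z') <= 0.
Proof.
have h := nbhs_singleton (near_twopt (tdir R n) (tdir R n)).
have := derive_left_min h; rewrite twopt0 /d1 !scale0r !add0r; apply.
exact: tmin.
Qed.

Lemma sdir_comb (I : finType) (W : opn V) (r : I -> R) (t : I -> 'rV[R]_n)
    (f : sfun W) :
  sfder (sdir (\sum_b r b *: t b)) f = \sum_b sfC W (r b) * sfder (sdir (t b)) f.
Proof.
rewrite -sfder_sum; congr (sfder _ f).
have e : sdir (\sum_b r b *: t b) = \sum_b sdir (r b *: t b).
  apply: (big_morph (fun x : 'rV[R]_n => (x, 0) : V)) => // p q.
  by rewrite -[RHS]/(p + q, 0 + 0) addr0.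
rewrite e; apply: eq_bigr => i _.
by rewrite -[RHS]/(_ *: _, _ *: 0) scaler0.
Qed.

(** An orthogonal matrix pairing the ambient directions at the first point with those at the second;
    it will be the reflection in the bisector. *)
Variable rf : 'I_n.+2 -> 'I_n.+2 -> R.
Hypothesis rfO : forall b b', \sum_a rf a b * rf a b' = (b == b')%:R.

Let tv := tvec fp z.
Let tv' := tvec fp' z'.
Let w a := \sum_b rf a b *: tv' b.

Lemma sfder_w a (f : sfun U') :
  sfder (sdir (w a)) f z' = \sum_b rf a b * pdl fp' b f z'.
Proof.
rewrite sdir_comb (sfsum_ev Uz'); apply: eq_bigr => b _.
by rewrite (sfM_ev Uz') (sfC_ev Uz') (pdl_ev fp' b f Uz').
Qed.

(** Orthogonality of [rf] makes the pure second derivatives at the second point add up to those in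
    the Laplacian; [rf] survives only in the mixed terms. *)
Lemma sfder_ww (f : sfun U') :
  \sum_a sfder (sdir (w a)) (sfder (sdir (w a)) f) z' =
  \sum_b sfder (sdir (tv' b)) (sfder (sdir (tv' b)) f) z'.
Proof.
pose q b b' := sfder (sdir (tv' b)) (sfder (sdir (tv' b')) f) z'.
have e a : sfder (sdir (w a)) (sfder (sdir (w a)) f) z' =
    \sum_b \sum_b' rf a b * rf a b' * q b b'.
  rewrite [sfder _ (sfder _ _)]sdir_comb (sfsum_ev Uz'); apply: eq_bigr => b _.
  rewrite (sfM_ev Uz') (sfC_ev Uz') sdir_comb (der_sum (sfderD U' _)).
  rewrite (sfsum_ev Uz') mulr_sumr; apply: eq_bigr => b' _.
  rewrite (derM (sfderD U' _)) sfder_C mul0r add0r (sfM_ev Uz') (sfC_ev Uz').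
  by rewrite mulrA.
transitivity (\sum_a \sum_b \sum_b' rf a b * rf a b' * q b b').
  by apply: eq_bigr => a _; exact: e.
rewrite exchange_big; apply: eq_bigr => b _.
rewrite exchange_big; transitivity (\sum_b' (b == b')%:R * q b b').
  by apply: eq_bigr => b' _; rewrite -rfO mulr_suml.
exact: (deltasum (q b)).
Qed.

(** The second derivative tests are summed over all n + 2 pairs of directions. The drift terms by
    which these sums differ from Laplacians cancel by the first order conditions. *)
Lemma twopt_trace :
  0 <= lap (pdl fp) phi z / K
    - \sum_c (lap (pdl fp) (u c) z * y c z' + u c z * lap (pdl fp') (y c) z')
    - 2 * \sum_a \sum_c pdl fp a (u c) z * (\sum_b rf a b * pdl fp' b (y c) z').
Proof.
have s0 : 0 <= \sum_a d2 (sdir (tv a)) (sdir (w a)).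
  by apply: sumr_ge0 => a _; exact: (twopt_second _ _).2.
pose Q (f : sfun U) := \sum_a sfder (sdir (tv a)) (sfder (sdir (tv a)) f) z.
pose Q' (f : sfun U') := \sum_a sfder (sdir (tv' a)) (sfder (sdir (tv' a)) f) z'.
pose dr (f : sfun U) := \sum_l drift fp z l * pdx l f z.
pose dr' (f : sfun U') := \sum_l drift fp' z' l * pdx l f z'.
have lE f : lap (pdl fp) f z = Q f + dr f by exact: lap_ev.
have lE' f : lap (pdl fp') f z' = Q' f + dr' f by exact: lap_ev.
have drE : dr phi / K = \sum_c dr (u c) * y c z'.
  transitivity (\sum_l \sum_c drift fp z l * pdx l (u c) z * y c z'); last first.
    by rewrite exchange_big; apply: eq_bigr => c _; rewrite mulr_suml.
  rewrite mulr_suml; apply: eq_bigr => l _.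
  rewrite -mulrA [pdx l phi z / K]twopt_FO1 mulr_sumr.
  by apply: eq_bigr => c _; rewrite mulrA.
have drE' : \sum_c u c z * dr' (y c) = 0.
  transitivity (\sum_c \sum_l u c z * (drift fp' z' l * pdx l (y c) z')).
    by apply: eq_bigr => c _; rewrite mulr_sumr.
  rewrite exchange_big big1// => l _.
  rewrite -[RHS](mulr0 (drift fp' z' l)) -[in RHS](twopt_FO2 (delta_mx 0 l)).
  by rewrite mulr_sumr; apply: eq_bigr => c _; rewrite mulrCA.
suff e : \sum_a d2 (sdir (tv a)) (sdir (w a)) = lap (pdl fp) phi z / K
    - \sum_c (lap (pdl fp) (u c) z * y c z' + u c z * lap (pdl fp') (y c) z')
    - 2 * \sum_a \sum_c pdl fp a (u c) z * (\sum_b rf a b * pdl fp' b (y c) z').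
  by rewrite -e.
pose X a c := pdl fp a (u c) z * (\sum_b rf a b * pdl fp' b (y c) z').
have e1 : \sum_a d2 (sdir (tv a)) (sdir (w a)) = Q phi / K
    - \sum_c (Q (u c) * y c z' + 2 * (\sum_a X a c) + u c z * Q' (y c)).
  rewrite /d2 sumrB -mulr_suml; congr (_ - _).
  rewrite exchange_big; apply: eq_bigr => c _.
  rewrite !big_split; congr (_ + _ + _).
  - by rewrite -mulr_suml.
  - rewrite -mulr_sumr; congr (2 * _); apply: eq_bigr => a _.
    by rewrite /X sfder_w (pdl_ev fp a (u c) Uz).
  - by rewrite -mulr_sumr sfder_ww.
rewrite e1 lE.
have -> : \sum_c (lap (pdl fp) (u c) z * y c z' + u c z * lap (pdl fp') (y c) z') =
    \sum_c (Q (u c) * y c z' + u c z * Q' (y c)) + dr phi / K.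
  rewrite drE -[RHS]addr0 -[X in _ = _ + X]drE' -!big_split.
  apply: eq_bigr => c _; rewrite lE lE'.
  by move: (u c z) => p; rewrite mulrDl mulrDr addrACA addrA.
have -> : \sum_a \sum_c pdl fp a (u c) z * (\sum_b rf a b * pdl fp' b (y c) z') =
    \sum_c \sum_a X a c by exact: exchange_big.
rewrite mulr_sumr mulrDl.
have -> : \sum_c (Q (u c) * y c z' + 2 * (\sum_a X a c) + u c z * Q' (y c)) =
    \sum_c (Q (u c) * y c z' + u c z * Q' (y c)) + \sum_c 2 * (\sum_a X a c).
  by rewrite -big_split; apply: eq_bigr => c _; rewrite addrAC.
by rewrite !opprD !addrA; congr (_ - _); rewrite [RHS]addrAC addrK.
Qed.

End TwoPoint.

Section PatchValues.
Variables (R : realType) (n : nat) (K : R).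
Let V := ('rV[R]_n * R^o)%type.
Variables (U : opn V) (F N : V -> 'rV[R]_n.+2).
Hypothesis K0 : 0 < K.
Hypothesis fp : flow_patch K U F N.
Let tr2 := @sf_two_reg R V U.

Lemma pos_sq z : oset U z -> \sum_c pos fp c z * pos fp c z = K^-1.
Proof.
move=> Uz; rewrite -(fp_FF fp Uz).
by apply: eq_bigr => c _; rewrite !(posE fp c Uz).
Qed.
Lemma nml_sq z : oset U z -> \sum_c nml fp c z * nml fp c z = 1.
Proof.
move=> Uz; rewrite -[RHS](fp_NN fp Uz).
by apply: eq_bigr => c _; rewrite !(nmlE fp c Uz).
Qed.
Lemma pos_nml z : oset U z -> \sum_c pos fp c z * nml fp c z = 0.
Proof.
move=> Uz; rewrite -[RHS](fp_NF fp Uz).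
by apply: eq_bigr => c _; rewrite (nmlE fp c Uz) (posE fp c Uz) mulrC.
Qed.

Let Wf := weingarten (nml fp) (pdl fp).

Lemma pW_x a : \sum_b Wf a b * pos fp b = 0.
Proof.
exact: (weingarten_x (pdlD fp) (patch_nunu fp) (patch_xnu fp) (pdl_x K0 fp)).
Qed.
Lemma pW_nu a : \sum_b Wf a b * nml fp b = 0.
Proof. exact: (weingarten_nu tr2 (pdlD fp) (patch_nunu fp)). Qed.

Lemma dot_z (f g : 'I_n.+2 -> sfun U) z : oset U z ->
  \sum_a f a * g a = 0 -> \sum_a f a z * g a z = 0.
Proof.
by move=> Uz e; rewrite -[RHS](sf0_ev Uz) -[in RHS]e dot_ev.
Qed.

Lemma pP_ev a b z : oset U z -> pP fp a b z =
  (a == b)%:R - nml fp a z * nml fp b z - K * pos fp a z * pos fp b z.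
Proof.
move=> Uz; rewrite /pP !(sfB_ev Uz) !(sfM_ev Uz) (sfC_ev Uz).
by rewrite (sfnat_ev Uz).
Qed.

Lemma gdot_pos (phi : sfun U) c : gdot (pdl fp) phi (pos fp c) = pdl fp c phi.
Proof.
have h := P_dl (Ks K U) (pnuT fp) (pxT K0 fp) c phi.
rewrite -[RHS]h; apply: eq_bigr => a _.
by rewrite (pdl_x K0 fp) mulrC; congr (_ * _); exact: (P_sym (Ks K U) (pos fp) (nml fp)).
Qed.

Lemma pbox_u (phi : sfun U) c : pbox fp (phi * pos fp c - nml fp c) =
  pbox fp phi * pos fp c + phi * (n%:R * Ks K U * pos fp c)
  - 2%:R * pdl fp c phi - (pA2 fp * nml fp c
  + 2%:R * Ks K U * pH fp * pos fp c).
Proof.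
have e : phi * pos fp c - nml fp c = phi * pos fp c + (-1) * nml fp c by ring.
rewrite e pboxD !pboxM (pbox_x K0) (pbox_nu K0) gdot_pos.
have c1 : (-1 : sfun U) = sfC U (-1).
  by apply: sfun_eq => z Uz; rewrite (sfN_ev Uz) (sf1_ev Uz) (sfC_ev Uz).
have -> : pbox fp (-1) = 0 by rewrite c1 pbox_C.
have -> : gdot (pdl fp) (-1) (nml fp c) = 0.
  by rewrite c1 /gdot big1// => a _; rewrite pdl_C mul0r.
by ring.
Qed.

End PatchValues.

Section Contradiction.
Variables (R : realType) (n : nat) (K : R).
Let V := ('rV[R]_n * R^o)%type.
Variables (U : opn V) (F N : V -> 'rV[R]_n.+2).
Variables (U' : opn V) (F' N' : V -> 'rV[R]_n.+2).
Hypothesis K0 : 0 < K.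
Hypothesis fp : flow_patch K U F N.
Hypothesis fp' : flow_patch K U' F' N'.
Variables (phi : sfun U) (z z' : V).
Hypothesis Uz : oset U z.
Hypothesis Uz' : oset U' z'.

Let u c : sfun U := phi * pos fp c - nml fp c.

Hypothesis delta0 : 0 < K^-1 - \sum_c pos fp c z * pos fp' c z'.
Hypothesis zero : phi z / K - \sum_c u c z * pos fp' c z' = 0.
Hypothesis smin : forall v w, \forall s \near (0 : R),
  0 <= twopt fp fp' phi z z' (sdir v) (sdir w) s.
Hypothesis tmin : \forall s \near (0 : R),
  s < 0 -> 0 <= twopt fp fp' phi z z' (tdir R n) (tdir R n) s.
Hypothesis phi0 : 0 <= phi z.
Hypothesis phiA : norm2c F N z <= phi z ^+ 2.
Hypothesis supersol : 0 < pbox fp phi z + n%:R * K * phi z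
   - 2 * K * meanc F N z - norm2c F N z * phi z.

(** The time condition minus the trace condition becomes delta (box phi + n K phi - 2 K H - |A|^2
    phi) + 2 <dphi, Y> <= 0, although the first term is positive by [supersol] and the second
    nonnegative by [weingarten_quadratic]. *)
Lemma two_point_contradiction : False.
Proof.
pose X c := pos fp c z; pose Y c := pos fp' c z'.
pose nu c := nml fp c z; pose nu2 c := nml fp' c z'.
pose dphi a := pdl fp a phi z.
pose W a b := weingarten (nml fp) (pdl fp) a b z.
pose H := pH fp z; pose A := pA2 fp z; pose p := phi z.
pose P a b := (a == b)%:R - nu a * nu b - K * X a * X b.
pose P2 a b := (a == b)%:R - nu2 a * nu2 b - K * Y a * Y b.
pose B a c := dphi a * X c + p * P a c - W a c.
pose delta := K^-1 - \sum_c X c * Y c.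
pose D c := X c - Y c.
pose Rf a b := (a == b)%:R - D a * D b / delta.
have uE c : u c z = p * X c - nu c by rewrite /u (sfB_ev Uz) (sfM_ev Uz).
have BE a c : pdl fp a (u c) z = B a c.
  rewrite /u (derB (pdlD fp a)) (derM (pdlD fp a)) (pdl_x K0 fp).
  rewrite (sfB_ev Uz) (sfD_ev Uz) !(sfM_ev Uz) (pP_ev fp _ _ Uz).
  by [].
have P2E b c : pdl fp' b (pos fp' c) z' = P2 b c.
  by rewrite (pdl_x K0 fp') (pP_ev fp' _ _ Uz').
have XX : \sum_c X c * X c = K^-1 := pos_sq fp Uz.
have YY : \sum_c Y c * Y c = K^-1 := pos_sq fp' Uz'.
have NN : \sum_c nu c * nu c = 1 := nml_sq fp Uz.
have NN2 : \sum_c nu2 c * nu2 c = 1 := nml_sq fp' Uz'.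
have NX : \sum_c X c * nu c = 0 := pos_nml fp Uz.
have NY2 : \sum_c Y c * nu2 c = 0 := pos_nml fp' Uz'.
have dX : \sum_a X a * dphi a = 0 := dot_z Uz (pxT K0 fp phi).
have dN : \sum_a nu a * dphi a = 0 := dot_z Uz (pnuT fp phi).
have WX a : \sum_c W a c * X c = 0 := dot_z Uz (pW_x K0 fp a).
have WN a : \sum_c W a c * nu c = 0 := dot_z Uz (pW_nu fp a).
have XW c : \sum_a X a * W a c = 0 := dot_z Uz (pxT K0 fp (nml fp c)).
have NW c : \sum_a nu a * W a c = 0 := dot_z Uz (pnuT fp (nml fp c)).
have trW : \sum_a W a a = H by rewrite /H /pH /mcurv (sfsum_ev Uz).
have WA : \sum_a \sum_c W a c ^+ 2 = A.
  rewrite /A /pA2 /sqnormA (sfsum_ev Uz); apply: eq_bigr => a _.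
  rewrite (sfsum_ev Uz); apply: eq_bigr => c _.
  by rewrite (sfM_ev Uz) expr2.
have uY : \sum_c (p * X c - nu c) * Y c = p / K.
  move/eqP: zero; rewrite subr_eq0 => /eqP h.
  by rewrite -[p / K]/(phi z / K) h; apply: eq_bigr => c _; rewrite uE.
have FO1 a : dphi a / K = \sum_c B a c * Y c.
  rewrite /dphi (pdl_ev fp a phi Uz).
  rewrite (twopt_FO1 Uz Uz' zero smin); apply: eq_bigr => c _.
  by rewrite -(BE a c) (pdl_ev fp a (u c) Uz).
have FO2 b : \sum_c (p * X c - nu c) * P2 b c = 0.
  rewrite -[RHS](twopt_FO2 Uz Uz' zero smin (tvec fp' z' b)).
  apply: eq_bigr => c _; rewrite -uE -P2E (pdl_ev fp' b _ Uz').
  by [].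
have Kn0 : K != 0 by rewrite gt_eqF.
have dn0 : delta != 0 by rewrite gt_eqF.
have DD : \sum_c D c * D c = 2 * delta.
  transitivity (\sum_c X c * X c + \sum_c Y c * Y c - 2 * \sum_c X c * Y c).
    rewrite mulr_sumr -big_split/= -sumrB; apply: eq_bigr => c _.
    by rewrite /D; ring.
  by rewrite XX YY /delta; ring.
have rfO b b' : \sum_a Rf a b * Rf a b' = (b == b')%:R.
  transitivity (\sum_a (b == a)%:R * Rf a b'
      - D b / delta * (\sum_a (b' == a)%:R * D a)
      + D b * D b' / delta / delta * (\sum_a D a * D a)).
    rewrite !mulr_sumr -sumrB -big_split/=; apply: eq_bigr => a _.
    by rewrite /Rf [a == b]eq_sym [a == b']eq_sym; field.
  rewrite deltasum deltasum DD /Rf; field.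
  by [].
have tr := twopt_trace Uz Uz' zero smin rfO.
have tm := twopt_time Uz Uz' zero tmin.
(* The mixed second derivatives: because the reflection carries one tangent space to the other, they
   reduce to the trace of [B]. *)
have T : \sum_a \sum_c pdl fp a (u c) z * (\sum_b Rf a b * pdl fp' b (pos fp' c) z')
    = n%:R * p - H.
  transitivity (\sum_a \sum_c B a c * (\sum_b Rf a b * P2 b c)).
    apply: eq_bigr => a _; apply: eq_bigr => c _; rewrite BE; congr (_ * _).
    by apply: eq_bigr => b _; rewrite P2E.
  have e1 := reflect_P2 K0 XX YY NN NX NN2 dX dN XW NW delta0 uY FO2.
  have e2 := trace_B K0 XX NN NX dX WX trW FO1.
  exact: etrans e1 e2.
rewrite T in tr.
have bu c : pbox fp (u c) z = pbox fp phi z * X c + p * (n%:R * K * X c)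
    - 2 * dphi c - (A * nu c + 2 * K * H * X c).
  rewrite (pbox_u K0 fp); move: (pbox fp phi) => q.
  rewrite !(sfnat_ev Uz, sfB_ev Uz, sfD_ev Uz, sfM_ev Uz).
  by rewrite (sfC_ev Uz).
have by' c : pbox fp' (pos fp' c) z' = n%:R * K * Y c.
  by rewrite (pbox_x K0 fp') !(sfnat_ev Uz', sfM_ev Uz') (sfC_ev Uz').
have tot : pbox fp phi z / K
    - \sum_c (pbox fp (u c) z * Y c + u c z * pbox fp' (pos fp' c) z')
    + 2 * (n%:R * p - H) <= 0.
  have bE f : pbox fp f z = pdt f z - lap (pdl fp) f z := sfB_ev Uz _ _.
  have bE' f : pbox fp' f z' = pdt f z' - lap (pdl fp') f z' := sfB_ev Uz' _ _.
  have -> : \sum_c (pbox fp (u c) z * Y c + u c z * pbox fp' (pos fp' c) z') =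
      \sum_c (pdt (u c) z * Y c + u c z * pdt (pos fp' c) z')
      - \sum_c (lap (pdl fp) (u c) z * Y c + u c z * lap (pdl fp') (pos fp' c) z').
    rewrite -sumrB; apply: eq_bigr => c _; rewrite bE bE'.
    by rewrite mulrBl mulrBr opprD addrACA.
  rewrite bE mulrBl; move: tr tm; rewrite -/Y.
  set s1 := \sum_c _; set s2 := \sum_c _; set b1 := _ / K; set b2 := _ / K.
  by move=> ? ?; lra.
have NY := tpNY uY.
have quad := weingarten_quadratic K0 XX NN NX WX WN XW NW delta0 FO1 phi0 WA.
have AE : A = norm2c F N z := pA2_ev K0 fp Uz.
have HE : H = meanc F N z := pH_ev fp Uz.
have dY0 : 0 <= \sum_a dphi a * Y a by apply: quad; rewrite AE.
move: tot.
have -> : \sum_c (pbox fp (u c) z * Y c + u c z * pbox fp' (pos fp' c) z') =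
    (pbox fp phi z + p * n%:R * K - 2 * K * H) * (\sum_c X c * Y c)
    - 2 * (\sum_c dphi c * Y c) - A * (\sum_c nu c * Y c)
    + n%:R * K * (\sum_c (p * X c - nu c) * Y c).
  rewrite !mulr_sumr -!sumrB -big_split; apply: eq_bigr => c _.
  rewrite -[RHS]/(_ + _) bu by' uE; move: (pbox fp phi z) => q; ring.
rewrite NY uY -/delta.
have -> : \sum_c X c * Y c = K^-1 - delta by rewrite /delta; ring.
move: supersol; rewrite -HE -AE -/p => ss.
have ss' := mulr_gt0 delta0 ss; rewrite -/delta in ss'.
have k1 : n%:R * K * (p / K) = n%:R * p by field.
have k2 : p * n%:R * K * (K^-1 - delta) = n%:R * p - p * n%:R * K * delta by field.
have k3 : 2 * K * H * (K^-1 - delta) = 2 * H - 2 * K * H * delta by field.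
rewrite k1 mulrBl mulrDl k2 k3; move: ss' dY0; set g := \sum_c _.
by set b := pbox fp phi z; lra.
Qed.

End Contradiction.

(** * Local representations of the flow *)

Section Slice.
Variables (R : realType) (n : nat).
Let V := ('rV[R]_n * R^o)%type.

Lemma slice_derive (W : normedModType R) (g : V -> W) (v x : 'rV[R]_n) (t : R) :
  'D_v (fun y : 'rV[R]_n => g (y, t)) x = 'D_(sdir v) g (x, t).
Proof.
rewrite /derive; set p := fun h => _; set q := fun h => _.
suff -> : p = q by [].
apply/funext => h; rewrite /p /q /=; congr (_ *: (g _ - _)).
by rewrite -[RHS]/(h *: v + x, h *: 0 + t) scaler0 add0r.
Qed.

Lemma slice_differentiable (W : normedModType R) (g : V -> W) (x : 'rV[R]_n) (t : R) :
  differentiable g (x, t) -> differentiable (fun y : 'rV[R]_n => g (y, t)) x.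
Proof.
move=> dg; apply: (@differentiable_comp _ _ _ _ (fun y : 'rV[R]_n => (y, t : R^o)) g) => //.
Qed.

Lemma near_slice (U : opn V) x t : oset U (x, t) ->
  \forall y \near x, oset U (y, t).
Proof.
move=> Ux.
have c : {for x, continuous (fun y : 'rV[R]_n => (y, t : R^o))}.
  by apply: differentiable_continuous; apply: differentiable_pair.
have nU : nbhs ((x, t) : V) (oset U).
  by apply: open_nbhs_nbhs; split => //; exact: osetP.
exact: (c _ nU).
Qed.

Lemma open_setXT (A : set 'rV[R]_n) (B : set R^o) : open A -> open B ->
  open (A `*` B : set V).
Proof.
move=> oA oB; rewrite openE => -[x t] [/= Ax Bt].
exists (A, B) => //=; split; exact: open_nbhs_nbhs.
Qed.

End Slice.

(** * Independence of the chart *)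

Section Charts.
Variables (R : realType) (n m : nat) (M : topologicalType).
Variable S : smooth_atlas R n M.

Definition cdiff (F : M -> 'rV[R]_m) := forall c, atlas_charts S c ->
  forall x, chart_tgt c x -> differentiable (F \o chart_bwd c) x.

Definition chart_metric (c : chart R n M) (F : M -> 'rV[R]_m) x : 'M[R]_n :=
  \matrix_(i, j) dotp ('D_(delta_mx 0 i) (F \o chart_bwd c) x)
                      ('D_(delta_mx 0 j) (F \o chart_bwd c) x).
Definition chart_sff (c : chart R n M) (F N : M -> 'rV[R]_m) x : 'M[R]_n :=
  \matrix_(i, j) dotp ('D_(delta_mx 0 i) (N \o chart_bwd c) x)
                      ('D_(delta_mx 0 j) (F \o chart_bwd c) x).

Lemma derive_sum_dir (W : normedModType R) (G : 'rV[R]_n -> W) x v :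
  differentiable G x -> 'D_v G x = \sum_j v 0 j *: 'D_(delta_mx 0 j) G x.
Proof.
move=> dG; rewrite deriveE// {1}[v]row_sum_delta linear_sum.
by apply: eq_bigr => j _; rewrite linearZ deriveE.
Qed.

Lemma dotp_suml (I : finType) (r : I -> R) (f : I -> 'rV[R]_m) w :
  dotp (\sum_i r i *: f i) w = \sum_i r i * dotp (f i) w.
Proof.
rewrite /dotp; under [RHS]eq_bigr do rewrite mulr_sumr.
rewrite exchange_big/=; apply: eq_bigr => a _.
by rewrite summxE mulr_suml; apply: eq_bigr => i _; rewrite mxE mulrA.
Qed.

Lemma dotpC (u v : 'rV[R]_m) : dotp u v = dotp v u.
Proof. by apply: eq_bigr => a _; rewrite mulrC. Qed.

Lemma dotp_sumr (I : finType) (r : I -> R) (f : I -> 'rV[R]_m) w :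
  dotp w (\sum_i r i *: f i) = \sum_i r i * dotp w (f i).
Proof. by rewrite dotpC dotp_suml; apply: eq_bigr => i _; rewrite dotpC. Qed.

Lemma dotp_ge0 (u : 'rV[R]_m) : 0 <= dotp u u.
Proof. by apply: sumr_ge0 => i _; rewrite -expr2 sqr_ge0. Qed.

Lemma dotp_eq0 (u : 'rV[R]_m) : dotp u u = 0 -> u = 0.
Proof.
move=> /eqP; rewrite psumr_eq0 => [/allP h|i _]; last by rewrite -expr2 sqr_ge0.
apply/rowP => i; rewrite mxE; have := h i (mem_index_enum i).
by rewrite mulf_eq0 orbb => /eqP.
Qed.

Section Transition.
Variables (c d : chart R n M) (x : 'rV[R]_n).
Hypothesis Sc : atlas_charts S c.
Hypothesis Sd : atlas_charts S d.
Hypothesis cx : chart_tgt c x.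
Hypothesis dx : chart_dom d (chart_bwd c x).

Let tau := chart_fwd d \o chart_bwd c.
Definition jac : 'M[R]_n := \matrix_(i, j) ('D_(delta_mx 0 i) tau x) 0 j.

Lemma near_dom : \forall y \near x, chart_tgt c y /\ chart_dom d (chart_bwd c y).
Proof.
apply: filterI; first by apply: open_nbhs_nbhs; split => //; exact: chart_tgt_open.
apply: (chart_bwd_cont cx).
by apply: open_nbhs_nbhs; split => //; exact: chart_dom_open.
Qed.

Lemma tau_diff : differentiable tau x.
Proof.
have [U [g [oU Ux sg eg]]] := atlas_smooth Sc Sd (conj cx dx).
have := sg 1%N => -[/(_ x Ux) dg _].
apply: near_eq_differentiable dg.
have nU : \forall y \near x, U y by apply: open_nbhs_nbhs.
by apply: filterS2 nU near_dom => y Uy [cy dy]; apply: eg.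
Qed.

Lemma transition_derive (G : M -> 'rV[R]_m) i : cdiff G ->
  'D_(delta_mx 0 i) (G \o chart_bwd c) x =
  \sum_j jac i j *: 'D_(delta_mx 0 j) (G \o chart_bwd d) (tau x).
Proof.
move=> dG.
have tx : chart_tgt d (tau x) by exact: chart_fwd_in.
have dGd : differentiable (G \o chart_bwd d) (tau x) := dG d Sd _ tx.
rewrite (near_eq_derive (g := (G \o chart_bwd d) \o tau)); last first.
  by apply: filterS near_dom => y [cy dy]; rewrite /= chart_fwdK.
rewrite deriveE; last exact: differentiable_comp tau_diff dGd.
rewrite (diff_comp tau_diff dGd)/= -deriveE// -(deriveE _ tau_diff).
rewrite derive_sum_dir//.
by apply: eq_bigr => j _; rewrite mxE.
Qed.

Lemma transition_form (G1 G2 : M -> 'rV[R]_m) : cdiff G1 -> cdiff G2 ->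
  \matrix_(i, j) dotp ('D_(delta_mx 0 i) (G1 \o chart_bwd c) x)
                      ('D_(delta_mx 0 j) (G2 \o chart_bwd c) x) =
  jac *m (\matrix_(i, j) dotp ('D_(delta_mx 0 i) (G1 \o chart_bwd d) (tau x))
                      ('D_(delta_mx 0 j) (G2 \o chart_bwd d) (tau x))) *m jac^T.
Proof.
move=> d1 d2; apply/matrixP => i j; rewrite !mxE.
rewrite (transition_derive i d1) (transition_derive j d2) dotp_sumr.
apply: eq_bigr => k _; rewrite dotp_suml !mxE mulrC; congr (_ * _).
by apply: eq_bigr => l _; rewrite !mxE.
Qed.

End Transition.

Lemma chart_metric_unit (F : M -> 'rV[R]_m) c x : atlas_charts S c ->
  chart_tgt c x -> cdiff F ->
  (forall v, 'D_v (F \o chart_bwd c) x = 0 -> v = 0) ->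
  chart_metric c F x \in unitmx.
Proof.
move=> Sc cx dF inj; rewrite -row_free_unit -kermx_eq0; apply/rowV0P => v.
move=> /sub_kermxP vg.
apply: inj; apply: dotp_eq0; rewrite (derive_sum_dir _ (dF c Sc x cx)).
rewrite dotp_suml; under eq_bigr do rewrite dotp_sumr.
transitivity ((v *m chart_metric c F x *m v^T) 0 0); last by rewrite vg mul0mx mxE.
rewrite [RHS]mxE; under eq_bigr do rewrite mulr_sumr.
rewrite exchange_big/=; apply: eq_bigr => j _.
rewrite !mxE mulr_suml; apply: eq_bigr => i _; rewrite mxE; ring.
Qed.

Lemma conj_trace1 (J g h : 'M[R]_n) : J *m g *m J^T \in unitmx ->
  \tr (invmx (J *m g *m J^T) *m (J *m h *m J^T)) = \tr (invmx g *m h).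
Proof.
rewrite !unitmx_mul unitmx_tr => /andP[/andP[uJ ug] _].
have -> : invmx (J *m g *m J^T) = invmx J^T *m invmx g *m invmx J.
  have u : J *m g *m J^T \in unitmx by rewrite !unitmx_mul unitmx_tr uJ ug.
  apply: (can_inj (mulKmx u)); rewrite mulmxV// -!mulmxA.
  by rewrite (mulKVmx _) ?unitmx_tr// (mulKVmx ug) mulmxV.
rewrite -!mulmxA (mulKmx uJ) mxtrace_mulC -!mulmxA mulmxV ?unitmx_tr//.
by rewrite mulmx1.
Qed.

Lemma conj_trace2 (J g h : 'M[R]_n) : J *m g *m J^T \in unitmx ->
  \tr (invmx (J *m g *m J^T) *m (J *m h *m J^T) *m invmx (J *m g *m J^T)
       *m (J *m h *m J^T)^T) = \tr (invmx g *m h *m invmx g *m h^T).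
Proof.
rewrite !unitmx_mul unitmx_tr => /andP[/andP[uJ ug] _].
have -> : invmx (J *m g *m J^T) = invmx J^T *m invmx g *m invmx J.
  have u : J *m g *m J^T \in unitmx by rewrite !unitmx_mul unitmx_tr uJ ug.
  apply: (can_inj (mulKmx u)); rewrite mulmxV// -!mulmxA.
  by rewrite (mulKVmx _) ?unitmx_tr// (mulKVmx ug) mulmxV.
rewrite !trmx_mul trmxK -!mulmxA (mulKmx uJ) mxtrace_mulC -!mulmxA.
rewrite (mulKVmx _) ?unitmx_tr// (mulKmx uJ) mulmxV ?unitmx_tr// mulmx1.
by [].
Qed.

(** The curvatures are defined through the chart selected at each point, which varies with the
    point. To differentiate them one needs a formula in a single chart around the point. *)
Lemma meancurv_chart (F N : M -> 'rV[R]_m) c x : atlas_charts S c ->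
  chart_tgt c x -> cdiff F -> cdiff N ->
  (forall v, 'D_v (F \o chart_bwd c) x = 0 -> v = 0) ->
  meancurv S F N (chart_bwd c x) =
    \tr (invmx (chart_metric c F x) *m chart_sff c F N x) /\
  sffnorm2 S F N (chart_bwd c x) =
    \tr (invmx (chart_metric c F x) *m chart_sff c F N x
         *m invmx (chart_metric c F x) *m (chart_sff c F N x)^T).
Proof.
move=> Sc cx dF dN inj.
pose d := chart_at S (chart_bwd c x).
have Sd : atlas_charts S d := chart_at_atlas S _.
have dx : chart_dom d (chart_bwd c x) := chart_at_dom S _.
have gE := transition_form Sc Sd cx dx dF dF.
have hE := transition_form Sc Sd cx dx dN dF.
have ug := chart_metric_unit Sc cx dF inj.
rewrite /chart_metric gE in ug.
rewrite /chart_metric /chart_sff gE hE.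
by split; [rewrite (conj_trace1 _ ug)|rewrite (conj_trace2 _ ug)].
Qed.

End Charts.

(** * Smoothness of the curvatures up to the initial time *)

Section MeanContinuity.
Variables (R : realType) (n : nat).
Let V := ('rV[R]_n * R^o)%type.
Variables (U : opn V) (F N : V -> 'rV[R]_n.+2).
Hypothesis sF : forall k, Ck k U F.
Hypothesis sN : forall k, Ck k U N.

Lemma Ck_deriv (G : V -> 'rV[R]_n.+2) v : (forall k, Ck k U G) ->
  forall k, Ck k U (fun z => 'D_v G z).
Proof. by move=> sG k; have [_] := sG k.+1; exact. Qed.

Let dF i a : sfun U :=
  mksf (smooth_coord a (Ck_deriv (sdir (delta_mx 0 i)) sF)).
Let dN i a : sfun U :=
  mksf (smooth_coord a (Ck_deriv (sdir (delta_mx 0 i)) sN)).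
Let gM : 'M[sfun U]_n := \matrix_(i, j) \sum_a dF i a * dF j a.
Let hM : 'M[sfun U]_n := \matrix_(i, j) \sum_a dN i a * dF j a.

Lemma gM_ev z : oset U z -> \matrix_(i, j) (gM i j) z = gram F z.
Proof.
move=> Uz; apply/matrixP => i j; rewrite !mxE (sfsum_ev Uz).
by apply: eq_bigr => a _; rewrite (sfM_ev Uz) !mksfE.
Qed.

Lemma hM_ev z : oset U z -> \matrix_(i, j) (hM i j) z = secf F N z.
Proof.
move=> Uz; apply/matrixP => i j; rewrite !mxE (sfsum_ev Uz).
by apply: eq_bigr => a _; rewrite (sfM_ev Uz) !mksfE.
Qed.

(** The smooth extensions across t = 0 need not be immersions everywhere, but they are near each
    point where they are. *)
Lemma gram_open z0 : oset U z0 -> gram F z0 \in unitmx ->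
  exists U2 : opn V, [/\ oset U2 z0, oset U2 `<=` oset U &
    forall z, oset U2 z -> gram F z \in unitmx].
Proof.
move=> Uz0 u0; pose d := \det gM.
have dE z : oset U z -> d z = \det (gram F z).
  by move=> Uz; rewrite /d (sf_det_ev _ Uz) gM_ev.
have oU : open (oset U `&` [set z | d z != 0]).
  rewrite openE => z [Uz dz]; apply: filterI.
    by apply: open_nbhs_nbhs; split => //; exact: osetP.
  have cd : {for z, continuous d} := smooth_cont (sfun_smooth d) Uz.
  exact: (cvgr_neq0 _ cd dz).
exists (Opn oU); split.
- by split => //; change (d z0 != 0); rewrite (dE _ Uz0) -unitfE -unitmxE.
- by move=> z [].
- by move=> z [Uz dz]; rewrite unitmxE unitfE -(dE _ Uz); exact: dz.
Qed.

Hypothesis uF : forall z, oset U z -> gram F z \in unitmx.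

(** Only smoothness and an invertible metric enter, and no flow equation, so the lemma also applies
    around points at t = 0. *)
Lemma meanc_sfun : exists h a : sfun U, forall z, oset U z ->
  h z = meanc F N z /\ a z = norm2c F N z.
Proof.
have [|gi _ giE] := @sf_gram_inv R V U n gM.
  by move=> z Uz; rewrite gM_ev//; exact: uF.
have trE (X : 'M[sfun U]_n) z : oset U z ->
    (\tr X) z = \tr (\matrix_(i, j) (X i j) z).
  move=> Uz; rewrite /mxtrace (sfsum_ev Uz).
  by apply: eq_bigr => i _; rewrite [RHS]mxE.
exists (\tr (gi *m hM)), (\tr (gi *m hM *m gi *m hM^T)) => z Uz.
have giz : \matrix_(i, j) (gi i j) z = invmx (gram F z).
  by rewrite -(gM_ev Uz); exact: giE.
rewrite !(trE _ _ Uz) !(mulmx_ev _ _ Uz) giz hM_ev//; split => //.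
rewrite /norm2c; congr (\tr (_ *m _)).
by rewrite -hM_ev//; apply/matrixP => i j; rewrite !mxE.
Qed.

End MeanContinuity.

Section Flow.
Variables (R : realType) (n : nat) (K : R) (T : \bar R) (M : topologicalType).
Variables (S : smooth_atlas R n M) (X nu : R -> M -> 'rV[R]_n.+2).
Let V := ('rV[R]_n * R^o)%type.
Hypothesis flow : mean_curvature_flow S K T X nu.

(* [gX] and [gN] are smooth across [t = 0], but represent the flow only for
   times in [0, T). *)
Record local_rep (c : chart R n M) (U : opn V) (gX gN : V -> 'rV[R]_n.+2) : Prop :=
  LocalRep {
  lr_atlas : atlas_charts S c;
  lr_smX : forall k, Ck k U gX;
  lr_smN : forall k, Ck k U gN;
  lr_tgt : forall z, oset U z -> chart_tgt c z.1;
  lr_X : forall z, oset U z -> time_interval T z.2 ->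
    X z.2 (chart_bwd c z.1) = gX z;
  lr_N : forall z, oset U z -> time_interval T z.2 ->
    nu z.2 (chart_bwd c z.1) = gN z }.

Lemma local_rep_ex c x t : atlas_charts S c -> chart_tgt c x ->
  time_interval T t -> exists U gX gN, oset U (x, t) /\ local_rep c U gX gN.
Proof.
move=> Sc cx It; have [sX sN _] := flow.
have [U1 [g1 [P1 u1 s1 e1]]] := sX c Sc (x, t) (conj cx It).
have [U2 [g2 [P2 u2 s2 e2]]] := sN c Sc (x, t) (conj cx It).
have oU : open (U1 `&` U2 `&` (chart_tgt c `*` setT : set V)).
  apply: openI; first exact: openI.
  by apply: open_setXT; [exact: chart_tgt_open|exact: openT].
exists (Opn oU), g1, g2; split => //; split => //.
- by move=> k; apply: Ck_sub (s1 k) => z [[]].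
- by move=> k; apply: Ck_sub (s2 k) => z [[]].
- by move=> z [_ []].
- by move=> z [[z1 z2] [z3 _]] Iz; rewrite e1.
- by move=> z [[z1 z2] [z3 _]] Iz; rewrite e2.
Qed.

Lemma local_rep_sub c U U' gX gN : local_rep c U gX gN ->
  oset U' `<=` oset U -> local_rep c U' gX gN.
Proof.
move=> [Sc s1 s2 h1 h2 h3] sU; split => //.
- by move=> k; exact: Ck_sub sU (s1 k).
- by move=> k; exact: Ck_sub sU (s2 k).
- by move=> z /sU; exact: h1.
- by move=> z /sU; exact: h2.
- by move=> z /sU; exact: h3.
Qed.

Section Rep.
Variables (c : chart R n M) (U : opn V) (gX gN : V -> 'rV[R]_n.+2).
Hypothesis lr : local_rep c U gX gN.

Lemma lr_diff (G : R -> M -> 'rV[R]_n.+2) g x t :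
  (forall k, Ck k U g) -> (forall z, oset U z -> time_interval T z.2 ->
    G z.2 (chart_bwd c z.1) = g z) -> oset U (x, t) -> time_interval T t ->
  differentiable (G t \o chart_bwd c) x /\
  forall v, 'D_v (G t \o chart_bwd c) x = 'D_(sdir v) g (x, t).
Proof.
move=> sg eg Uz It.
have ne : \forall y \near x, g (y, t) = (G t \o chart_bwd c) y.
  by apply: filterS (near_slice Uz) => y Uy; rewrite /= (eg (y, t)).
split.
  apply: near_eq_differentiable ne _; apply: slice_differentiable.
  by have [h _] := sg 1%N; exact: h.
move=> v; rewrite -slice_derive; apply: near_eq_derive.
by apply: filterS ne => y ->.
Qed.

End Rep.

Lemma flow_cdiff t : time_interval T t -> cdiff S (X t) /\ cdiff S (nu t).
Proof.
move=> It; split => c Sc x cx;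
  have [U [gX [gN [Uz lr]]]] := local_rep_ex Sc cx It.
  by have [] := lr_diff (lr_smX lr) (lr_X lr) Uz It.
by have [] := lr_diff (lr_smN lr) (lr_N lr) Uz It.
Qed.

Section Rep2.
Variables (c : chart R n M) (U : opn V) (gX gN : V -> 'rV[R]_n.+2).
Hypothesis lr : local_rep c U gX gN.
Variables (x : 'rV[R]_n) (t : R).
Hypothesis Uz : oset U (x, t).
Hypothesis It : time_interval T t.

Let Sc := lr_atlas lr.
Let cx : chart_tgt c x := lr_tgt lr Uz.
Lemma lr_DX v : 'D_v (X t \o chart_bwd c) x = 'D_(sdir v) gX (x, t).
Proof. by have [_] := lr_diff (lr_smX lr) (lr_X lr) Uz It. Qed.
Lemma lr_DN v : 'D_v (nu t \o chart_bwd c) x = 'D_(sdir v) gN (x, t).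
Proof. by have [_] := lr_diff (lr_smN lr) (lr_N lr) Uz It. Qed.

Lemma lr_metric : chart_metric c (X t) x = gram gX (x, t).
Proof. by apply/matrixP => i j; rewrite !mxE !lr_DX. Qed.
Lemma lr_sff : chart_sff c (X t) (nu t) x = secf gX gN (x, t).
Proof. by apply/matrixP => i j; rewrite !mxE lr_DX lr_DN. Qed.

Let inj v : 'D_v (X t \o chart_bwd c) x = 0 -> v = 0.
Proof.
have [_ _ /(_ t It) [_ im _ _]] := flow.
by have [_ h] := im c Sc; exact: h.
Qed.

Lemma lr_curv :
  meancurv S (X t) (nu t) (chart_bwd c x) = meanc gX gN (x, t) /\
  sffnorm2 S (X t) (nu t) (chart_bwd c x) = norm2c gX gN (x, t).
Proof.
have [dX dN] := flow_cdiff It.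
have := meancurv_chart Sc cx dX dN inj.
by rewrite lr_metric lr_sff.
Qed.

Lemma lr_unit : gram gX (x, t) \in unitmx.
Proof.
have [dX dN] := flow_cdiff It.
by rewrite -lr_metric; exact: chart_metric_unit Sc cx dX inj.
Qed.

Lemma lr_normal : [/\ dotp (gX (x, t)) (gX (x, t)) = K^-1,
  dotp (gN (x, t)) (gN (x, t)) = 1, dotp (gN (x, t)) (gX (x, t)) = 0 &
  forall v, dotp (gN (x, t)) ('D_(sdir v) gX (x, t)) = 0].
Proof.
have [_ _ /(_ t It) [sph _ [n1 n2 n3] _]] := flow.
rewrite -(lr_X lr Uz It) -(lr_N lr Uz It)/=; split => // [|v].
  exact: sph.
by rewrite -lr_DX; exact: n3.
Qed.

End Rep2.

Lemma nbhs_time t : 0 < t -> time_interval T t -> nbhs t (time_interval T).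
Proof.
move=> t0 [_ tT].
have n1 : \forall s \near t, 0 < s by exact: lt_nbhsr.
have n2 : \forall s \near t, (s%:E < T)%E.
  case: (T) tT => [r||]//.
    by rewrite lte_fin => tr; apply: filterS (lt_nbhsl tr) => s; rewrite lte_fin.
  by move=> _; apply/nbhs_ballP; exists 1 => //= s _; exact: ltry.
by apply: filterS2 n1 n2 => s s0 sT; split => //; exact: ltW.
Qed.

(** At a positive time a full neighbourhood lies in [0, T), so the limit within the interval is a
    two-sided derivative. *)
Lemma lr_time c U gX gN x t : local_rep c U gX gN -> oset U (x, t) ->
  0 < t -> time_interval T t ->
  'D_(tdir R n) gX (x, t) = - meanc gX gN (x, t) *: gN (x, t).
Proof.
move=> lr Uz t0 It.
have [_ _ /(_ t It) [_ _ _ /(_ (chart_bwd c x)) lim]] := flow.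
rewrite (lr_curv lr Uz It).1 (lr_N lr Uz It) in lim.
rewrite /derive; apply: cvg_lim => //.
move=> A /lim; rewrite /= /dnbhs /within/= => nA.
have : \forall h \near (0 : R), h + t != t -> time_interval T (h + t) ->
    A ((h + t - t)^-1 *: (X (h + t) (chart_bwd c x) - X t (chart_bwd c x))).
  have ct : (fun h : R => h + t) @ (0 : R) --> t.
    by rewrite -{2}[t]add0r; apply: cvgD; [exact: cvg_id|exact: cvg_cst].
  exact: (ct _ nA).
have nI : \forall h \near (0 : R), time_interval T (h + t).
  have ct : (fun h : R => h + t) @ (0 : R) --> t.
    by rewrite -{2}[t]add0r; apply: cvgD; [exact: cvg_id|exact: cvg_cst].
  exact: (ct _ (nbhs_time t0 It)).
have nU := near_line (tdir R n) Uz.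
have hE h : h *: tdir R n + (x, t) = (x, h + t) :> V.
  by rewrite -[LHS]/(h *: 0 + x, h *: 1 + t) scaler0 add0r -[h *: 1]/(h * 1) mulr1.
move=> nAt; apply: filterS3 nI nU nAt => h Ih Uh nAh hn0.
have hn : h + t != t by rewrite -subr_eq0 addrK.
have := nAh hn Ih; rewrite addrK hE in Uh *.
rewrite (lr_X lr Uh Ih) (lr_X lr Uz It).
by rewrite -hE.
Qed.

End Flow.

Lemma dotpN (R : realType) m (u v : 'rV[R]_m) : dotp (- u) v = - dotp u v.
Proof. by rewrite -sumrN; apply: eq_bigr => i _; rewrite mxE mulNr. Qed.

Section NegNormal.
Variables (R : realType) (n : nat) (K : R).
Let V := ('rV[R]_n * R^o)%type.
Variables (U : opn V) (F N : V -> 'rV[R]_n.+2).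
Hypothesis sN : forall k, Ck k U N.

Lemma Ck_opp k : Ck k U (fun z => - N z).
Proof.
elim: k N sN => [|k IH] G sG.
  by move=> x Ux; apply: cvgN; exact: (sG 0%N).
split=> [x Ux|v].
  by apply: differentiableN; have [h _] := sG 1%N; exact: h.
apply: (Ck_ext (f := fun z => - 'D_v G z)); first exact: osetP.
  move=> x Ux; rewrite deriveN//; apply: diff_derivable.
  by have [h _] := sG 1%N; exact: h.
by apply: IH => j; have [_] := sG j.+1; exact.
Qed.

Lemma secf_opp z : oset U z -> secf F (fun z => - N z) z = - secf F N z.
Proof.
move=> Uz; apply/matrixP => i j; rewrite !mxE deriveN ?dotpN//.
by apply: diff_derivable; have [h _] := sN 1%N; exact: h.
Qed.

Lemma meanc_opp z : oset U z -> meanc F (fun z => - N z) z = - meanc F N z.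
Proof. by move=> Uz; rewrite /meanc secf_opp// mulmxN raddfN. Qed.

Lemma norm2c_opp z : oset U z -> norm2c F (fun z => - N z) z = norm2c F N z.
Proof.
move=> Uz; rewrite /norm2c secf_opp// mulmxN linearN/= !mulNmx.
by rewrite mulmxN opprK.
Qed.

End NegNormal.

(** H nu does not depend on the orientation. This reduces |<D, nu>| to <D, nu> at a touching
    pair. *)
Lemma flow_patch_opp (R : realType) (n : nat) (K : R)
    (U : opn ('rV[R]_n * R^o)%type) F N :
  flow_patch K U F N -> flow_patch K U F (fun z => - N z).
Proof.
move=> fp; split.
- exact: fp_smF fp.
- by move=> k; apply: Ck_opp; exact: fp_smN fp.
- exact: fp_FF fp.
- move=> z Uz; rewrite dotpN (dotpC (N z)) dotpN opprK.
  exact: fp_NN fp z Uz.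
- by move=> z Uz; rewrite dotpN (fp_NF fp Uz) oppr0.
- by move=> z Uz i; rewrite dotpN (fp_NdF fp Uz) oppr0.
- exact: fp_gram fp.
- move=> z Uz; rewrite (fp_flow fp Uz) (meanc_opp F (fp_smN fp) Uz).
  by rewrite opprK scalerN scaleNr.
Qed.

Section LocalData.
Variables (R : realType) (n : nat) (K : R) (T : \bar R) (M : topologicalType).
Variables (S : smooth_atlas R n M) (X nu : R -> M -> 'rV[R]_n.+2).
Let V := ('rV[R]_n * R^o)%type.
Hypothesis flow : mean_curvature_flow S K T X nu.
Let I := time_interval T.
Let Hm p t := meancurv S (X t) (nu t) p.
Let Am p t := sffnorm2 S (X t) (nu t) p.

Lemma interior_patch c U gX gN x t :
  local_rep T S X nu c U gX gN -> oset U (x, t) -> 0 < t -> I t ->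
  exists U2 : opn V, [/\ oset U2 (x, t), oset U2 `<=` oset U,
    flow_patch K U2 gX gN & forall z, oset U2 z -> 0 < z.2 /\ I z.2].
Proof.
move=> lr Uz t0 It.
have oJ : open [set s : R^o | 0 < s /\ I s].
  rewrite openE => s [s0 Is]; apply: filterI; first exact: lt_nbhsr.
  exact: nbhs_time.
have oU : open (oset U `&` (setT `*` [set s : R^o | 0 < s /\ I s]) : set V).
  apply: openI; first exact: osetP.
  by apply: open_setXT => //; exact: openT.
have sU : oset (Opn oU) `<=` oset U by move=> z [].
have lr' := local_rep_sub lr sU.
exists (Opn oU); split => //; last by move=> z [_ [_]].
split.
- exact: lr_smX lr'.
- exact: lr_smN lr'.
- move=> [y s] Uy; have [_ [_ [s0 Is]]] := Uy.
  by have [] := lr_normal flow lr' Uy Is.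
- move=> [y s] Uy; have [_ [_ [s0 Is]]] := Uy.
  by have [] := lr_normal flow lr' Uy Is.
- move=> [y s] Uy; have [_ [_ [s0 Is]]] := Uy.
  by have [] := lr_normal flow lr' Uy Is.
- move=> [y s] Uy; have [_ [_ [s0 Is]]] := Uy.
  by have [] := lr_normal flow lr' Uy Is.
- move=> [y s] Uy; have [_ [_ [s0 Is]]] := Uy.
  exact: (lr_unit flow lr' Uy Is).
- move=> [y s] Uy; have [_ [_ [s0 Is]]] := Uy.
  exact: (lr_time flow lr' Uy s0 Is).
Qed.

Lemma local_data p0 t0 : I t0 -> exists (U : opn V) gX gN (h a : sfun U),
  [/\ local_rep T S X nu (chart_at S p0) U gX gN,
      oset U (chart_fwd (chart_at S p0) p0, t0) &
      forall z, oset U z -> [/\ gram gX z \in unitmx,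
        h z = meanc gX gN z & a z = norm2c gX gN z]].
Proof.
move=> It.
have Sc : atlas_charts S (chart_at S p0) := chart_at_atlas S p0.
have cx := chart_fwd_in (chart_at_dom S p0).
have [U [gX [gN [Uz lr]]]] := local_rep_ex flow Sc cx It.
have uz := lr_unit flow lr Uz It.
have [U2 [U2z sU2 u2]] := gram_open (lr_smX lr) Uz uz.
have lr2 := local_rep_sub lr sU2.
have [h [a ha]] := meanc_sfun (lr_smX lr2) (lr_smN lr2) u2.
exists U2, gX, gN, h, a; split; [exact: lr2|exact: U2z|] => z Uz2.
have [e1 e2] := ha z Uz2; split; [exact: u2|exact: e1|exact: e2].
Qed.

Lemma near_chart (c : chart R n M) p0 t0 (A : set V) : chart_dom c p0 ->
  nbhs ((chart_fwd c p0, t0) : V) A ->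
  \forall z \near ((p0, t0) : M * R), chart_dom c z.1 /\
    A (chart_fwd c z.1, z.2).
Proof.
move=> dp [[A1 A2] /= [n1 n2] sA].
exists (chart_dom c `&` chart_fwd c @^-1` A1, A2) => /=.
  split => //; apply: filterI; last exact: (chart_fwd_cont dp).
  by apply: open_nbhs_nbhs; split => //; exact: chart_dom_open.
by move=> [p t] /= [[dcp A1p] A2t]; split => //; apply: sA.
Qed.

(** Neighbourhoods relative to the times in [0, T): the hypotheses say nothing of [X] at other
    times. *)
Definition flow_filter (p0 : M) (t0 : R) :=
  within [set z : M * R | I z.2] (nbhs ((p0, t0) : M * R)).
Definition flow_cont (f : M -> R -> R) := forall p0 t0, I t0 ->
  (fun z : M * R => f z.1 z.2) @ flow_filter p0 t0 --> f p0 t0.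

Lemma rep_cont (c : chart R n M) (U : opn V) (g : V -> R) (f : M -> R -> R) p0 t0 :
  chart_dom c p0 -> oset U (chart_fwd c p0, t0) -> smooth U g -> I t0 ->
  (forall p t, I t -> chart_dom c p -> oset U (chart_fwd c p, t) ->
    f p t = g (chart_fwd c p, t)) ->
  (fun z : M * R => f z.1 z.2) @ flow_filter p0 t0 --> f p0 t0.
Proof.
move=> dp Uz sg It fE.
have cg := smooth_cont sg Uz.
rewrite (fE _ _ It dp Uz) => A nA.
have nU : nbhs ((chart_fwd c p0, t0) : V) (oset U).
  by apply: open_nbhs_nbhs; split => //; exact: osetP.
have nB : nbhs ((chart_fwd c p0, t0) : V) (oset U `&` g @^-1` A).
  by apply: filterI => //; exact: (cg _ nA).
rewrite /flow_filter /= /within/=.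
apply: filterS (near_chart dp nB) => z [dz [Uz' Az]] Iz.
by rewrite /= fE.
Qed.

Lemma curv_cont : flow_cont Hm /\ flow_cont Am.
Proof.
split => p0 t0 It; have [U [gX [gN [h [a [lr Uz ha]]]]]] := local_data p0 It.
  apply: (rep_cont (chart_at_dom S p0) Uz (sfun_smooth h) It) => p t It' dp Up.
  have [_ -> _] := ha _ Up; rewrite -(lr_curv flow lr Up It').1.
  by rewrite chart_fwdK.
apply: (rep_cont (chart_at_dom S p0) Uz (sfun_smooth a) It) => p t It' dp Up.
have [_ _ ->] := ha _ Up; rewrite -(lr_curv flow lr Up It').2.
by rewrite chart_fwdK.
Qed.

Lemma pos_cont i : flow_cont (fun p t => X t p 0 i).
Proof.
move=> p0 t0 It; have [U [gX [gN [h [a [lr Uz ha]]]]]] := local_data p0 It.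
apply: (rep_cont (f := fun p t => X t p 0 i) (chart_at_dom S p0) Uz
  (smooth_coord i (lr_smX lr)) It).
by move=> p t It' dp Up; rewrite -(lr_X lr Up It')/= chart_fwdK.
Qed.

Lemma nml_cont i : flow_cont (fun p t => nu t p 0 i).
Proof.
move=> p0 t0 It; have [U [gX [gN [h [a [lr Uz ha]]]]]] := local_data p0 It.
apply: (rep_cont (f := fun p t => nu t p 0 i) (chart_at_dom S p0) Uz
  (smooth_coord i (lr_smN lr)) It).
by move=> p t It' dp Up; rewrite -(lr_N lr Up It')/= chart_fwdK.
Qed.

End LocalData.

(** * Chords near the diagonal *)

Section QuadraticForms.
Variables (R : realFieldType) (n m : nat).
Implicit Types (F : 'M[R]_(n, m)) (g h : 'M[R]_n) (v : 'rV[R]_n).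

Lemma mx11_sum (u w : 'rV[R]_m) : (u *m w^T) 0 0 = \sum_a u 0 a * w 0 a.
Proof. by rewrite mxE; apply: eq_bigr => a _; rewrite mxE. Qed.

Lemma quad_sum h v : (v *m h *m v^T) 0 0 = \sum_i \sum_j v 0 i * v 0 j * h i j.
Proof.
rewrite mxE exchange_big/=; apply: eq_bigr => j _.
by rewrite !mxE mulr_suml; apply: eq_bigr => i _; ring.
Qed.

Lemma quad_gram F v :
  (v *m (F *m F^T) *m v^T) 0 0 = \sum_a (v *m F) 0 a ^+ 2.
Proof.
rewrite mulmxA -mulmxA -trmx_mul mx11_sum.
by apply: eq_bigr => a _; rewrite expr2.
Qed.

Lemma gram_sym F : (invmx (F *m F^T))^T = invmx (F *m F^T).
Proof. by rewrite trmx_inv trmx_mul trmxK. Qed.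

(* Principal curvatures are bounded by [|A|], without diagonalising. *)
Lemma quad_sff F h v : F *m F^T \in unitmx ->
  ((v *m h *m v^T) 0 0) ^+ 2 <=
  \tr (invmx (F *m F^T) *m h *m invmx (F *m F^T) *m h^T)
  * ((v *m (F *m F^T) *m v^T) 0 0) ^+ 2.
Proof.
move=> ug; set g := F *m F^T in ug *; set gi := invmx g.
pose B := F^T *m gi *m h *m gi *m F; pose w := v *m F.
have -> : v *m h *m v^T = w *m (w *m B^T)^T.
  have wB : w *m B = v *m h *m gi *m F.
    by rewrite /w /B !mulmxA -(mulmxA v F) -/g (mulmxK ug).
  rewrite trmx_mul trmxK mulmxA wB /w trmx_mul !mulmxA -(mulmxA _ F) -/g.
  by rewrite (mulmxKV ug).
rewrite mx11_sum quad_gram -/w.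
have -> : \tr (gi *m h *m gi *m h^T) = \sum_a \sum_b B a b ^+ 2.
  transitivity (\tr (B *m B^T)); last first.
    apply: eq_bigr => a _; rewrite mxE; apply: eq_bigr => b _.
    by rewrite [_^T _ _]mxE expr2.
  have BT : B^T = F^T *m gi *m h^T *m gi *m F.
    by rewrite /B !trmx_mul trmxK gram_sym -/g -/gi !mulmxA.
  rewrite BT /B !mulmxA -(mulmxA _ F F^T) -/g (mulmxKV ug).
  rewrite [RHS]mxtrace_mulC !mulmxA -/g mulmxV// mul1mx.
  by rewrite [RHS]mxtrace_mulC !mulmxA.
set S := \sum_a w 0 a ^+ 2.
have S0 : 0 <= S by apply: sumr_ge0 => a _; exact: sqr_ge0.
apply: (le_trans (cauchy_schwarz_sum _ _)); rewrite -/S.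
rewrite (_ : _ * S ^+ 2 = S * ((\sum_a \sum_b B a b ^+ 2) * S)); last by ring.
rewrite ler_wpM2l// mulr_suml; apply: ler_sum => a _.
have -> : (w *m B^T) 0 a = \sum_b B a b * w 0 b.
  by rewrite mxE; apply: eq_bigr => b _; rewrite [_^T _ _]mxE mulrC.
exact: cauchy_schwarz_sum.
Qed.

(** A lower bound for the metric without eigenvalues: the dual frame [E] recovers the coordinates of
    [v] from [v *m F], and Cauchy-Schwarz bounds them. *)
Lemma gram_lower F : F *m F^T \in unitmx -> exists2 C, 0 < C &
  forall v, \sum_i v 0 i ^+ 2 <= C * (v *m (F *m F^T) *m v^T) 0 0.
Proof.
move=> ug; pose E := invmx (F *m F^T) *m F.
pose C0 := \sum_i \sum_a E i a ^+ 2.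
have C00 : 0 <= C0 by apply: sumr_ge0 => i _; apply: sumr_ge0 => a _; exact: sqr_ge0.
(* The added 1 only makes the constant positive. *)
exists (C0 + 1); first by lra.
move=> v; rewrite quad_gram; set S := \sum_a (v *m F) 0 a ^+ 2.
have S0 : 0 <= S by apply: sumr_ge0 => a _; exact: sqr_ge0.
apply: (@le_trans _ _ (C0 * S)); last by apply: ler_wpM2r => //; lra.
rewrite mulr_suml; apply: ler_sum => i _.
have -> : v 0 i = \sum_a E i a * (v *m F) 0 a.
  transitivity ((v *m F *m E^T) 0 i).
    rewrite /E trmx_mul gram_sym mulmxA -(mulmxA v) -mulmxA mulmxV//.
    by rewrite mulmx1.
  by rewrite mxE; apply: eq_bigr => a _; rewrite [_^T _ _]mxE mulrC.
exact: cauchy_schwarz_sum.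
Qed.

Lemma quad_perturb h h' v e : 0 <= e -> (forall i j, `|h' i j - h i j| <= e) ->
  (v *m h *m v^T) 0 0 - e * n%:R * \sum_i v 0 i ^+ 2 <= (v *m h' *m v^T) 0 0.
Proof.
move=> e0 he; rewrite lerBlDr -lerBlDl !quad_sum.
have -> : \sum_i \sum_j v 0 i * v 0 j * h i j -
    \sum_i \sum_j v 0 i * v 0 j * h' i j =
    \sum_i \sum_j v 0 i * v 0 j * (h i j - h' i j).
  rewrite -sumrB; apply: eq_bigr => i _; rewrite -sumrB.
  by apply: eq_bigr => j _; ring.
apply: (@le_trans _ _ (\sum_i \sum_j e * (v 0 i ^+ 2 / 2 + v 0 j ^+ 2 / 2))).
  apply: ler_sum => i _; apply: ler_sum => j _.
  apply: (le_trans (ler_norm _)); rewrite normrM mulrC.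
  apply: ler_pM => //; first by rewrite distrC.
  rewrite normrM -[v 0 i ^+ 2]real_normK ?num_real//.
  rewrite -[v 0 j ^+ 2]real_normK ?num_real//.
  have := sqr_ge0 (`|v 0 i| - `|v 0 j|); rewrite sqrrB; lra.
set q := \sum_i v 0 i ^+ 2.
have inner i : \sum_j e * (v 0 i ^+ 2 / 2 + v 0 j ^+ 2 / 2) =
    (e * n%:R / 2) * v 0 i ^+ 2 + e * q / 2.
  rewrite -mulr_sumr big_split/= sumr_const card_ord -mulr_suml -/q.
  by rewrite -mulr_natl; ring.
under eq_bigr do rewrite inner.
rewrite big_split/= sumr_const card_ord -mulr_sumr -/q -mulr_natl.
by rewrite le_eqVlt; apply/orP; left; apply/eqP; field.
Qed.

End QuadraticForms.

Lemma convex_lt (R : realType) (s a b e : R) : 0 <= s -> s <= 1 -> a < e -> b < e ->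
  s * a + (1 - s) * b < e.
Proof.
move=> s0 s1 ae be; have [->|s00] := eqVneq s 0; first by rewrite mul0r add0r subr0 mul1r.
have sp : 0 < s by rewrite lt_def s00.
have h1 : s * a < s * e by rewrite ltr_pM2l.
have h2 : (1 - s) * b <= e - s * e.
  rewrite -[X in _ <= X - _]mul1r -mulrBl.
  by rewrite ler_wpM2l ?subr_ge0// ltW.
by move: h1 h2; move: (s * a) (s * e) ((1 - s) * b) => x y z; lra.
Qed.

Lemma ball_segment (R : realType) (W : normedModType R) (a b z : W) (s e : R) :
  0 <= s -> s <= 1 -> ball a e z -> ball a e (b + z) -> ball a e (s *: b + z).
Proof.
move=> s0 s1; rewrite -ball_normE /= => bz bw.
have -> : a - (s *: b + z) = s *: (a - (b + z)) + (1 - s) *: (a - z).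
  have e1 u : a - (u + z) = (a - z) - u by rewrite opprD addrA addrAC.
  by rewrite !e1 scalerBr scalerBl scale1r [RHS]addrC addrA subrK.
apply: (le_lt_trans (ler_normD _ _)); rewrite !normrZ ger0_norm// ger0_norm ?subr_ge0//.
exact: convex_lt.
Qed.

(** * Second order expansion of the chord function *)

Section Taylor.
Variables (R : realType) (n : nat).
Let V := ('rV[R]_n * R^o)%type.
Variables (U : opn V) (x nu : 'I_n.+2 -> sfun U).

(* The Hessian in [w] of [k |x(z) - x(w)|^2 / 2 - sg <x(z) - x(w), nu(z)>]. *)
Definition chord_hess (sg k : R) (z w : V) : 'M[R]_n := \matrix_(i, j) \sum_a
  (k * (pdx i (x a) w * pdx j (x a) w) - k * (x a z - x a w) * hess (x a) w i j
   + sg * (nu a z * hess (x a) w i j)).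

Let zeta (sg k : R) (v : 'rV[R]_n) (z : V) (s : R) : R := \sum_a
  (k / 2 * ((x a z - x a (s *: sdir v + z)) * (x a z - x a (s *: sdir v + z)))
   - sg * (x a z - x a (s *: sdir v + z)) * nu a z).
Let zeta1 (sg k : R) (v : 'rV[R]_n) (z : V) (s : R) : R := \sum_a
  (- k * ((x a z - x a (s *: sdir v + z)) * sfder (sdir v) (x a) (s *: sdir v + z))
   + sg * nu a z * sfder (sdir v) (x a) (s *: sdir v + z)).
Let zeta2 (sg k : R) (v : 'rV[R]_n) (z w : V) : R := \sum_a
  (k * (sfder (sdir v) (x a) w * sfder (sdir v) (x a) w)
   - k * (x a z - x a w) * sfder (sdir v) (sfder (sdir v) (x a)) w
   + sg * (nu a z * sfder (sdir v) (sfder (sdir v) (x a)) w)).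

Lemma is_derive_scale (f : R -> R) (c df s : R) : is_derive s (1 : R) f df ->
  is_derive s (1 : R) (fun s => c * f s) (c * df).
Proof.
move=> hf; have := is_derive_mulf (is_derive_cst c s (1 : R)) hf.
by rewrite mul0r add0r.
Qed.

Lemma is_derive_csub (f : R -> R) (c df s : R) : is_derive s (1 : R) f df ->
  is_derive s (1 : R) (fun s => c - f s) (- df).
Proof.
move=> hf; have := is_deriveB (is_derive_cst c s (1 : R)) hf.
by rewrite sub0r.
Qed.

Lemma zeta_derive sg k v z s : oset U (s *: sdir v + z) ->
  is_derive s (1 : R) (zeta sg k v z) (zeta1 sg k v z s) /\
  is_derive s (1 : R) (zeta1 sg k v z) (zeta2 sg k v z (s *: sdir v + z)).
Proof.
move=> Us; split; apply: is_derive_sumf => a.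
  have d1 := is_derive_csub (x a z) (is_derive_sfun (x a) Us).
  have d2 := is_derive_scale (k / 2) (is_derive_mulf d1 d1).
  have d3 := is_derive_mulf (is_derive_scale sg d1) (is_derive_cst (nu a z) s (1 : R)).
  apply: (is_derive_eq (is_deriveB d2 d3)).
  by rewrite /cst; cbv beta; move: (sfder _ _ _) => p; field.
have d1 := is_derive_csub (x a z) (is_derive_sfun (x a) Us).
have d0 := is_derive_sfun (sfder (sdir v) (x a)) Us.
have d2 := is_derive_scale (- k) (is_derive_mulf d1 d0).
have d3 := is_derive_scale (sg * nu a z) d0.
apply: (is_derive_eq (is_deriveD d2 d3)).
by cbv beta; move: (sfder _ (sfder _ _) _) (sfder _ _ _) => p q; ring.
Qed.

Lemma zeta2E sg k v z w : oset U w ->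
  zeta2 sg k v z w = (v *m chord_hess sg k z w *m v^T) 0 0.
Proof.
move=> Uw; rewrite quad_sum.
transitivity (\sum_a \sum_i \sum_j v 0 i * v 0 j *
  (k * (pdx i (x a) w * pdx j (x a) w) - k * (x a z - x a w) * hess (x a) w i j
   + sg * (nu a z * hess (x a) w i j))).
  apply: eq_bigr => a _; rewrite (sfder2_sdir v v (x a) Uw).
  have -> : sfder (sdir v) (x a) w = \sum_i v 0 i * pdx i (x a) w.
    rewrite sfder_sdir (sfsum_ev Uw); apply: eq_bigr => i _.
    by rewrite (sfM_ev Uw) (sfC_ev Uw).
  rewrite mulr_suml !mulr_sumr -sumrB -big_split; apply: eq_bigr => i _.
  rewrite -[LHS]/(_ + _) !mulr_sumr -sumrB -big_split; apply: eq_bigr => j _.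
  rewrite -[LHS]/(_ + _).
  by move: (pdx i (x a) w) (pdx j (x a) w) (hess _ _ _ _) => p q r; ring.
rewrite exchange_big; apply: eq_bigr => i _; rewrite exchange_big.
by apply: eq_bigr => j _; rewrite [chord_hess _ _ _ _ _ _]mxE mulr_sumr.
Qed.

(** Along the segment [zeta] vanishes at 0, and so does its derivative because [nu] is normal at
    [z]. Two applications of the mean value theorem leave the second derivative, which is the
    quadratic form assumed positive. *)
Lemma chord_positive (sg k : R) (v : 'rV[R]_n) (z : V) :
  (forall s : R, 0 <= s <= 1 -> oset U (s *: sdir v + z)) ->
  \sum_a nu a z * sfder (sdir v) (x a) z = 0 ->
  (forall s : R, 0 <= s <= 1 ->
     0 < (v *m chord_hess sg k z (s *: sdir v + z) *m v^T) 0 0) ->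
  sg * \sum_a (x a z - x a (sdir v + z)) * nu a z <
  k / 2 * \sum_a (x a z - x a (sdir v + z)) ^+ 2.
Proof.
move=> Us vn pos.
have MV (f df : R -> R) (b : R) : 0 < b -> b <= 1 ->
    (forall s : R, 0 <= s <= 1 -> is_derive s (1 : R) f (df s)) ->
    exists2 s, 0 < s < b & f b - f 0 = df s * b.
  move=> b0 b1 dd.
  have der s : s \in `]0, b[%R -> is_derive s (1 : R) f (df s).
    rewrite in_itv/= => /andP[s0 sb]; apply: dd.
    by rewrite !ltW//; exact: lt_le_trans sb b1.
  have cont : {within `[0, b], continuous f}.
    apply: derivable_within_continuous => s; rewrite in_itv/= => /andP[s0 sb].
    by have [] // := dd s; rewrite s0 (le_trans sb b1).
  have [s] := MVT b0 der cont; rewrite in_itv/= subr0 => sb e.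
  by exists s.
have d1 (s : R) : 0 <= s <= 1 -> is_derive s (1 : R) (zeta sg k v z) (zeta1 sg k v z s).
  by move=> hs; exact: (zeta_derive sg k (Us s hs)).1.
have d2 (s : R) : 0 <= s <= 1 -> is_derive s (1 : R) (zeta1 sg k v z)
    ((fun s : R => zeta2 sg k v z (s *: sdir v + z)) s).
  by move=> hs; exact: (zeta_derive sg k (Us s hs)).2.
have [s1 /andP[s10 s11] e1] := MV _ _ 1 ltr01 (lexx 1) d1.
have [s2 /andP[s20 s21] e2] := MV _ _ s1 s10 (ltW s11) d2.
have z00 : (0 : R) *: sdir v + z = z by rewrite scale0r add0r.
have s2in : 0 <= s2 <= 1 by rewrite !ltW//; exact: lt_trans s21 s11.
have p2 : 0 < zeta2 sg k v z (s2 *: sdir v + z).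
  by rewrite zeta2E ?pos//; exact: Us.
have z10 : zeta1 sg k v z 0 = 0.
  rewrite /zeta1 z00 -[RHS](mulr0 sg) -[in RHS]vn mulr_sumr; apply: eq_bigr => a _.
  by rewrite subrr mul0r mulr0 add0r mulrA.
have z0 : zeta sg k v z 0 = 0.
  rewrite /zeta z00 big1// => a _.
  by rewrite subrr !mulr0 mul0r subr0.
rewrite z10 subr0 in e2; rewrite z0 subr0 mulr1 e2 in e1.
have : 0 < zeta sg k v z 1 by rewrite e1 mulr_gt0.
rewrite /zeta scale1r sumrB subr_gt0 !mulr_sumr.
by under eq_bigr do rewrite -mulrA; under [X in _ < X -> _]eq_bigr do rewrite -expr2.
Qed.

Lemma chord_hess_cont sg k z0 i j : oset U z0 ->
  (fun p : R * (V * V) => chord_hess sg p.1 p.2.1 p.2.2 i j) @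
    ((k, (z0, z0)) : R * (V * V)) --> chord_hess sg k z0 z0 i j.
Proof.
move=> Uz.
have c1 : (fun p : R * (V * V) => p.1) @ ((k, (z0, z0)) : R * (V * V)) --> k.
  exact: cvg_fst.
have cz (f : sfun U) : (fun p : R * (V * V) => f p.2.1) @
    ((k, (z0, z0)) : R * (V * V)) --> f z0.
  apply: (@cvg_comp _ _ _ (fun p : R * (V * V) => p.2.1) f _ (nbhs z0)).
    by apply: (cvg_comp _ _ cvg_snd); exact: cvg_fst.
  exact: smooth_cont (sfun_smooth f) Uz.
have cw (f : sfun U) : (fun p : R * (V * V) => f p.2.2) @
    ((k, (z0, z0)) : R * (V * V)) --> f z0.
  apply: (@cvg_comp _ _ _ (fun p : R * (V * V) => p.2.2) f _ (nbhs z0)).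
    by apply: (cvg_comp _ _ cvg_snd); exact: cvg_snd.
  exact: smooth_cont (sfun_smooth f) Uz.
rewrite [X in _ --> X]mxE.
rewrite (_ : (fun p => _) = (fun p : R * (V * V) => \sum_a
  (p.1 * (pdx i (x a) p.2.2 * pdx j (x a) p.2.2)
   - p.1 * (x a p.2.1 - x a p.2.2) * pdx i (pdx j (x a)) p.2.2
   + sg * (nu a p.2.1 * pdx i (pdx j (x a)) p.2.2)))); last first.
  by apply/funext => p; rewrite mxE.
apply: cvg_big => [|a _]; first exact: add_continuous.
apply: cvgD.
  apply: cvgB; first by apply: cvgM => //; apply: cvgM; exact: cw.
  apply: cvgM; last exact: cw.
  by apply: cvgM => //; apply: cvgB; [exact: cz|exact: cw].
apply: cvgM; first exact: cvg_cst.
by apply: cvgM; [exact: cz|exact: cw].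
Qed.

(** On the diagonal the Hessian is k g - sg h, positive definite because |A| < k. Continuity extends
    this to nearby pairs and to nearby [k'], as the scale mu sqrt G varies with the point. *)
Lemma chord_near (sg k : R) (z0 : V) (h : 'M[R]_n) :
  let F := \matrix_(i, a) pdx i (x a) z0 in
  oset U z0 -> F *m F^T \in unitmx -> sg ^+ 2 = 1 -> 0 < k ->
  (forall i j, \sum_a nu a z0 * hess (x a) z0 i j = - h i j) ->
  \tr (invmx (F *m F^T) *m h *m invmx (F *m F^T) *m h^T) < k ^+ 2 ->
  exists2 e, 0 < e & forall (k' : R) (z : V) (v : 'rV[R]_n),
    ball k e k' -> ball z0 e z -> ball z0 e (sdir v + z) -> v != 0 ->
    \sum_a nu a z * sfder (sdir v) (x a) z = 0 ->
    sg * \sum_a (x a z - x a (sdir v + z)) * nu a z <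
    k' / 2 * \sum_a (x a z - x a (sdir v + z)) ^+ 2.
Proof.
move=> F Uz ug sg2 k0 hh tk.
have [C C0 gC] := gram_lower ug.
pose q (v : 'rV[R]_n) := (v *m (F *m F^T) *m v^T) 0 0.
have q0 v : 0 <= q v by rewrite /q quad_gram; apply: sumr_ge0 => a _; exact: sqr_ge0.
set A := \tr _ in tk.
have [c c0 base] : exists2 c, 0 < c & forall v : 'rV[R]_n,
    c * \sum_i v 0 i ^+ 2 <= (v *m chord_hess sg k z0 z0 *m v^T) 0 0.
  have A0 : Num.sqrt A < k by rewrite -(ger0_norm (ltW k0)) -sqrtr_sqr ltr_sqrt// exprn_gt0.
  exists ((k - Num.sqrt A) / C) => [|v]; first by rewrite divr_gt0// subr_gt0.
  have -> : chord_hess sg k z0 z0 = k *: (F *m F^T) - sg *: h.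
    apply/matrixP => i j; rewrite !mxE -[- (sg * _)]mulrN -hh !mulr_sumr -big_split.
    apply: eq_bigr => a _; rewrite !mxE -[RHS]/(_ + _) subrr.
    by move: (pdx i _ _) (pdx j _ _) (hess _ _ _ _) => r1 r2 r3; ring.
  rewrite mulmxBr mulmxBl -!scalemxAr -!scalemxAl.
  rewrite [X in _ <= X](_ : _ = k * q v - sg * (v *m h *m v^T) 0 0); last first.
    rewrite [LHS]mxE; congr (_ + _); first by rewrite [LHS]mxE.
    by rewrite [LHS]mxE; congr (- _); rewrite [LHS]mxE.
  have hA : sg * (v *m h *m v^T) 0 0 <= Num.sqrt A * q v.
    have h1 := quad_sff h v ug; rewrite -/A -/(q v) in h1.
    have Aq0 : 0 <= Num.sqrt A * q v by rewrite mulr_ge0// sqrtr_ge0.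
    apply: (le_trans (ler_norm _)); rewrite -(ger0_norm Aq0) -ler_sqr ?nnegrE//.
    rewrite !real_normK ?num_real// !exprMn sg2 mul1r.
    (* The sign of the trace is not known here; a negative [A] lies below any square. *)
    have [A00|A00] := leP 0 A; first by rewrite sqr_sqrtr.
    apply: (le_trans h1); rewrite ler_wpM2r ?sqr_ge0//.
    by apply: (le_trans (ltW A00)); exact: sqr_ge0.
  rewrite lerBrDr; apply: (le_trans (lerD (lexx _) hA)).
  rewrite -lerBrDr -mulrBl -mulrA; apply: ler_wpM2l; first by rewrite subr_ge0; exact: ltW.
  by rewrite ler_pdivrMl//; exact: gC.
(* [quad_perturb] loses e1 n |v|^2, less than the c |v|^2 available. *)
pose e1 := c / (2 * (n%:R + 1)).
have e10 : 0 < e1 by rewrite divr_gt0// mulr_gt0// ltr_wpDl.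
have nij i j : \forall p \near ((k, (z0, z0)) : R * (V * V)),
    `|chord_hess sg p.1 p.2.1 p.2.2 i j - chord_hess sg k z0 z0 i j| <= e1.
  by exact: (@cvgr_distC_le _ _ _ _ _ _ _ (@chord_hess_cont sg k z0 i j Uz) _ e10).
have nh : \forall p \near ((k, (z0, z0)) : R * (V * V)), forall i j,
    `|chord_hess sg p.1 p.2.1 p.2.2 i j - chord_hess sg k z0 z0 i j| <= e1.
  apply: (filter_forall (F := nbhs ((k, (z0, z0)) : R * (V * V)))) => i.
  by apply: (filter_forall (F := nbhs ((k, (z0, z0)) : R * (V * V)))) => j; exact: nij.
have /nbhs_ballP[e2 /= e20 be2] := nh.
have /nbhs_ballP[e3 /= e30 be3] : nbhs z0 (oset U).
  by apply: open_nbhs_nbhs; split => //; exact: osetP.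
pose e := Num.min e2 e3.
exists e => [|k' z v bk bz bw v0 nv]; first by rewrite lt_min e20.
have seg s : 0 <= s <= 1 -> ball z0 e (s *: sdir v + z).
  by move=> /andP[s0 s1]; exact: ball_segment.
apply: chord_positive => // s s01.
  apply: be3; apply: le_ball (seg s s01); by rewrite ge_min lexx orbT.
have hp i j : `|chord_hess sg k' z (s *: sdir v + z) i j - chord_hess sg k z0 z0 i j| <= e1.
  apply: (be2 (k', (z, s *: sdir v + z)) _ i j); split => //=.
    by apply: le_ball bk; rewrite ge_min lexx.
  have le2 : e <= e2 by rewrite ge_min lexx.
  by split; [exact: le_ball le2 _ bz|exact: le_ball le2 _ (seg s s01)].
apply: (lt_le_trans _ (quad_perturb v (ltW e10) hp)).
rewrite subr_gt0; apply: (lt_le_trans _ (base v)).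
have Sv : 0 < \sum_i v 0 i ^+ 2.
  rewrite lt_def sumr_ge0 ?andbT; last by move=> i _; exact: sqr_ge0.
  apply: contra v0 => /eqP sv; apply/eqP/rowP => i; rewrite mxE.
  have /eqP := sv; rewrite psumr_eq0; last by move=> j _; exact: sqr_ge0.
  by move=> /allP/(_ i (mem_index_enum _)); rewrite sqrf_eq0 => /eqP.
rewrite ltr_pM2r// /e1 mulrAC ltr_pdivrMr; last by rewrite mulr_gt0// ltr_wpDl.
rewrite ltr_pM2l//; have : 0 <= n%:R :> R by [].
by move: (n%:R : R) => r r0; lra.
Qed.

End Taylor.

Lemma near_pair (M : topologicalType) (R : realType) (p q : M) (t : R)
    (P : M * R -> Prop) (Q : M * R -> Prop) :
  (\forall z \near ((p, t) : M * R), P z) ->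
  (\forall z \near ((q, t) : M * R), Q z) ->
  \forall z \near (((p, q), t) : (M * M) * R), P (z.1.1, z.2) /\ Q (z.1.2, z.2).
Proof.
move=> [[A1 B1] /= [nA1 nB1] sP] [[A2 B2] /= [nA2 nB2] sQ].
exists (A1 `*` A2, B1 `&` B2) => /=.
  by split; [exists (A1, A2)|exact: filterI].
by move=> [[a b] s] /= [[Aa Ab] [Bs Bs']]; split; [apply: sP|apply: sQ].
Qed.

Section NearDiagonal.
Variables (R : realType) (n : nat) (K : R) (T : \bar R) (M : topologicalType).
Variables (S : smooth_atlas R n M) (X nu : R -> M -> 'rV[R]_n.+2).
Let V := ('rV[R]_n * R^o)%type.
Hypothesis flow : mean_curvature_flow S K T X nu.
Let I := time_interval T.
Let Am p t := sffnorm2 S (X t) (nu t) p.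

Lemma sfder_coord (U : opn V) (G : V -> 'rV[R]_n.+2) (sG : forall k, Ck k U G) a v z :
  oset U z -> sfder v (mksf (smooth_coord a sG)) z = ('D_v G z) 0 a.
Proof.
move=> Uz; rewrite (sfderE v _ Uz) -(derive_coord _ _ sG Uz).
apply: near_eq_derive.
have nU : \forall y \near z, oset U y by exact: open_nbhs_nbhs (conj (osetP U) Uz).
by apply: filterS nU => y Uy; rewrite mksfE.
Qed.

(** Both signs of the normal component come from [chord_near], with [sg] equal to 1 and -1. The
    pairs are distinct as points of the manifold, so the strict inequality also shows that the
    immersion is injective near [p0]. *)
Lemma near_diagonal (f : M -> R -> R) p0 t0 : I t0 ->
  (fun z : M * R => f z.1 z.2) @ flow_filter T p0 t0 --> f p0 t0 ->
  0 < f p0 t0 -> Am p0 t0 < f p0 t0 ^+ 2 ->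
  \forall z \near (((p0, p0), t0) : (M * M) * R), I z.2 -> z.1.1 <> z.1.2 ->
    `|dotp (X z.2 z.1.1 - X z.2 z.1.2) (nu z.2 z.1.1)| <
    f z.1.1 z.2 / 2 * dotp (X z.2 z.1.1 - X z.2 z.1.2) (X z.2 z.1.1 - X z.2 z.1.2).
Proof.
move=> It cf f0 Af.
have [U [gX [gN [hU [aU [lr Uz ha]]]]]] := local_data flow p0 It.
set c := chart_at S p0 in lr Uz; set z0 := (chart_fwd c p0, t0) in Uz.
have dc : chart_dom c p0 := chart_at_dom S p0.
pose x a := mksf (smooth_coord a (lr_smX lr)).
pose w a := mksf (smooth_coord a (lr_smN lr)).
have xE a z : oset U z -> x a z = gX z 0 a by exact: mksfE.
have wE a z : oset U z -> w a z = gN z 0 a by exact: mksfE.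
have normal z v : oset U z -> I z.2 -> \sum_a w a z * sfder (sdir v) (x a) z = 0.
  move: z => [y t] Uy Iy; have [_ _ _ nn] := lr_normal flow lr Uy Iy.
  rewrite -[RHS](nn v).
  by apply: eq_bigr => a _; rewrite wE// sfder_coord.
have gE : (\matrix_(i, a) pdx i (x a) z0) *m (\matrix_(i, a) pdx i (x a) z0)^T = gram gX z0.
  apply/matrixP => i j; rewrite !mxE; apply: eq_bigr => a _.
  by rewrite !mxE /pdx !sfder_coord.
(* Obtained by differentiating <nu, d_j x> = 0. This relation holds at times of [0, T) only, but the
   derivative is spatial, so t0 = 0 is allowed. *)
have hh i j : \sum_a w a z0 * hess (x a) z0 i j = - secf gX gN z0 i j.
  pose g := \sum_a w a * pdx j (x a).
  have gz z : oset U z -> I z.2 -> g z = 0.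
    by move=> Uy Iy; rewrite /g dot_ev//; exact: normal.
  have d1 := is_derive_sfun0 g (sdir (delta_mx 0 i)) Uz.
  have d2 : is_derive (0 : R) (1 : R) (fun s => g (s *: sdir (delta_mx 0 i) + z0)) 0.
    apply: (near_eq_is_derive _ (is_derive_cst (0 : R) (0 : R) (1 : R))).
    apply: filterS (near_line (sdir (delta_mx 0 i)) Uz) => s Us.
    by rewrite gz//= scaler0 add0r.
  have : pdx i g z0 = 0.
    by rewrite -(@derive_val _ _ _ _ _ _ _ d1); exact: (@derive_val _ _ _ _ _ _ _ d2).
  rewrite (der_sum (@pdxD R n U i)) (sfsum_ev Uz) => e.
  apply/eqP; rewrite -addr_eq0 -[X in _ == X]e mxE /dotp -big_split; apply/eqP.
  apply: eq_bigr => a _; rewrite (derM (@pdxD R n U i)) (sfD_ev Uz) !(sfM_ev Uz).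
  rewrite -[LHS]/(_ + _) /hess addrC; congr (_ + _).
  by rewrite /pdx !sfder_coord.
have ug : (\matrix_(i, a) pdx i (x a) z0) *m (\matrix_(i, a) pdx i (x a) z0)^T
    \in unitmx by rewrite gE; exact: (lr_unit flow lr Uz It).
have Af2 : \tr (invmx ((\matrix_(i, a) pdx i (x a) z0) *m
      (\matrix_(i, a) pdx i (x a) z0)^T) *m secf gX gN z0 *m
    invmx ((\matrix_(i, a) pdx i (x a) z0) *m
      (\matrix_(i, a) pdx i (x a) z0)^T) *m (secf gX gN z0)^T) < f p0 t0 ^+ 2.
  rewrite gE -[X in X < _]/(norm2c gX gN z0) -(lr_curv flow lr Uz It).2.
  by rewrite chart_fwdK.
have sg1 : (1 : R) ^+ 2 = 1 by rewrite expr1n.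
have sgN : (- 1 : R) ^+ 2 = 1 by rewrite sqrrN expr1n.
have [e1 e10 h1] := chord_near Uz ug sg1 f0 hh Af2.
have [e2 e20 h2] := chord_near Uz ug sgN f0 hh Af2.
pose e := Num.min e1 e2.
have e0 : 0 < e by rewrite lt_min e10.
have nB : nbhs (z0 : V) (oset U `&` ball (z0 : V) e).
  apply: filterI; last exact: nbhsx_ballx.
  by apply: open_nbhs_nbhs; split => //; exact: osetP.
have nc := near_chart dc nB.
have nf : \forall z \near ((p0, t0) : M * R), I z.2 -> ball (f p0 t0) e (f z.1 z.2).
  exact: (cf _ (nbhsx_ballx _ _ e0)).
have np : \forall z \near ((p0, t0) : M * R), (chart_dom c z.1 /\
  (oset U `&` ball (z0 : V) e) (chart_fwd c z.1, z.2)) /\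
  (I z.2 -> ball (f p0 t0) e (f z.1 z.2)) by exact: filterI nc nf.
apply: filterS (near_pair np nc) => -[[p q] t] /=.
move=> [[[dp [Up bp]] bf] [dq [Uq bq]]] It' pq.
have {bf} bf := bf It'.
pose v := chart_fwd c q - chart_fwd c p.
have vq : sdir v + (chart_fwd c p, t) = (chart_fwd c q, t) :> V.
  by rewrite /sdir /v; congr (_, _); [rewrite subrK|rewrite add0r].
have v0 : v != 0.
  apply/eqP => v0; apply: pq; rewrite -(chart_fwdK dp) -(chart_fwdK dq).
  by congr chart_bwd; apply/esym/eqP; rewrite -subr_eq0 -/v v0.
have nv := normal _ v Up It'.
have xp a : x a (chart_fwd c p, t) = X t p 0 a.
  by rewrite xE// -(lr_X lr Up It')/= chart_fwdK.
have xq a : x a (chart_fwd c q, t) = X t q 0 a.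
  by rewrite xE// -(lr_X lr Uq It')/= chart_fwdK.
have wp a : w a (chart_fwd c p, t) = nu t p 0 a.
  by rewrite wE// -(lr_N lr Up It')/= chart_fwdK.
have dE : \sum_a (x a (chart_fwd c p, t) - x a (chart_fwd c q, t)) *
    w a (chart_fwd c p, t) = dotp (X t p - X t q) (nu t p).
  by apply: eq_bigr => a _; rewrite xp xq wp !mxE.
have d2E : \sum_a (x a (chart_fwd c p, t) - x a (chart_fwd c q, t)) ^+ 2 =
    dotp (X t p - X t q) (X t p - X t q).
  by apply: eq_bigr => a _; rewrite xp xq !mxE expr2.
have b1 : e <= e1 by rewrite ge_min lexx.
have b2 : e <= e2 by rewrite ge_min lexx orbT.
have r1 := h1 (f p t) (chart_fwd c p, t) v (le_ball b1 bf) (le_ball b1 bp).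
have r2 := h2 (f p t) (chart_fwd c p, t) v (le_ball b2 bf) (le_ball b2 bp).
rewrite vq dE d2E in r1 r2.
have := r1 (le_ball b1 bq) v0 nv; have := r2 (le_ball b2 bq) v0 nv.
by rewrite ltr_norml mul1r mulN1r => s1 s2; rewrite s2 andbT ltrNl.
Qed.

End NearDiagonal.

(** * First times and preservation of the pinching *)

Lemma compact_near_all (R : realType) (Q : topologicalType) (P : Q -> R -> Prop) (t0 : R) :
  compact [set: Q] ->
  (forall q, \forall z \near ((q, t0) : Q * R), P z.1 z.2) ->
  \forall t \near t0, forall q, P q t.
Proof.
move=> /compact_near_coveringP cQ h.
have := cQ R (nbhs t0) (fun t q => P q t) (nbhs_filter t0) (fun q _ => h q).
by apply: filterS => t ht q; exact: (ht q).
Qed.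

(** If no point were bad at the infimum of the bad times, compactness of [Q] would exclude bad
    points for a short while after it. *)
Lemma first_time (R : realType) (Q : topologicalType) (bad : Q -> R -> Prop) (t1 : R) (q1 : Q) :
  compact [set: Q] -> 0 <= t1 -> bad q1 t1 ->
  (forall q, ~ bad q 0) ->
  (forall q t, 0 <= t <= t1 -> ~ bad q t ->
    \forall z \near ((q, t) : Q * R), 0 <= z.2 <= t1 -> ~ bad z.1 z.2) ->
  exists q0 t0, [/\ 0 < t0 <= t1, bad q0 t0 & forall q t, 0 <= t < t0 -> ~ bad q t].
Proof.
move=> cQ t10 b1 b0 nb.
pose E := [set t : R | 0 <= t <= t1 /\ exists q, bad q t].
have Et1 : E t1 by split; [rewrite t10 lexx|exists q1].
have lE : has_inf E.
  by split; [exists t1|exists 0 => t [/andP[]]].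
have lbE t : E t -> inf E <= t by move=> Et; apply: ge_inf => //; case: lE.
pose t0 := inf E.
have t00 : 0 <= t0 by apply: lb_le_inf; [exists t1|move=> t [/andP[]]].
have t01 : t0 <= t1 by exact: lbE.
have [q0 bq0] : exists q0, bad q0 t0.
  apply: contrapT => nq.
  have nq' q : ~ bad q t0 by move=> bq; apply: nq; exists q.
  have h : \forall t \near t0, forall q, 0 <= t <= t1 -> ~ bad q t.
    apply: (compact_near_all (P := fun q t => 0 <= t <= t1 -> ~ bad q t) cQ) => q.
    by apply: nb => //; rewrite t00.
  have /nbhs_ballP[e /= e0 be] := h.
  have [t Et te] := inf_adherent e0 lE.
  have [tt [q bq]] := Et; apply: (be t _ q) => //.
  by rewrite /ball/= ltr_distlC ltrBlDr (le_lt_trans (lbE _ Et)) ?ltrDl// te.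
exists q0, t0; split => //.
  rewrite t01 andbT lt_def t00 andbT; apply: contraPneq bq0 => ->; exact: b0.
move=> q t /andP[tge tlt] bq.
have : t0 <= t by apply: lbE; split; [rewrite tge (le_trans (ltW tlt))|exists q].
by rewrite leNgt tlt.
Qed.

Instance flow_filter_filter (R : realType) (T : \bar R) (M : topologicalType) (p : M) (t : R) :
  Filter (flow_filter T p t).
Proof. exact: within_filter. Qed.

(** For n = 3 this is al > 1/2, weaker than al > 2/3. *)
Lemma pinch_const_gt0 (R : realType) (n : nat) (al : R) : (3 <= n)%N -> 0 < al ->
  (n = 3%N -> 2 / 3 < al) -> 0 < n%:R - 4 + 2 * al.
Proof.
move=> n3 al0 al3; have [n3'|n3'] := eqVneq n 3%N.
  by have := al3 n3'; rewrite n3'; lra.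
have : (4 : R) <= n%:R by rewrite ler_nat ltn_neqAle eq_sym n3' n3.
by lra.
Qed.

Section FlowCont.
Variables (R : realType) (T : \bar R) (M : topologicalType).
Implicit Types f g : M -> R -> R.

Lemma flow_cont_cst c : flow_cont T (fun (_ : M) (_ : R) => c).
Proof. by move=> p t It; exact: cvg_cst. Qed.

Lemma flow_contD f g : flow_cont T f -> flow_cont T g ->
  flow_cont T (fun p t => f p t + g p t).
Proof. by move=> cf cg p t It; apply: cvgD; [exact: cf|exact: cg]. Qed.

Lemma flow_contN f : flow_cont T f -> flow_cont T (fun p t => - f p t).
Proof. by move=> cf p t It; apply: cvgN; exact: cf. Qed.

Lemma flow_contM f g : flow_cont T f -> flow_cont T g ->
  flow_cont T (fun p t => f p t * g p t).
Proof. by move=> cf cg p t It; apply: cvgM; [exact: cf|exact: cg]. Qed.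

Lemma flow_cont_comp (h : R -> R) f : flow_cont T f -> continuous h ->
  flow_cont T (fun p t => h (f p t)).
Proof. by move=> cf ch p t It; apply: cvg_comp (cf p t It) (ch _). Qed.

Lemma flow_cont_sum m (f : 'I_m -> M -> R -> R) : (forall i, flow_cont T (f i)) ->
  flow_cont T (fun p t => \sum_i f i p t).
Proof.
move=> cf p t It; apply: cvg_big => [|i _]; first exact: add_continuous.
exact: cf.
Qed.

Lemma flow_cont_gt f c p0 t0 : flow_cont T f -> time_interval T t0 -> c < f p0 t0 ->
  \forall z \near ((p0, t0) : M * R), time_interval T z.2 -> c < f z.1 z.2.
Proof. by move=> cf It c0; exact: (cvgr_gt _ (cf p0 t0 It) _ c0). Qed.

Lemma flow_cont_ge0 f p0 t0 : flow_cont T f -> time_interval T t0 -> 0 < t0 ->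
  (forall t, 0 <= t < t0 -> 0 <= f p0 t) -> 0 <= f p0 t0.
Proof.
move=> cf It t00 h; rewrite leNgt; apply/negP => f0.
have nf0 : 0 < - f p0 t0 by rewrite oppr_gt0.
have [[A B] /= [nA nB] sAB] := flow_cont_gt (flow_contN cf) It nf0.
have /nbhs_ballP[e /= e0 be] := nB.
pose s := Num.max 0 (t0 - e / 2).
have s0 : 0 <= s by rewrite le_max lexx.
have st : s < t0 by rewrite gt_max t00 /= ltrBlDr ltrDl divr_gt0.
have Bs : B s.
  apply: be; rewrite /ball/= ltr_distlC; apply/andP; split.
    by apply: lt_le_trans (_ : t0 - e / 2 <= _); [lra|rewrite le_max lexx orbT].
  by apply: (lt_trans st); rewrite ltrDl.
have Is : time_interval T s.
  by case: It => _ tT; split => //; apply: lt_trans tT; rewrite lte_fin.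
have := sAB (p0, s) (conj (nbhs_singleton nA) Bs) Is.
by rewrite /= ltNge oppr_le0 h ?s0.
Qed.

End FlowCont.

(** * Preservation of the pinching *)

Section Pinching.
Variables (R : realType) (n : nat) (K : R) (T : \bar R) (M : topologicalType).
Variables (S : smooth_atlas R n M) (X nu : R -> M -> 'rV[R]_n.+2).
Let V := ('rV[R]_n * R^o)%type.
Hypothesis K0 : 0 < K.
Hypothesis flow : mean_curvature_flow S K T X nu.
Let I := time_interval T.
Let Hm p t := meancurv S (X t) (nu t) p.
Let Am p t := sffnorm2 S (X t) (nu t) p.

Definition pinch (al : R) p t :=
  (n%:R - 2 + al)^-1 * Hm p t ^+ 2 + 2 * (2 - al) * K - Am p t.

Lemma pinch_cont al : flow_cont T (pinch al).
Proof.
have [cH cA] := curv_cont flow.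
apply: flow_contD; last exact: flow_contN.
apply: flow_contD; last exact: flow_cont_cst.
apply: flow_contM; first exact: flow_cont_cst.
exact: (flow_contM cH cH).
Qed.

Lemma patch_at p0 t0 : I t0 -> 0 < t0 -> exists (U : opn V) gX gN,
  [/\ local_rep T S X nu (chart_at S p0) U gX gN,
      oset U (chart_fwd (chart_at S p0) p0, t0),
      flow_patch K U gX gN &
      forall z, oset U z -> [/\ 0 < z.2, I z.2,
        Hm (chart_bwd (chart_at S p0) z.1) z.2 = meanc gX gN z &
        Am (chart_bwd (chart_at S p0) z.1) z.2 = norm2c gX gN z]].
Proof.
move=> It t00; have [U [gX [gN [hU [aU [lr Uz ha]]]]]] := local_data flow p0 It.
have [U2 [Uz2 sU fp hI]] := interior_patch flow lr Uz t00 It.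
exists U2, gX, gN; split; [exact: (local_rep_sub lr sU)|exact: Uz2|exact: fp|].
move=> [x t] Ux; have [h1 h2] := hI _ Ux; have [e1 e2] := lr_curv flow lr (sU _ Ux) h2.
split; [exact: h1|exact: h2|exact: e1|exact: e2].
Qed.

(** At a first zero G is minimal in space and in past time, so box G <= 0; but where G = 0 the
    evolution inequality bounds box G below by a positive multiple of K^2. *)
Lemma pinch_positive al : compact [set: M] -> (3 <= n)%N -> 0 < al -> al < 1 ->
  (n = 3%N -> 2 / 3 < al) -> (forall p, 0 < pinch al p 0) ->
  forall p t, I t -> 0 < pinch al p t.
Proof.
have pc : flow_cont T (pinch al) by exact: pinch_cont.
move=> cM n3 al0 al1 al3 init p1 t1 It1; rewrite ltNge; apply/negP => b1.
have t10 : 0 <= t1 by case: It1.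
have sI t : 0 <= t <= t1 -> I t.
  by move=> /andP[tge tle]; split => //; case: It1 => _; apply: le_lt_trans; rewrite lee_fin.
have [|q t tt|p0 [t0 [t0in b0 nb]]] :=
    @first_time R M (fun p t => pinch al p t <= 0) t1 p1 cM t10 b1.
- by move=> q; apply/negP; rewrite -ltNge.
- move=> /negP; rewrite -ltNge => gt0.
  have ng := flow_cont_gt pc (sI _ tt) gt0.
  apply: filterS ng => z h zt.
  by apply/negP; rewrite -ltNge; apply: h; exact: sI.
have [t00 t01] := andP t0in.
have It0 : I t0 by apply: sI; rewrite ltW.
have pos p t : 0 <= t < t0 -> 0 < pinch al p t.
  by move=> /(nb p) /negP; rewrite -ltNge.
have nneg p : 0 <= pinch al p t0.
  by apply: (flow_cont_ge0 pc It0 t00) => t /pos-/(_ p)/ltW.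
have z0 : pinch al p0 t0 = 0 by apply: le_anti; rewrite b0 nneg.
have [U [gX [gN [lr Uz fp hU]]]] := patch_at p0 It0 t00.
set c := chart_at S p0 in lr Uz hU; set z := (chart_fwd c p0, t0) in Uz.
have gE w : oset U w -> pG fp al w = pinch al (chart_bwd c w.1) w.2.
  by move=> Uw; have [_ _ e1 e2] := hU w Uw; rewrite (pG_ev K0 fp al Uw) /pinch e1 e2.
have gz : pG fp al z = 0.
  rewrite (gE z Uz) -[LHS]/(pinch al (chart_bwd c (chart_fwd c p0)) t0).
  by rewrite chart_fwdK; [exact: z0|exact: chart_at_dom].
have le0 : pbox fp (pG fp al) z <= 0.
  apply: (@pbox_min R n K U gX gN fp (pG fp al) z Uz) => [v|].
    apply: filterS (near_line (sdir v) Uz) => s Us; rewrite gz (gE _ Us).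
    have -> : (s *: sdir v + z).2 = t0 by rewrite /= scaler0 add0r.
    exact: nneg.
  apply: filterS (near_line (tdir R n) Uz) => s Us s0; rewrite gz (gE _ Us).
  have [h _ _ _] := hU _ Us; apply/ltW/pos; rewrite (ltW h) /=.
  by rewrite /GRing.scale/= mulr1 gtrDr.
have := le_trans (pbox_pinching K0 fp Uz n3 al0 al3 al1) le0.
have b0' := pinch_const_gt0 n3 al0 al3.
rewrite gz mulr0 add0r leNgt mulr_gt0 ?exprn_gt0//.
by rewrite !mulr_gt0// subr_gt0; apply: (lt_trans al1); rewrite ltr1n.
Qed.

End Pinching.

(** * Noncollapsing *)

Lemma dotpB_sq (R : realType) m (u v : 'rV[R]_m) :
  dotp (u - v) (u - v) = dotp u u + dotp v v - 2 * dotp u v.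
Proof.
rewrite /dotp mulr_sumr -!big_split -sumrB; apply: eq_bigr => i _.
by rewrite !mxE -[RHS]/(_ + _ - _); ring.
Qed.

Lemma dotpBl (R : realType) m (u v w : 'rV[R]_m) :
  dotp (u - v) w = dotp u w - dotp v w.
Proof. by rewrite /dotp -sumrB; apply: eq_bigr => i _; rewrite !mxE mulrBl. Qed.

(* The tangent line of the concave square root: it replaces [mu sqrt G] by a
   function of the form [lam G + kap] touching it from above. *)
Lemma tangent_le (R : realType) (mu s g : R) : 0 <= mu -> 0 < s -> 0 <= g ->
  mu * Num.sqrt g <= mu / (2 * s) * g + mu * s / 2.
Proof.
move=> m0 s0 g0; have e : g = Num.sqrt g ^+ 2 by rewrite sqr_sqrtr.
rewrite {2}e; move: (Num.sqrt g) => r; rewrite -subr_ge0.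
have -> : mu / (2 * s) * r ^+ 2 + mu * s / 2 - mu * r = mu / (2 * s) * (r - s) ^+ 2.
  by field; rewrite gt_eqF.
by rewrite mulr_ge0 ?sqr_ge0// divr_ge0// mulr_ge0// ltW.
Qed.

(** The terms in |A|^2 cancel; what remains is at least (n - be - 2) K ph + 2 K (ph - H) + c0. *)
Lemma supersol_gt0 (R : realType) (n K H A B ph be c0 : R) :
  0 < K -> 0 < c0 -> 2 <= n - be -> `|H| <= ph ->
  ph * (A - be * K) + c0 <= B ->
  0 < B + n * K * ph - 2 * K * H - A * ph.
Proof.
move=> K0 c00 nb Hp hB; have h1 : H <= ph := le_trans (ler_norm _) Hp.
have p0 : 0 <= ph := le_trans (normr_ge0 _) Hp.
have h2 : 0 <= K * (ph - H) by rewrite mulr_ge0 ?subr_ge0// ltW.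
have h3 : 0 <= (n - be - 2) * (K * ph) by rewrite mulr_ge0 ?subr_ge0// mulr_ge0// ltW.
have e : ph * (A - be * K) + c0 + n * K * ph - 2 * K * H - A * ph =
  (n - be - 2) * (K * ph) + 2 * (K * (ph - H)) + c0 by ring.
have : 0 < ph * (A - be * K) + c0 + n * K * ph - 2 * K * H - A * ph.
  by rewrite e ltr_wpDl// addr_ge0// mulr_ge0.
by move=> h; apply: (lt_le_trans h); rewrite !lerD2r.
Qed.

(** * A touching pair for mu sqrt G *)

Section Touching.
Variables (R : realType) (n : nat) (K : R).
Let V := ('rV[R]_n * R^o)%type.
Variables (U U' : opn V) (F N F' N' : V -> 'rV[R]_n.+2).
Hypothesis K0 : 0 < K.
Hypothesis fp : flow_patch K U F N.
Hypothesis fp' : flow_patch K U' F' N'.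

Lemma twoptE (phi : sfun U) w w' : oset U w -> oset U' w' ->
  phi w / K - \sum_c (phi * pos fp c - nml fp c) w * pos fp' c w' =
  phi w / 2 * dotp (F w - F' w') (F w - F' w') - dotp (F w - F' w') (N w).
Proof.
move=> Uw Uw'; rewrite dotpB_sq dotpBl (fp_FF fp Uw) (fp_FF fp' Uw').
rewrite (dotpC (F w) (N w)) (fp_NF fp Uw).
have -> : \sum_c (phi * pos fp c - nml fp c) w * pos fp' c w' =
    phi w * dotp (F w) (F' w') - dotp (F' w') (N w).
  rewrite /dotp mulr_sumr -sumrB; apply: eq_bigr => c _.
  rewrite (sfB_ev Uw) (sfM_ev Uw) (posE fp c Uw) (posE fp' c Uw') (nmlE fp c Uw).
  by rewrite mulrBl mulrA [X in _ - X]mulrC.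
by move: (phi w) (dotp _ _) (dotp _ _) => a b c; field; rewrite gt_eqF.
Qed.

Variables (al mu : R) (z z' : V).
Hypotheses (n3 : (3 <= n)%N) (al0 : 0 < al) (al1 : al < 1).
Hypothesis al3 : n = 3%N -> 2 / 3 < al.
Hypothesis Uz : oset U z.
Hypothesis Uz' : oset U' z'.
Hypothesis mu0 : 0 < mu.
Let G w : R := (n%:R - 2 + al)^-1 * meanc F N w ^+ 2 + 2 * (2 - al) * K - norm2c F N w.
Hypothesis G0 : forall w, oset U w -> 0 < G w.
Hypothesis GA : norm2c F N z <= mu ^+ 2 * G z.
Hypothesis GH : meanc F N z ^+ 2 <= mu ^+ 2 * G z.
Let Z w w' := mu * Num.sqrt (G w) / 2 * dotp (F w - F' w') (F w - F' w')
  - dotp (F w - F' w') (N w).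
Hypothesis d0 : 0 < dotp (F z - F' z') (F z - F' z').
Hypothesis zero : Z z z' = 0.
Hypothesis smin : forall v w, \forall s \near (0 : R),
  oset U (s *: sdir v + z) -> oset U' (s *: sdir w + z') ->
  0 <= Z (s *: sdir v + z) (s *: sdir w + z').
Hypothesis tmin : \forall s \near (0 : R), s < 0 ->
  oset U (s *: tdir R n + z) -> oset U' (s *: tdir R n + z') ->
  0 <= Z (s *: tdir R n + z) (s *: tdir R n + z').

Lemma touching_contradiction : False.
Proof.
pose s := Num.sqrt (G z).
have Gz := G0 Uz.
have s0 : 0 < s by rewrite sqrtr_gt0.
have s2 : s ^+ 2 = G z by rewrite sqr_sqrtr// ltW.
(* The tangent of mu sqrt at G(z): [phi] equals mu sqrt G at [z] and lies above it elsewhere, so its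
   two-point function keeps the zero and stays nonnegative nearby. *)
pose lam := mu / (2 * s); pose kap := mu * s / 2.
pose phi : sfun U := sfC U lam * pG fp al + sfC U kap.
have phiE w : oset U w -> phi w = lam * G w + kap.
  by move=> Uw; rewrite /phi (sfD_ev Uw) (sfM_ev Uw) !(sfC_ev Uw) (pG_ev K0 fp al Uw).
have phiz : phi z = mu * s.
  by rewrite (phiE z Uz) -s2 /lam /kap; field; rewrite gt_eqF.
have phige w w' : oset U w -> oset U' w' -> 0 <= Z w w' ->
    0 <= phi w / K - \sum_c (phi * pos fp c - nml fp c) w * pos fp' c w'.
  move=> Uw Uw' Z0; rewrite (twoptE phi Uw Uw'); apply: (le_trans Z0).
  rewrite lerB// ler_wpM2r ?dotp_ge0// ler_pM2r ?invr_gt0// (phiE w Uw).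
  exact: (tangent_le (ltW mu0) s0 (ltW (G0 Uw))).
have be0 := pinch_const_gt0 n3 al0 al3.
apply: (@two_point_contradiction R n K U F N U' F' N' K0 fp fp' phi z z' Uz Uz').
- have := d0; rewrite dotpB_sq (fp_FF fp Uz) (fp_FF fp' Uz').
  have -> : \sum_c pos fp c z * pos fp' c z' = dotp (F z) (F' z').
    by apply: eq_bigr => c _; rewrite (posE fp c Uz) (posE fp' c Uz').
  by move: (K^-1) (dotp _ _) => a b; lra.
- by rewrite (twoptE phi Uz Uz') phiz; exact: zero.
- move=> v w; apply: filterS3 (smin v w) (near_line (sdir v) Uz) (near_line (sdir w) Uz').
  by move=> t h Ut Ut'; exact: (phige _ _ Ut Ut' (h Ut Ut')).
- apply: filterS3 tmin (near_line (tdir R n) Uz) (near_line (tdir R n) Uz').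
  by move=> t h Ut Ut' t0; exact: (phige _ _ Ut Ut' (h t0 Ut Ut')).
- by rewrite phiz mulr_ge0// ltW.
- by rewrite phiz exprMn s2.
apply: (@supersol_gt0 R n%:R K _ _ _ _ (n%:R - 4 + 2 * al)
  (lam * (4 * (2 - al) * (n%:R - 4 + 2 * al) * K ^+ 2))) => //.
- have l0 : 0 < lam by rewrite divr_gt0// mulr_gt0.
  by rewrite mulr_gt0// !mulr_gt0// ?exprn_gt0// subr_gt0; apply: (lt_trans al1); rewrite ltr1n.
(* The condition n - be >= 2 amounts to al <= 1. *)
- by move: (n%:R) al1 => r h; lra.
- have p0 : 0 <= mu * s by rewrite mulr_ge0// ltW.
  rewrite phiz -(ger0_norm p0) -ler_sqr ?nnegrE//.
  by rewrite !real_normK ?num_real// exprMn s2.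
have -> : pbox fp phi z = lam * pbox fp (pG fp al) z.
  rewrite /phi (pboxD fp) (pboxM fp) !(pbox_C fp).
  have -> : gdot (pdl fp) (sfC U lam) (pG fp al) = 0.
    by rewrite /gdot big1// => a _; rewrite (pdl_C fp) mul0r.
  by rewrite mul0r add0r mulr0 subr0 addr0 (sfM_ev Uz) (sfC_ev Uz).
have l0 : 0 < lam by rewrite divr_gt0// mulr_gt0.
apply: le_trans (_ : lam * (2 * (norm2c F N z - (n%:R - 4 + 2 * al) * K) * pG fp al z
    + 4 * (2 - al) * (n%:R - 4 + 2 * al) * K ^+ 2) <= _); last first.
  by rewrite ler_pM2l//; exact: pbox_pinching.
(* The factor 2 in the evolution of G matches the square root: 2 lam s^2 = mu s, which is phi at
   [z]. *)
rewrite (pG_ev K0 fp al Uz) -/(G z) -s2 phiz [X in _ <= X]mulrDr.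
rewrite le_eqVlt; apply/orP; left; apply/eqP; congr (_ + _); rewrite /lam.
by move: (norm2c F N z) => A; field; rewrite gt_eqF.
Qed.

End Touching.

(** The product of [d] and exp(C t) is nondecreasing. *)
Lemma gronwall_gt0 (R : realType) (d d' : R -> R) (C t1 t0 : R) : t1 < t0 ->
  (forall t : R, t1 <= t <= t0 -> is_derive t (1 : R) d (d' t)) ->
  (forall t, t1 < t < t0 -> - (C * d t) <= d' t) -> 0 < d t1 -> 0 < d t0.
Proof.
move=> t10 dd dge d1.
pose g t := expR (C * t) * d t; pose g' t := expR (C * t) * (C * d t + d' t).
have dg (t : R) : t1 <= t <= t0 -> is_derive t (1 : R) g (g' t).
  move=> tt; have h1 : is_derive t (1 : R) (fun t => C * t) C.
    apply: (is_derive_eq (is_derive_scale C (is_derive_id t (1 : R)))).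
    by rewrite mulr1.
  have h2 := is_derive1_comp (is_derive_expR (C * t)) h1.
  apply: (is_derive_eq (is_derive_mulf h2 (dd t tt))).
  by rewrite /g' /comp /GRing.scale/=; ring.
have cont : {within `[t1, t0], continuous g}.
  apply: derivable_within_continuous => t; rewrite in_itv/= => tt.
  by have [] := dg t tt.
have der t : t \in `]t1, t0[%R -> is_derive t (1 : R) g (g' t).
  by rewrite in_itv/= => /andP[a b]; apply: dg; rewrite !ltW.
have [s] := MVT t10 der cont; rewrite in_itv/= => st e.
have : 0 <= g' s * (t0 - t1).
  apply: mulr_ge0; last by rewrite subr_ge0 ltW.
  apply: mulr_ge0; first exact: expR_ge0.
  by rewrite -lerBlDl sub0r; exact: dge.
rewrite -e subr_ge0 => h.
have : 0 < g t0 by apply: lt_le_trans h; rewrite mulr_gt0// expR_gt0.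
by rewrite /g pmulr_rgt0// expR_gt0.
Qed.

Section Pairs.
Variables (R : realType) (T : \bar R) (M : topologicalType).
Implicit Types f : M -> R -> R.

Lemma flow_cont_fst f : flow_cont T f ->
  flow_cont T (fun (z : (M * M)%type) t => f z.1 t).
Proof.
move=> cf [p q] t It A nA; have h := cf p t It A nA.
have nT : nbhs ((q, t) : M * R) setT by exact: filterT.
by apply: filterS (near_pair h nT) => z [].
Qed.

Lemma flow_cont_snd f : flow_cont T f ->
  flow_cont T (fun (z : (M * M)%type) t => f z.2 t).
Proof.
move=> cf [p q] t It A nA; have h := cf q t It A nA.
have nT : nbhs ((p, t) : M * R) setT by exact: filterT.
by apply: filterS (near_pair nT h) => z [].
Qed.

End Pairs.

Section PairDistance.
Variables (R : realType) (n : nat) (K : R) (T : \bar R) (M : topologicalType).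
Variables (S : smooth_atlas R n M) (X nu : R -> M -> 'rV[R]_n.+2).
Let V := ('rV[R]_n * R^o)%type.
Hypothesis flow : mean_curvature_flow S K T X nu.
Let I := time_interval T.
Let Hm p t := meancurv S (X t) (nu t) p.
Let D (z : M * M) t := X t z.1 - X t z.2.
Let dist2 (z : M * M) t := dotp (D z t) (D z t).

Lemma dist2_cont : flow_cont T dist2.
Proof.
have c i : flow_cont T (fun (z : (M * M)%type) t => D z t 0 i * D z t 0 i).
  have c1 : flow_cont T (fun (z : (M * M)%type) t => X t z.1 0 i - X t z.2 0 i).
    apply: flow_contD; first exact: (flow_cont_fst (pos_cont flow (i:=i))).
    by apply: flow_contN; exact: (flow_cont_snd (pos_cont flow (i:=i))).
  have -> : (fun z t => D z t 0 i * D z t 0 i) =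
      (fun z t => (X t z.1 0 i - X t z.2 0 i) * (X t z.1 0 i - X t z.2 0 i)).
    by apply/funext => z; apply/funext => t; rewrite /D !mxE.
  exact: (flow_contM c1 c1).
exact: (flow_cont_sum c).
Qed.

Lemma chord_cont : flow_cont T (fun (z : (M * M)%type) t => dotp (D z t) (nu t z.1)).
Proof.
have c i : flow_cont T (fun (z : (M * M)%type) t => D z t 0 i * nu t z.1 0 i).
  have c1 : flow_cont T (fun (z : (M * M)%type) t => X t z.1 0 i - X t z.2 0 i).
    apply: flow_contD; first exact: (flow_cont_fst (pos_cont flow (i:=i))).
    by apply: flow_contN; exact: (flow_cont_snd (pos_cont flow (i:=i))).
  have -> : (fun (z : (M * M)%type) t => D z t 0 i * nu t z.1 0 i) =
      (fun z t => (X t z.1 0 i - X t z.2 0 i) * nu t z.1 0 i).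
    by apply/funext => z; apply/funext => t; rewrite /D !mxE.
  exact: (flow_contM c1 (flow_cont_fst (nml_cont flow (i:=i)))).
exact: (flow_cont_sum c).
Qed.

Lemma time_derive p t a : I t -> 0 < t ->
  is_derive (t : R) (1 : R) (fun s => X s p 0 a) (- Hm p t * nu t p 0 a).
Proof.
move=> It t0; have [U [gX [gN [lr Uz fp hU]]]] := patch_at flow p It t0.
set c := chart_at S p in lr Uz hU; set z := (chart_fwd c p, t) in Uz.
have dc : chart_dom c p := chart_at_dom S p.
have lineE (s : R) : s *: tdir R n + ((chart_fwd c p, 0) : V) = (chart_fwd c p, s) :> V.
  by rewrite /tdir; congr (_, _); rewrite /= ?scaler0 ?add0r// addr0 /GRing.scale/= mulr1.
have Uz2 : oset U (t *: tdir R n + ((chart_fwd c p, 0) : V)) by rewrite lineE.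
have h1 := is_derive_sfun (pos fp a) Uz2; rewrite lineE -/z in h1.
have v1 : sfder (tdir R n) (pos fp a) z = - Hm p t * nu t p 0 a.
  rewrite (der_pos fp a _ Uz) (fp_flow fp Uz) !mxE.
  have [_ _ <- _] := hU _ Uz; rewrite -(lr_N lr Uz It) /z.
  by rewrite -[(_, _).1]/(chart_fwd c p) -[(_, _).2]/t chart_fwdK.
rewrite v1 in h1.
apply: (near_eq_is_derive _ h1).
have cl : (fun s : R => s *: tdir R n + ((chart_fwd c p, 0) : V)) @ t -->
    t *: tdir R n + ((chart_fwd c p, 0) : V).
  by apply: cvgD; [exact: scalel_continuous|exact: cvg_cst].
have nt : nbhs t [set s : R | oset U (s *: tdir R n + ((chart_fwd c p, 0) : V))].
  by apply: cl; apply: open_nbhs_nbhs; split => //; exact: osetP.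
apply: filterS nt => s /= Us; rewrite lineE; rewrite lineE in Us.
have e : pos fp a (chart_fwd c p, s) = gX (chart_fwd c p, s) 0 a by exact: posE.
have [_ Is _ _] := hU _ Us.
by rewrite [LHS]e -(lr_X lr Us Is) /= chart_fwdK.
Qed.

End PairDistance.

Lemma dotp0l (R : realType) m (u : 'rV[R]_m) : dotp 0 u = 0.
Proof. by rewrite /dotp big1// => i _; rewrite mxE mul0r. Qed.

Lemma chord_rate (R : realType) (d a b f g H H' C : R) : 0 <= d ->
  `|a| <= f / 2 * d -> `|b| <= g / 2 * d -> `|H| * f + `|H'| * g <= C ->
  - (C * d) <= 2 * (H' * b - H * a).
Proof.
move=> d0 ha hb hC.
have h1 : H * a <= `|H| * (f / 2 * d).
  by apply: (le_trans (ler_norm _)); rewrite normrM ler_wpM2l.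
have h2 : - (H' * b) <= `|H'| * (g / 2 * d).
  by apply: (le_trans (ler_norm _)); rewrite normrN normrM ler_wpM2l.
have h3 : (`|H| * f + `|H'| * g) * d <= C * d by rewrite ler_wpM2r.
move: h1 h2 h3; move: `|H| `|H'| (H * a) (H' * b) => x y u v.
have -> : (x * f + y * g) * d = 2 * (x * (f / 2 * d)) + 2 * (y * (g / 2 * d)) by field.
by move: (x * _) (y * _) (C * d) => p q r; lra.
Qed.

(** * The first touching pair *)

Section Separation.
Variables (R : realType) (n : nat) (K : R) (T : \bar R) (M : topologicalType).
Variables (S : smooth_atlas R n M) (X nu : R -> M -> 'rV[R]_n.+2).
Let V := ('rV[R]_n * R^o)%type.
Hypothesis K0 : 0 < K.
Hypothesis flow : mean_curvature_flow S K T X nu.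
Hypothesis cM : compact [set: M].
Let I := time_interval T.
Let Hm p t := meancurv S (X t) (nu t) p.
Let Am p t := sffnorm2 S (X t) (nu t) p.
Let D (z : M * M) t := X t z.1 - X t z.2.
Let dist2 (z : M * M) t := dotp (D z t) (D z t).
Variables (al mu : R).
Hypotheses (n3 : (3 <= n)%N) (al0 : 0 < al) (al1 : al < 1).
Hypothesis al3 : n = 3%N -> 2 / 3 < al.
Hypothesis mu0 : 0 < mu.
Let G := pinch K S X nu al.
Let f p t := mu * Num.sqrt (G p t).
Let Z (z : M * M) t := f z.1 t / 2 * dist2 z t - `|dotp (D z t) (nu t z.1)|.
Hypothesis G0 : forall p t, I t -> 0 < G p t.
Hypothesis GA : forall p t, I t -> Am p t < mu ^+ 2 * G p t.
Hypothesis GH : forall p t, I t -> Hm p t ^+ 2 <= mu ^+ 2 * G p t.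
Hypothesis init : forall z : M * M, z.1 <> z.2 -> 0 < Z z 0.

Lemma f_cont : flow_cont T f.
Proof.
have c : flow_cont T G by exact: (pinch_cont flow).
apply: flow_contM; first exact: flow_cont_cst.
by apply: (flow_cont_comp c); exact: sqrt_continuous.
Qed.

Lemma f_gt0 p t : I t -> 0 < f p t.
Proof. by move=> It; rewrite mulr_gt0// sqrtr_gt0; exact: G0. Qed.

Lemma f_sq p t : I t -> f p t ^+ 2 = mu ^+ 2 * G p t.
Proof. by move=> It; rewrite exprMn sqr_sqrtr// ltW// G0. Qed.

Lemma Z_cont : flow_cont T Z.
Proof.
have c1 : flow_cont T (fun (z : (M * M)%type) t => dotp (D z t) (nu t z.1)).
  exact: (chord_cont flow).
have c2 : flow_cont T dist2 by exact: (dist2_cont flow).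
have c3 : flow_cont T (fun (z : (M * M)%type) t => f z.1 t).
  exact: (flow_cont_fst f_cont).
apply: flow_contD.
  by apply: flow_contM c2; apply: flow_contM c3 _; exact: flow_cont_cst.
by apply: flow_contN; apply: (flow_cont_comp c1); exact: norm_continuous.
Qed.

Lemma Z_diag p t : Z (p, p) t = 0.
Proof. by rewrite /Z /dist2 /D /= subrr !dotp0l mulr0 normr0 subrr. Qed.

(** Off the diagonal this is continuity of [Z]. On the diagonal [Z] vanishes, continuity says
    nothing, and [near_diagonal] takes over, thanks to mu^2 G > |A|^2. *)
Lemma near_not_bad (z : M * M) t : I t -> ~ (z.1 <> z.2 /\ Z z t <= 0) ->
  \forall y \near ((z, t) : (M * M) * R), I y.2 -> ~ (y.1.1 <> y.1.2 /\ Z y.1 y.2 <= 0).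
Proof.
move=> It; have [zz|zz] := pselect (z.1 = z.2) => nb.
  case: z zz nb => p q /= <- _.
  have nd : \forall z \near (((p, p), t) : (M * M) * R), I z.2 -> z.1.1 <> z.1.2 ->
      `|dotp (X z.2 z.1.1 - X z.2 z.1.2) (nu z.2 z.1.1)| <
      f z.1.1 z.2 / 2 * dotp (X z.2 z.1.1 - X z.2 z.1.2) (X z.2 z.1.1 - X z.2 z.1.2).
    apply: (near_diagonal flow It); first exact: f_cont.
      exact: f_gt0.
    by rewrite f_sq//; exact: GA.
  apply: filterS nd => y h Iy [yy]; apply/negP; rewrite -ltNge subr_gt0.
  exact: h.
have Z0 : 0 < Z z t.
  by rewrite ltNge; apply/negP => Zz; apply: nb.
have nZ := flow_cont_gt Z_cont It Z0.
by apply: filterS nZ => y h Iy [_]; apply/negP; rewrite -ltNge; exact: h.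
Qed.

Lemma dist2_derive (z : M * M) t : I t -> 0 < t ->
  is_derive (t : R) (1 : R) (dist2 z)
    (2 * (Hm z.2 t * dotp (D z t) (nu t z.2) - Hm z.1 t * dotp (D z t) (nu t z.1))).
Proof.
move=> It t0.
have d1 a : is_derive (t : R) (1 : R) (fun s => D z s 0 a)
    (- Hm z.1 t * nu t z.1 0 a - - Hm z.2 t * nu t z.2 0 a).
  have := is_deriveB (time_derive flow z.1 a It t0) (time_derive flow z.2 a It t0).
  have -> // : (fun s => D z s 0 a) = (fun s => X s z.1 0 a) - (fun s => X s z.2 0 a).
  by apply/funext => s; rewrite /D !mxE.
have d2 a := is_derive_mulf (d1 a) (d1 a).
apply: (is_derive_eq (is_derive_sumf d2)).
transitivity (\sum_a (2 * (Hm z.2 t * (D z t 0 a * nu t z.2 0 a))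
    - 2 * (Hm z.1 t * (D z t 0 a * nu t z.1 0 a)))).
  apply: eq_bigr => a _; cbv beta.
  by move: (D z t 0 a) (Hm _ _) (Hm _ _) (nu _ _ _ _) (nu _ _ _ _) => b c d e g; ring.
by rewrite sumrB -!mulr_sumr -mulrBr.
Qed.

(* Embeddedness is not assumed for positive times: as long as [Z > 0], the
   squared chord length decreases at most exponentially. *)
Lemma dist2_gt0 (z : M * M) t0 : I t0 -> 0 < t0 -> z.1 <> z.2 ->
  (forall y t, 0 <= t < t0 -> y.1 <> y.2 -> 0 < Z y t) -> 0 < dist2 z t0.
Proof.
move=> It0 t00 zz pos.
have It t : 0 <= t <= t0 -> I t.
  move=> /andP[tge tle]; split => //; case: It0 => _.
  by apply: le_lt_trans; rewrite lee_fin.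
pose C (y : M * M) t := `|Hm y.1 t| * f y.1 t + `|Hm y.2 t| * f y.2 t.
have cC : flow_cont T C.
  have [cH _] := curv_cont flow.
  have ch : flow_cont T (fun p t => `|Hm p t| * f p t).
    by apply: flow_contM f_cont; apply: (flow_cont_comp cH); exact: norm_continuous.
  by apply: flow_contD; [exact: (flow_cont_fst ch)|exact: (flow_cont_snd ch)].
have CC : - (C z t0 + 1) < - C z t0 by rewrite ltrN2 ltrDl.
have [[A B] /= [nA nB] sAB] := flow_cont_gt (flow_contN cC) It0 CC.
have /nbhs_ballP[e /= e0 be] := nB.
(* Late enough for [C] to stay below its value at [t0] plus 1, and positive so that time derivatives
   are two-sided. *)
pose t1 := Num.max (t0 / 2) (t0 - e / 2).
have t1lt : t1 < t0 by rewrite gt_max; apply/andP; split; lra.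
have t1ge : 0 < t1 by rewrite lt_max divr_gt0.
have Cle t : t1 < t < t0 -> C z t <= C z t0 + 1.
  move=> /andP[ta tb]; apply/ltW; rewrite -ltrN2.
  apply: (sAB (z, t) (conj (nbhs_singleton nA) _)).
    apply: be; rewrite /ball/= ltr_distlC; apply/andP; split.
      apply: lt_trans ta; apply: lt_le_trans (_ : t0 - e / 2 <= _); first by lra.
      by rewrite le_max lexx orbT.
    by apply: (lt_trans tb); rewrite ltrDl.
  by apply: It; rewrite !ltW//; exact: lt_trans ta.
pose d' t := 2 * (Hm z.2 t * dotp (D z t) (nu t z.2) - Hm z.1 t * dotp (D z t) (nu t z.1)).
apply: (@gronwall_gt0 R (dist2 z) d' (C z t0 + 1) t1 t0 t1lt).
- move=> t /andP[ta tb]; have tp : 0 < t := lt_le_trans t1ge ta.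
  by apply: dist2_derive => //; apply: It; rewrite ltW.
- move=> t /andP[ta tb].
  have tp : 0 < t := lt_trans t1ge ta.
  have tt : 0 <= t < t0 by rewrite tb ltW.
  have z1 := ltW (pos z t tt zz).
  have zz' : (z.2, z.1).1 <> (z.2, z.1).2 by move=> /esym.
  have z2 := ltW (pos (z.2, z.1) t tt zz').
  have Ct : C z t <= C z t0 + 1 by apply: Cle; rewrite ta.
  have DN : D (z.2, z.1) t = - D z t by rewrite /D /= opprB.
  rewrite /Z /dist2 DN !dotpN (dotpC _ (- D z t)) dotpN opprK normrN /= in z2.
  rewrite subr_ge0 in z2; rewrite subr_ge0 in z1.
  exact: (chord_rate (dotp_ge0 _) z1 z2 Ct).
have Z1 : 0 < Z z t1 by apply: (pos z t1 _ zz); rewrite t1lt ltW.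
rewrite lt_def dotp_ge0 andbT; apply/eqP => d0.
have : Z z t1 <= 0 by rewrite /Z d0 mulr0 sub0r oppr_le0.
by rewrite leNgt Z1.
Qed.

(** The normal is oriented so that its product with the chord is the absolute value at the touching
    pair. At other pairs it is at most the absolute value, so nonnegativity of the two-point
    function survives. *)
Lemma signed_patch (U : opn V) gX gN (p q : M) t x :
  flow_patch K U gX gN -> oset U (x, t) -> gN (x, t) = nu t p -> exists N sg,
  [/\ flow_patch K U gX N, (forall w, N w = sg *: gN w),
      (forall w, oset U w -> meanc gX N w ^+ 2 = meanc gX gN w ^+ 2 /\
        norm2c gX N w = norm2c gX gN w), (forall r, sg * r <= `|r|) &
      dotp (D (p, q) t) (N (x, t)) = `|dotp (D (p, q) t) (nu t p)|].
Proof.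
move=> fp Ux eN; have [h|h] := leP 0 (dotp (D (p, q) t) (nu t p)).
  exists gN, 1; split => //.
  - by move=> w; rewrite scale1r.
  - by move=> r; rewrite mul1r ler_norm.
  - by rewrite ger0_norm// eN.
exists (fun w => - gN w), (- 1); split.
- exact: flow_patch_opp.
- by move=> w; rewrite scaleN1r.
- move=> w Uw; rewrite (meanc_opp gX (fp_smN fp) Uw) sqrrN.
  by rewrite (norm2c_opp gX (fp_smN fp) Uw).
- by move=> r; rewrite mulN1r -normrN ler_norm.
- by rewrite ltr0_norm// dotpC dotpN eN dotpC.
Qed.

Theorem separation (z : M * M) t : I t -> z.1 <> z.2 -> 0 < Z z t.
Proof.
move: z t => z1 t1 It1 zz1; rewrite ltNge; apply/negP => b1.
have t10 : 0 <= t1 by case: It1.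
have sI t : 0 <= t <= t1 -> I t.
  by move=> /andP[tge tle]; split => //; case: It1 => _; apply: le_lt_trans; rewrite lee_fin.
pose bad (z : M * M) t := z.1 <> z.2 /\ Z z t <= 0.
have cMM : compact [set: M * M].
  by rewrite -setXTT; exact: compact_setX.
have nb0 z : ~ bad z 0.
  by move=> [zz]; rewrite leNgt init.
have nbn z t : 0 <= t <= t1 -> ~ bad z t ->
    \forall y \near ((z, t) : (M * M) * R), 0 <= y.2 <= t1 -> ~ bad y.1 y.2.
  move=> tt nb; have := near_not_bad (sI t tt) nb.
  by apply: filterS => y h yt; exact: h (sI _ yt).
have [[p0 q0] [t0 [t0in [zz Zle] nb]]] :=
  first_time cMM t10 (conj zz1 b1 : bad z1 t1) nb0 nbn.
have [t00 t01] := andP t0in.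
have It0 : I t0 by apply: sI; rewrite ltW.
have pos y t : 0 <= t < t0 -> y.1 <> y.2 -> 0 < Z y t.
  by move=> tt yy; rewrite ltNge; apply/negP => Zy; apply: (nb y t tt).
have nneg y t : 0 <= t <= t0 -> 0 <= Z y t.
  move=> /andP[tge tle]; have [yy|yy] := pselect (y.1 = y.2).
    by case: y yy => a b /= ->; rewrite Z_diag.
  have [tlt|tge'] := ltP t t0; first by apply/ltW/pos => //; rewrite tge.
  have -> : t = t0 by apply: le_anti; rewrite tle.
  by apply: (flow_cont_ge0 Z_cont It0 t00) => s ss; apply/ltW/pos.
have Z0 : Z (p0, q0) t0 = 0.
  by apply: le_anti; rewrite Zle nneg// lexx ltW.
have d0 := dist2_gt0 It0 t00 zz pos.
have [U [gX [gN [lr Uz fp hU]]]] := patch_at flow p0 It0 t00.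
have [U' [gX' [gN' [lr' Uz' fp' hU']]]] := patch_at flow q0 It0 t00.
set c := chart_at S p0 in lr Uz hU; set z := (chart_fwd c p0, t0) in Uz.
set c' := chart_at S q0 in lr' Uz' hU'; set z' := (chart_fwd c' q0, t0) in Uz'.
have cp : chart_bwd c (chart_fwd c p0) = p0 by apply: chart_fwdK; exact: chart_at_dom.
have cq : chart_bwd c' (chart_fwd c' q0) = q0 by apply: chart_fwdK; exact: chart_at_dom.
have eN : gN z = nu t0 p0 by rewrite -(lr_N lr Uz It0) -[in RHS]cp.
have eX : gX z = X t0 p0 by rewrite -(lr_X lr Uz It0) -[in RHS]cp.
have eX' : gX' z' = X t0 q0 by rewrite -(lr_X lr' Uz' It0) -[in RHS]cq.
have [N [sg [fpN Nsg NN sgr dN]]] := signed_patch q0 fp Uz eN.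
have GE w : oset U w -> (n%:R - 2 + al)^-1 * meanc gX N w ^+ 2 + 2 * (2 - al) * K
    - norm2c gX N w = G (chart_bwd c w.1) w.2.
  move=> Uw; have [-> ->] := NN w Uw; have [_ _ e1 e2] := hU w Uw.
  by rewrite /G /pinch e1 e2.
have ZE w w' : oset U w -> oset U' w' -> w.2 = w'.2 -> 0 <= w.2 <= t0 ->
    0 <= mu * Num.sqrt (G (chart_bwd c w.1) w.2) / 2 *
      dotp (gX w - gX' w') (gX w - gX' w') - dotp (gX w - gX' w') (N w).
  move=> Uw Uw' e2 tt; have [_ Iw _ _] := hU w Uw.
  have h := nneg (chart_bwd c w.1, chart_bwd c' w'.1) w.2 tt.
  have Iw' : I w'.2 by rewrite -e2.
  have e3 : D (chart_bwd c w.1, chart_bwd c' w'.1) w.2 = gX w - gX' w'.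
    by rewrite /D /= (lr_X lr Uw Iw) [in X in _ - X]e2 (lr_X lr' Uw' Iw').
  apply: (le_trans h); rewrite /Z /dist2 e3 lerB//.
  rewrite Nsg -[(_, _).1]/(chart_bwd c w.1) (lr_N lr Uw Iw) dotpC.
  have -> : dotp (sg *: gN w) (gX w - gX' w') = sg * dotp (gX w - gX' w') (gN w).
    by rewrite [in RHS]dotpC /dotp mulr_sumr; apply: eq_bigr => i _; rewrite mxE mulrA.
  exact: sgr.
apply: (@touching_contradiction R n K U U' gX N gX' gN' K0 fpN fp' al mu z z'
  n3 al0 al1 al3 Uz Uz' mu0).
- by move=> w Uw; rewrite (GE w Uw); apply: G0; have [] := hU w Uw.
- rewrite (GE z Uz) (NN z Uz).2; have [_ _ _ <-] := hU z Uz.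
  by rewrite -[(_, _).1]/(chart_fwd c p0) cp; exact/ltW/GA.
- rewrite (GE z Uz) (NN z Uz).1; have [_ _ <- _] := hU z Uz.
  by rewrite -[(_, _).1]/(chart_fwd c p0) cp; exact: GH.
- by rewrite eX eX'; exact: d0.
- by rewrite (GE z Uz) eX eX' dN cp; exact: Z0.
- move=> v w; apply: filterS (near_line (sdir v) Uz) => s _ Us Us'; rewrite (GE _ Us).
  have e1 : (s *: sdir v + z).2 = t0 by rewrite /= scaler0 add0r.
  have e2 : (s *: sdir w + z').2 = t0 by rewrite /= scaler0 add0r.
  by apply: (ZE _ _ Us Us'); [rewrite e1 e2|rewrite e1 lexx ltW].
- apply: filterS (near_line (tdir R n) Uz) => s _ s0 Us Us'; rewrite (GE _ Us).
  apply: (ZE _ _ Us Us') => //; have [/ltW -> _ _ _] := hU _ Us.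
  by rewrite /= /GRing.scale/= mulr1 gerDr ltW.
Qed.

End Separation.

Lemma quotient_bound (R : realType) (c d f : R) : 0 < d -> `|c| <= f / 2 * d ->
  - f <= 2 * c / d <= f.
Proof.
move=> d0; rewrite ler_norml => /andP[h1 h2].
rewrite ler_pdivlMr// ler_pdivrMr//.
move: h1 h2; rewrite [f / 2 * d]mulrAC mulNr; move: (f * d) => x.
by move=> h1 h2; apply/andP; split; move: h1 h2; lra.
Qed.

(** [quad_sff] at one basis vector exhibits a nonnegative lower bound, once divided by the positive
    square of its metric length. *)
Lemma sff_trace_ge0 (R : realFieldType) n m (F : 'M[R]_(n, m)) (h : 'M[R]_n) :
  (0 < n)%N -> F *m F^T \in unitmx ->
  0 <= \tr (invmx (F *m F^T) *m h *m invmx (F *m F^T) *m h^T).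
Proof.
move=> n0 ug; pose v : 'rV[R]_n := delta_mx 0 (Ordinal n0).
have h1 := quad_sff h v ug; have [C C0 /(_ v) vC] := gram_lower ug.
have v1 : 1 <= \sum_i v 0 i ^+ 2.
  rewrite (bigD1 (Ordinal n0))//= mxE !eqxx expr1n lerDl.
  by apply: sumr_ge0 => i _; exact: sqr_ge0.
have := lt_le_trans ltr01 (le_trans v1 vC); rewrite pmulr_rgt0// => q0.
by have := le_trans (sqr_ge0 _) h1; rewrite pmulr_lge0// exprn_gt0.
Qed.

(** * Initial bounds by compactness *)

Section Compactness.
Variables (R : realType) (n : nat) (K : R) (T : \bar R) (M : topologicalType).
Variables (S : smooth_atlas R n M) (X nu : R -> M -> 'rV[R]_n.+2).
Hypothesis K0 : 0 < K.
Hypothesis flow : mean_curvature_flow S K T X nu.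
Hypothesis cM : compact [set: M].
Hypothesis n3 : (3 <= n)%N.
Let I := time_interval T.
Let Am p t := sffnorm2 S (X t) (nu t) p.
Let D (z : M * M) t := X t z.1 - X t z.2.

Lemma sffnorm2_ge0 p t : I t -> 0 <= Am p t.
Proof.
move=> It; have [U [gX [gN [hU [aU [lr Uz ha]]]]]] := local_data flow p It.
have e := (lr_curv flow lr Uz It).2.
rewrite chart_fwdK in e; last exact: chart_at_dom.
rewrite /Am e /norm2c; set z := (_, _) in Uz *.
pose x a := mksf (smooth_coord a (lr_smX lr)).
have gE : (\matrix_(i, a) pdx i (x a) z) *m (\matrix_(i, a) pdx i (x a) z)^T = gram gX z.
  apply/matrixP => i j; rewrite !mxE; apply: eq_bigr => a _.
  by rewrite !mxE /pdx !sfder_coord.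
have ug := lr_unit flow lr Uz It; rewrite -gE in ug.
have n0 : (0 < n)%N by apply: leq_trans n3.
rewrite -gE; exact: (sff_trace_ge0 (secf gX gN z) n0 ug).
Qed.

Hypothesis T0 : (0 < T)%E.
Hypothesis injX : injective (X 0).

Lemma dist_gt0 z : z.1 <> z.2 -> 0 < dotp (D z 0) (D z 0).
Proof.
move=> zz; rewrite lt_def dotp_ge0 andbT; apply/eqP => /dotp_eq0 /eqP.
by rewrite subr_eq0 => /eqP/injX.
Qed.

Lemma near_chord_bound (z : M * M) : exists B : R, \forall y \near z,
  y.1 <> y.2 -> `|dotp (D y 0) (nu 0 y.1)| <= B / 2 * dotp (D y 0) (D y 0).
Proof.
have I0 : I 0 by split.
have [zz|zz] := pselect (z.1 = z.2).
  (* The square of |A|^2 + 1 exceeds |A|^2, as [near_diagonal] requires of its scale. *)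
  case: z zz => p q /= <-; pose B := Am p 0 + 1; exists B.
  have A0 := sffnorm2_ge0 p I0.
  have nd : \forall z \near (((p, p), 0) : (M * M) * R), I z.2 -> z.1.1 <> z.1.2 ->
      `|dotp (X z.2 z.1.1 - X z.2 z.1.2) (nu z.2 z.1.1)| <
      B / 2 * dotp (X z.2 z.1.1 - X z.2 z.1.2) (X z.2 z.1.1 - X z.2 z.1.2).
    apply: (near_diagonal (f := fun _ _ => B) flow I0).
    - exact: cvg_cst.
    - by rewrite /B; lra.
    - by rewrite /B -/(Am p 0); move: (Am p 0) A0 => a a0; nra.
  move: nd => [[A1 B1] /= [nA nB] sAB].
  apply: filterS nA => y Ay yy; apply/ltW.
  exact: (sAB (y, 0) (conj Ay (nbhs_singleton nB)) I0 yy).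
have d0 := dist_gt0 zz.
set c := `|dotp (D z 0) (nu 0 z.1)|.
(* With this [B] the right-hand side is c + 1 at the pair [z] itself, which leaves room for
   continuity. *)
pose B := 2 * (c + 1) / dotp (D z 0) (D z 0); exists B.
pose h (y : M * M) t := B / 2 * dotp (D y t) (D y t) - `|dotp (D y t) (nu t y.1)|.
have ch : flow_cont T h.
  have c1 : flow_cont T (fun (z : (M * M)%type) t => dotp (D z t) (nu t z.1)).
    exact: (chord_cont flow).
  have c2 : flow_cont T (fun (z : (M * M)%type) t => dotp (D z t) (D z t)).
    exact: (dist2_cont flow).
  apply: flow_contD; first by apply: flow_contM c2; exact: flow_cont_cst.
  by apply: flow_contN; apply: (flow_cont_comp c1); exact: norm_continuous.
have h0 : 0 < h z 0.
  rewrite /h -/c /B; move: d0; move: (dotp _ _) => d d0.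
  have -> : 2 * (c + 1) / d / 2 * d = c + 1 by field; rewrite gt_eqF.
  by rewrite addrAC subrr add0r.
have [[A1 B1] /= [nA nB] sAB] := flow_cont_gt ch I0 h0.
apply: filterS nA => y Ay yy.
have := sAB (y, 0) (conj Ay (nbhs_singleton nB)) I0.
by rewrite subr_gt0 => /ltW.
Qed.

(** This bounds the initial ball curvatures uniformly and so makes the two initial ratios finite.
    The local bounds are merged by a covering argument along the filter at infinity, the property
    being monotone in [B]. *)
Lemma chord_bound : exists B : R, forall z : M * M, z.1 <> z.2 ->
  `|dotp (D z 0) (nu 0 z.1)| <= B / 2 * dotp (D z 0) (D z 0).
Proof.
have cMM : compact [set: M * M].
  by rewrite -setXTT; exact: compact_setX.
pose P (B : R) (z : M * M) := z.1 <> z.2 ->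
  `|dotp (D z 0) (nu 0 z.1)| <= B / 2 * dotp (D z 0) (D z 0).
have cc := (compact_near_coveringP _).1 cMM.
have pf : ProperFilter (pinfty_nbhs R) by exact: proper_pinfty_nbhs.
have h (z : M * M) : [set: M * M] z -> \forall y \near z & B \near (pinfty_nbhs R), P B y.
  move=> _; have [B0 nB0] := near_chord_bound z.
  exists ([set y : M * M | y.1 <> y.2 ->
    `|dotp (D y 0) (nu 0 y.1)| <= B0 / 2 * dotp (D y 0) (D y 0)], [set B | B0 <= B]) => /=.
    by split; [exact: nB0|by apply: nbhs_pinfty_ge; exact: num_real].
  move=> [y B] /= [hy hB] yy; apply: (le_trans (hy yy)).
  by rewrite ler_wpM2r ?dotp_ge0// ler_pM2r ?invr_gt0.
have [B hB] := filter_ex (cc R (pinfty_nbhs R) P pf h).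
by exists B => z; exact: hB.
Qed.

End Compactness.

(** * The initial ratios and the constant *)

Lemma two_sided (R : realType) (u v a b c : R) : - u <= a -> b <= v -> 0 <= u -> 0 <= v ->
  a <= c -> c <= b -> - (u + v) <= c <= u + v.
Proof. by move=> *; apply/andP; split; lra. Qed.

Section Ratios.
Variables (R : realType) (n : nat) (K : R) (M : topologicalType).
Variables (S : smooth_atlas R n M) (F N : M -> 'rV[R]_n.+2).
Hypothesis K0 : 0 < K.
Hypothesis injF : injective F.

Lemma curv_scale_gt0 p : 0 < curv_scale S K F N p.
Proof. by rewrite ltr_wpDl// sqrtr_gt0. Qed.

Lemma curv_scale_ge p : Num.sqrt K <= curv_scale S K F N p.
Proof. by rewrite lerDr. Qed.

Variable B : R.
Hypothesis hB : forall p q, p <> q -> `|ball_curv F N p (F q)| <= B.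

(** The bound [B] confines both extended ratios to a finite interval, so [fine] returns their true
    values. The sum of their absolute values controls the ball curvature from both sides. *)
Lemma ratio_bound p q : p <> q -> `|ball_curv F N p (F q)| <=
  (`|fine (min_exscribed_ratio S K F N)| + `|fine (max_inscribed_ratio S K F N)|)
  * curv_scale S K F N p.
Proof.
move=> pq.
have B0 : 0 <= B := le_trans (normr_ge0 _) (hB pq).
have s0 p' := curv_scale_gt0 p'.
have r0 : 0 < Num.sqrt K by rewrite sqrtr_gt0.
have ball_le p' : forall x, [set (ball_curv F N p' q)%:E | q in range F `\ F p'] x ->
    (- B%:E <= x <= B%:E)%E.
  move=> _ [_ [[q' _ <-] ne] <-]; rewrite -EFinN !lee_fin -ler_norml; apply: hB.
  by move=> e; apply: ne; rewrite e.
have scl p' : B * (curv_scale S K F N p')^-1 <= B / Num.sqrt K.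
  by rewrite ler_wpM2l// lef_pV2 ?posrE// curv_scale_ge.
have inE : [set (ball_curv F N p q)%:E | q in range F `\ F p] (ball_curv F N p (F q))%:E.
  by exists (F q) => //; split; [exists q|move=> /injF e; apply: pq].
set m := min_exscribed_ratio S K F N; set Mx := max_inscribed_ratio S K F N.
have mle : (m <= (ball_curv F N p (F q) * (curv_scale S K F N p)^-1)%:E)%E.
  apply: (@le_trans _ _ (exscribed_curv F N p * (curv_scale S K F N p)^-1%:E)%E).
    by apply: ereal_inf_lbound; exists p.
  rewrite EFinM; apply: lee_wpmul2r; first by rewrite lee_fin invr_ge0 ltW.
  exact: ereal_inf_lbound.
have Mge : ((ball_curv F N p (F q) * (curv_scale S K F N p)^-1)%:E <= Mx)%E.
  apply: (@le_trans _ _ (inscribed_curv F N p * (curv_scale S K F N p)^-1%:E)%E).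
    rewrite EFinM; apply: lee_wpmul2r; first by rewrite lee_fin invr_ge0 ltW.
    exact: ereal_sup_ubound.
  by apply: ereal_sup_ubound; exists p.
have mge : ((- (B / Num.sqrt K))%:E <= m)%E.
  apply: le_ereal_inf_tmp => _ [p' _ <-].
  apply: (@le_trans _ _ ((- B)%:E * (curv_scale S K F N p')^-1%:E)%E).
    by rewrite -EFinM lee_fin mulNr lerN2.
  apply: lee_wpmul2r; first by rewrite lee_fin invr_ge0 ltW.
  by apply: le_ereal_inf_tmp => x /ball_le /andP[].
have Mle : (Mx <= (B / Num.sqrt K)%:E)%E.
  apply: ge_ereal_sup => _ [p' _ <-].
  apply: (@le_trans _ _ (B%:E * (curv_scale S K F N p')^-1%:E)%E); last first.
    by rewrite -EFinM lee_fin.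
  apply: lee_wpmul2r; first by rewrite lee_fin invr_ge0 ltW.
  by apply: ge_ereal_sup => x /ball_le /andP[].
move: m Mx mle Mge mge Mle => [m||] [Mx||]//=; rewrite !lee_fin => mle Mge _ _.
rewrite ler_pdivrMr// in Mge; rewrite ler_pdivlMr// in mle.
have e1 : - (`|m| * curv_scale S K F N p) <= m * curv_scale S K F N p.
  by rewrite -mulNr; apply: ler_wpM2r; [exact: ltW|rewrite lerNl -normrN ler_norm].
have e2 : Mx * curv_scale S K F N p <= `|Mx| * curv_scale S K F N p.
  by apply: ler_wpM2r; [exact: ltW|exact: ler_norm].
have e3 : 0 <= `|m| * curv_scale S K F N p by rewrite mulr_ge0// ltW.
have e4 : 0 <= `|Mx| * curv_scale S K F N p by rewrite mulr_ge0// ltW.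
rewrite mulrDl ler_norml; move: e1 e2 e3 e4 mle Mge; exact: two_sided.
Qed.

End Ratios.

(** Used to exchange |H| + sqrt K for sqrt (H^2 + K), which is what G controls. *)
Lemma hypot_bounds (R : realType) (h k q : R) : 0 <= h -> 0 <= k -> 0 <= q ->
  q ^+ 2 = h ^+ 2 + k ^+ 2 -> h + k <= 2 * q /\ q <= h + k.
Proof.
move=> h0 k0 q0 e; have hk : 0 <= h * k by rewrite mulr_ge0.
have hk2 : 0 <= (h - k) ^+ 2 by exact: sqr_ge0.
split; rewrite -ler_sqr ?nnegrE ?addr_ge0 ?mulr_ge0//.
  have -> : (2 * q) ^+ 2 = (h + k) ^+ 2 + 3 * (h - k) ^+ 2 + 4 * (h * k).
    by rewrite exprMn e; ring.
  by rewrite -!addrA lerDl !addr_ge0// mulr_ge0.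
have -> : (h + k) ^+ 2 = q ^+ 2 + 2 * (h * k) by rewrite e; ring.
by rewrite lerDl mulr_ge0.
Qed.

Lemma half_gap (R : realFieldType) (a f d : R) : 2 * a < f * d -> 0 < f / 2 * d - a.
Proof. by rewrite [f / 2 * d]mulrAC; move: (f * d) => x h; lra. Qed.

(** * Comparison of pinching exponents and choice of the constant *)

Section Constants.
Variables (R : realType) (n : nat).
Hypothesis n3 : (3 <= n)%N.

Let b (al : R) := n%:R - 2 + al.

Lemma pinch_den_ge1 al : 0 < al -> 1 <= b al.
Proof.
move=> al0; have : (3 : R) <= n%:R by rewrite ler_nat.
by rewrite /b; move: (n%:R : R) => x; lra.
Qed.

Lemma pinch_den_gt0 al : 0 < al -> 0 < b al.
Proof. by move=> al0; apply: lt_le_trans (pinch_den_ge1 al0). Qed.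

Lemma pinch_coef_lt al al' : 0 < al -> al < al' -> (b al')^-1 < (b al)^-1.
Proof.
move=> al0 lt; have al0' := lt_trans al0 lt.
by rewrite ltf_pV2 ?posrE ?pinch_den_gt0// /b ltrD2l.
Qed.

(** Lowering the exponent raises both the coefficient of H^2 and that of K, while |A|^2 cancels in
    the difference. *)
Lemma pinch_gap al al' H K A : 0 < al -> al < al' -> 0 <= K ->
  Num.min ((b al)^-1 - (b al')^-1) (2 * (al' - al)) * (H ^+ 2 + K) <=
  ((b al)^-1 * H ^+ 2 + 2 * (2 - al) * K - A)
  - ((b al')^-1 * H ^+ 2 + 2 * (2 - al') * K - A).
Proof.
move=> al0 lt K0; set c := Num.min _ _.
have c1 : c <= (b al)^-1 - (b al')^-1 by rewrite ge_min lexx.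
have c2 : c <= 2 * (al' - al) by rewrite ge_min lexx orbT.
have h1 : c * H ^+ 2 <= ((b al)^-1 - (b al')^-1) * H ^+ 2 by rewrite ler_wpM2r ?sqr_ge0.
have h2 : c * K <= 2 * (al' - al) * K by rewrite ler_wpM2r.
apply: (le_trans (_ : _ <= ((b al)^-1 - (b al')^-1) * H ^+ 2 + 2 * (al' - al) * K)).
  by rewrite mulrDr lerD.
rewrite le_eqVlt; apply/orP; left; apply/eqP.
by move: (_^-1) (_^-1) (H ^+ 2) => x y z; ring.
Qed.

Lemma pinch_upper al H K : 0 < al -> 0 <= K ->
  (b al)^-1 * H ^+ 2 + 2 * (2 - al) * K <= 4 * (H ^+ 2 + K).
Proof.
move=> al0 K0.
have h1 : (b al)^-1 * H ^+ 2 <= 1 * H ^+ 2.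
  rewrite ler_wpM2r ?sqr_ge0// invf_le1 ?pinch_den_ge1//; exact: pinch_den_gt0.
have h2 : 2 * (2 - al) * K <= 4 * K by rewrite ler_wpM2r//; lra.
have h3 : 1 * H ^+ 2 <= 4 * H ^+ 2 by rewrite ler_wpM2r ?sqr_ge0// ler1n.
by rewrite [X in _ <= X]mulrDr; exact: lerD (le_trans h1 h3) h2.
Qed.

End Constants.

Section Final.
Variables (R : realType) (n : nat) (K : R) (T : \bar R) (M : topologicalType).
Variables (S : smooth_atlas R n M) (X nu : R -> M -> 'rV[R]_n.+2).
Variables (alpha al1 al2 : R).
Hypotheses (n3 : (3 <= n)%N) (al10 : 0 < al1) (al12 : al1 < al2) (al2a : al2 < alpha).
Hypotheses (alpha1 : alpha < 1) (al13 : n = 3%N -> 2 / 3 < al1).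
Hypotheses (K0 : 0 < K) (T0 : (0 < T)%E) (cM : compact [set: M]).
Hypothesis flow : mean_curvature_flow S K T X nu.
Hypothesis injX : injective (X 0).
Hypothesis pinched : forall p, sffnorm2 S (X 0) (nu 0) p <=
  (n%:R - 2 + alpha)^-1 * meancurv S (X 0) (nu 0) p ^+ 2 + 2 * (2 - alpha) * K.
Let I := time_interval T.
Let Hm p t := meancurv S (X t) (nu t) p.
Let Am p t := sffnorm2 S (X t) (nu t) p.
Let kappa := Num.min ((n%:R - 2 + al1)^-1 - (n%:R - 2 + al2)^-1) (2 * (al2 - al1)).
Let sc t p := curv_scale S K (X t) (nu t) p.

Lemma kappa_gt0 : 0 < kappa.
Proof. by rewrite lt_min subr_gt0 (pinch_coef_lt n3)// mulr_gt0// subr_gt0. Qed.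

(** The hypothesis for [alpha] is not strict. Passing to al2 < alpha gains a multiple of H^2 + K >
    0, which the maximum principle can start from; [pinch1_gt] repeats the gain to make it
    quantitative. *)
Lemma pinch2_gt0 p t : I t -> 0 < pinch K S X nu al2 p t.
Proof.
have al20 := lt_trans al10 al12.
move: p t; apply: (pinch_positive K0 flow cM n3 al20 (lt_trans al2a alpha1)).
  by move=> /al13 h; exact: lt_trans h al12.
move=> p; have h := pinch_gap n (meancurv S (X 0) (nu 0) p)
  (sffnorm2 S (X 0) (nu 0) p) al20 al2a (ltW K0).
have c0 : 0 < Num.min ((n%:R - 2 + al2)^-1 - (n%:R - 2 + alpha)^-1) (2 * (alpha - al2)).
  by rewrite lt_min subr_gt0 (pinch_coef_lt n3)// mulr_gt0// subr_gt0.
have hK : 0 < meancurv S (X 0) (nu 0) p ^+ 2 + K by rewrite ltr_wpDl// sqr_ge0.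
have := lt_le_trans (mulr_gt0 c0 hK) h; rewrite subr_gt0 => h2.
by apply: le_lt_trans h2; rewrite subr_ge0; exact: pinched.
Qed.

Lemma pinch1_gt p t : I t -> kappa * (Hm p t ^+ 2 + K) < pinch K S X nu al1 p t.
Proof.
move=> It; have h := pinch_gap n (Hm p t) (Am p t) al10 al12 (ltW K0).
by apply: (le_lt_trans h); rewrite ltrBlDr ltrDl; exact: pinch2_gt0.
Qed.

Lemma sff_lt p t : I t -> Am p t < 4 * (Hm p t ^+ 2 + K).
Proof.
move=> It; apply: lt_le_trans (pinch_upper n3 (Hm p t) (lt_trans al10 al12) (ltW K0)).
by have := pinch2_gt0 p It; rewrite subr_gt0.
Qed.

Lemma pinch1_le p t : I t -> pinch K S X nu al1 p t <= 4 * (Hm p t ^+ 2 + K).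
Proof.
move=> It; apply: le_trans (pinch_upper n3 (Hm p t) al10 (ltW K0)).
by rewrite /pinch gerBl; exact: (sffnorm2_ge0 flow n3).
Qed.

Lemma scale_bounds p t : sc t p <= 2 * Num.sqrt (Hm p t ^+ 2 + K) /\
  Num.sqrt (Hm p t ^+ 2 + K) <= sc t p.
Proof.
apply: hypot_bounds; rewrite ?normr_ge0 ?sqrtr_ge0//.
by rewrite real_normK ?num_real// !sqr_sqrtr// ?addr_ge0 ?sqr_ge0// ltW.
Qed.

Lemma ball_curv_le r : 0 <= r ->
  (forall p q, p <> q -> `|ball_curv (X 0) (nu 0) p (X 0 q)| <= r * sc 0 p) ->
  forall t p q, I t -> p <> q ->
    `|ball_curv (X t) (nu t) p (X t q)| <= 4 * (r + 1) / Num.sqrt kappa * sc t p.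
Proof.
move=> r0 init; have k0 := kappa_gt0.
have sk0 : 0 < Num.sqrt kappa by rewrite sqrtr_gt0.
(* Chosen so that mu^2 G >= 4 (r+1)^2 (H^2 + K), which dominates |A|^2 and H^2. The factor 2 pays
   for |H| + sqrt K <= 2 sqrt (H^2 + K), and r + 1 instead of [r] makes the initial inequality
   strict. *)
pose mu := 2 * (r + 1) / Num.sqrt kappa.
have mu0 : 0 < mu by rewrite divr_gt0// mulr_gt0// ltr_wpDl.
have muk : mu * Num.sqrt kappa = 2 * (r + 1) by rewrite divfK// gt_eqF.
have mu2k : mu ^+ 2 * kappa = 4 * (r + 1) ^+ 2.
  by rewrite -[in LHS](sqr_sqrtr (ltW k0)) -exprMn muk exprMn; congr (_ * _); ring.
have HK p t : 0 < Hm p t ^+ 2 + K by rewrite ltr_wpDl// sqr_ge0.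
have Gge p t : I t -> 4 * (Hm p t ^+ 2 + K) <= mu ^+ 2 * pinch K S X nu al1 p t.
  move=> It; apply: (le_trans (_ : _ <= mu ^+ 2 * (kappa * (Hm p t ^+ 2 + K)))).
    rewrite mulrA mu2k ler_wpM2r//; first exact: ltW.
    by rewrite ler_pMr// exprn_ege1// lerDr.
  by rewrite ler_pM2l ?exprn_gt0//; apply/ltW/pinch1_gt.
have G0 p t : I t -> 0 < pinch K S X nu al1 p t.
  by move=> It; apply: lt_trans (pinch1_gt p It); rewrite mulr_gt0.
have GA p t : I t -> Am p t < mu ^+ 2 * pinch K S X nu al1 p t.
  by move=> It; apply: (lt_le_trans (sff_lt p It)); exact: Gge.
have GH p t : I t -> Hm p t ^+ 2 <= mu ^+ 2 * pinch K S X nu al1 p t.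
  move=> It; apply: le_trans (Gge p t It).
  apply: (@le_trans _ _ (Hm p t ^+ 2 + K)); first by rewrite lerDl ltW.
  by rewrite ler_peMl ?ler1n// ltW.
have I0 : I 0 by split.
have fge p t : I t -> r * sc t p < mu * Num.sqrt (pinch K S X nu al1 p t).
  move=> It; apply: (@lt_le_trans _ _ ((r + 1) * sc t p)).
    by rewrite ltr_pM2r ?ltrDl//; exact: curv_scale_gt0.
  apply: (@le_trans _ _ (mu * (Num.sqrt kappa * Num.sqrt (Hm p t ^+ 2 + K)))).
    rewrite mulrA muk [2 * (r + 1)]mulrC -mulrA ler_wpM2l ?addr_ge0//.
    by have [] := scale_bounds p t.
  rewrite ler_pM2l// -(sqrtrM _ (ltW k0)); apply: ler_wsqrtr.
  exact/ltW/pinch1_gt.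
have init' (z : M * M) : z.1 <> z.2 -> 0 < mu * Num.sqrt (pinch K S X nu al1 z.1 0) / 2 *
    dotp (X 0 z.1 - X 0 z.2) (X 0 z.1 - X 0 z.2)
    - `|dotp (X 0 z.1 - X 0 z.2) (nu 0 z.1)|.
  move=> zz; have d0 := dist_gt0 injX zz; rewrite /= in d0.
  have := le_lt_trans (init _ _ zz) (fge z.1 0 I0).
  rewrite /ball_curv normrM normfV (gtr0_norm d0) ltr_pdivrMr// normrM gtr0_norm//.
  exact: half_gap.
move=> t p q It pq.
have Z := separation K0 flow cM n3 al10 (lt_trans al12 (lt_trans al2a alpha1)) al13
  mu0 G0 GA GH init' (z := (p, q)) It pq.
rewrite /= subr_gt0 in Z.
have d0 : 0 < dotp (X t p - X t q) (X t p - X t q).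
  rewrite lt_def dotp_ge0 andbT; apply/eqP => d0.
  by move: Z; rewrite d0 mulr0 ltNge normr_ge0.
have := quotient_bound d0 (ltW Z); rewrite -ler_norml => h.
(* Back from G to the curvature scale: G <= 4 (H^2 + K) gives sqrt G <= 2 (|H| + sqrt K), so the
   final constant is 2 mu. *)
apply: (le_trans h); apply: (@le_trans _ _ (mu * (2 * sc t p))).
  rewrite ler_pM2l//; apply: (@le_trans _ _ (2 * Num.sqrt (Hm p t ^+ 2 + K))).
    have -> : 2 * Num.sqrt (Hm p t ^+ 2 + K) = Num.sqrt (4 * (Hm p t ^+ 2 + K)).
      by rewrite sqrtrM// (_ : 4 = 2 ^+ 2) ?sqrtr_sqr ?ger0_norm//; ring.
    by apply: ler_wsqrtr; exact: pinch1_le.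
  by rewrite ler_pM2l//; have [] := scale_bounds p t.
rewrite le_eqVlt; apply/orP; left; apply/eqP; rewrite /mu.
by field; rewrite gt_eqF.
Qed.

End Final.

Lemma pinch_exponents (R : realType) (n : nat) (alpha : R) : 0 < alpha < 1 ->
  (n = 3%N -> 2 / 3 < alpha) -> exists al1 al2, [/\ 0 < al1, al1 < al2,
    al2 < alpha & n = 3%N -> 2 / 3 < al1].
Proof.
(* [th] is the lower limit of the admissible exponents; [al2] is the midpoint of [th] and [alpha],
   [al1] that of [th] and [al2]. *)
move=> /andP[a0 a1] a3; pose th : R := if n == 3%N then 2 / 3 else 0.
have th0 : 0 <= th by rewrite /th; case: ifP => _ //; lra.
have tha : th < alpha by rewrite /th; case: eqP => [/a3|].
have th3 : n = 3%N -> th = 2 / 3 by rewrite /th => ->.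
exists (((alpha + th) / 2 + th) / 2), ((alpha + th) / 2).
by split=> [|||/th3 <-]; lra.
Qed.

Unset Implicit Arguments.
Set Strict Implicit.
Set Printing Implicit Defensive.

Theorem corollary3p3 (R : realType) (n : nat) (alpha : R)
    (hn : (3 <= n)%N) (halpha : 0 < alpha < 1)
    (halpha3 : n = 3%N -> 2 / 3 < alpha) :
  exists mu : \bar R -> \bar R -> R,
    forall (K : R) (T : \bar R) (M : topologicalType) (S : smooth_atlas R n M)
           (X nu : R -> M -> 'rV[R]_n.+2),
      0 < K -> (0 < T)%E ->
      closed_manifold_space M ->
      mean_curvature_flow S K T X nu ->
      embedding S (X 0) ->
      (forall p, sffnorm2 S (X 0) (nu 0) p <=
         (n%:R - 2 + alpha)^-1 * meancurv S (X 0) (nu 0) p ^+ 2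
         + 2 * (2 - alpha) * K) ->
      let mu0 := mu (min_exscribed_ratio S K (X 0) (nu 0))
                    (max_inscribed_ratio S K (X 0) (nu 0)) in
      forall t p, time_interval T t ->
        ((- mu0 * curv_scale S K (X t) (nu t) p)%:E
           <= exscribed_curv (X t) (nu t) p)%E /\
        (inscribed_curv (X t) (nu t) p
           <= (mu0 * curv_scale S K (X t) (nu t) p)%:E)%E.
Proof.
have [al1 [al2 [al10 al12 al2a al13]]] := pinch_exponents halpha halpha3.
have [_ alpha1] := andP halpha.
pose kappa := Num.min ((n%:R - 2 + al1)^-1 - (n%:R - 2 + al2)^-1) (2 * (al2 - al1)).
(* The constant of [ball_curv_le] with [r] the sum of the absolute values of the ratios; [kappa]
   involves [n] and [alpha] only. On infinite values [fine] is 0, but the ratios met below are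
   finite by [chord_bound]. *)
exists (fun m Mx => 4 * ((`|fine m| + `|fine Mx|) + 1) / Num.sqrt kappa).
move=> K T M S X nu K0 T0 [_ _ cM] flow [_ _ injX _] pinched mu0 t p It.
have [B hB] := chord_bound flow cM hn T0 injX.
have bound0 p' q : p' <> q -> `|ball_curv (X 0) (nu 0) p' (X 0 q)| <= B.
  move=> pq; rewrite ler_norml; apply: quotient_bound; last exact: (hB (p', q)).
  exact: (dist_gt0 injX (z := (p', q))).
have r0 : 0 <= `|fine (min_exscribed_ratio S K (X 0) (nu 0))| +
    `|fine (max_inscribed_ratio S K (X 0) (nu 0))| by rewrite addr_ge0.
have bound q : p <> q -> `|ball_curv (X t) (nu t) p (X t q)| <=
    mu0 * curv_scale S K (X t) (nu t) p.
  move=> pq; apply: (ball_curv_le hn al10 al12 al2a alpha1 al13 K0 T0 cM flow injX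
    pinched r0 _ It pq) => p' q' pq'.
  exact: (ratio_bound S K0 injX bound0 pq').
split.
  apply: le_ereal_inf_tmp => _ [_ [[q _ <-] ne] <-]; rewrite lee_fin mulNr.
  have pq : p <> q by move=> e; apply: ne; rewrite e.
  by have := bound q pq; rewrite ler_norml => /andP[].
apply: ge_ereal_sup => _ [_ [[q _ <-] ne] <-]; rewrite lee_fin.
have pq : p <> q by move=> e; apply: ne; rewrite e.
by have := bound q pq; rewrite ler_norml => /andP[].
Qed.
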